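(* The Identification problem can be solved in $n^{\mathcal{O}(\ell^2)}$ time on instances $(G,F)$ where $G$ has $n$ vertices and $F$ is a forest with $\ell$ leaves.
   Context: All graphs are finite, simple and undirected. An identification of two distinct vertices $u,v$ replaces them with a new vertex adjacent to every vertex of $(N(u)\cup N(v))\setminus\{u,v\}$. The Identification problem takes as input two graphs $G$ and $H$ and asks whether $G$ can be transformed into a graph isomorphic to $H$ by a (possibly empty) sequence of identifications. A leaf of a forest is a vertex of degree at most $1$ (isolated vertices are leaves). *)

(* Defs.v *)
From mathcomp Require Import all_boot.

Set Implicit Arguments.
Unset Strict Implicit.
Unset Printing Implicit Defensive.

(** * Graphs *)

Record sgraph := SGraph {
  vertex :> finType;
  adj : rel vertex;
  adj_sym : symmetric adj;
  adj_irrefl : irreflexive adj }.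

Definition graph_iso (G H : sgraph) : Prop :=
  exists2 f : G -> H, bijective f & {mono f : x y / adj x y >-> adj x y}.

Definition degree (G : sgraph) (x : G) : nat := #|[set y : G | adj x y]|.

Definition leaves (G : sgraph) : {set G} := [set x : G | degree x <= 1].

(* [ucycle] also accepts the closed walk x, y, x along a single edge; this is
   the only reason for tolerating duplicate-free closed walks of size 2. *)
Definition is_forest (G : sgraph) : Prop :=
  forall c : seq G, ucycle (@adj G) c -> size c <= 2.

(** * Identifications *)

Section Identify.
Variables (G : sgraph) (u v : G).

(* [None] is the new vertex. *)
Definition identify_vertex : finType := option {x : G | (x != u) && (x != v)}.

Definition identify_adj (a b : identify_vertex) : bool :=
  match a, b with
  | Some x, Some y => adj (val x) (val y)
  | Some x, None | None, Some x => adj u (val x) || adj v (val x)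
  | None, None => false
  end.

Lemma identify_adj_sym : symmetric identify_adj.
Proof. by move=> [x|] [y|] //=; rewrite adj_sym. Qed.

Lemma identify_adj_irrefl : irreflexive identify_adj.
Proof. by move=> [x|] //=; rewrite adj_irrefl. Qed.

Definition identify : sgraph := SGraph identify_adj_sym identify_adj_irrefl.

End Identify.

Inductive identifies_to (H : sgraph) : sgraph -> Prop :=
| identifies_iso (G : sgraph) : graph_iso G H -> identifies_to H G
| identifies_step (G : sgraph) (u v : G) :
    u != v -> identifies_to H (identify u v) -> identifies_to H G.

Definition Identification (G H : sgraph) : Prop := identifies_to H G.

(** * Random access machines

  The usual unit-cost RAM with addition and truncated subtraction (and no
  multiplication, so that unit cost is polynomially related to Turing machine
  time), a read-only input array and an unbounded read-write memory that is
  initially 0 everywhere.  One step executes one instruction; the machine halts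
  when the program counter leaves the program. *)

Inductive instr :=
| IConst of nat & nat        (* M[r] := k *)
| IAdd of nat & nat & nat    (* M[r] := M[s] + M[t] *)
| ISub of nat & nat & nat    (* M[r] := M[s] - M[t] *)
| ILoad of nat & nat         (* M[r] := M[M[s]] *)
| IStore of nat & nat        (* M[M[r]] := M[s] *)
| IRead of nat & nat         (* M[r] := input[M[s]], 0 beyond the end *)
| IJumpZ of nat & nat.       (* if M[r] = 0 then goto k *)

Definition program := seq instr.

Record config := Config { pc : nat; memory : nat -> nat }.

Definition update (M : nat -> nat) (a x : nat) : nat -> nat :=
  fun b => if b == a then x else M b.

Definition exec_instr (input : seq nat) (i : instr) (c : config) : config :=
  let: Config p M := c in
  match i with
  | IConst r k => Config p.+1 (update M r k)
  | IAdd r s t => Config p.+1 (update M r (M s + M t))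
  | ISub r s t => Config p.+1 (update M r (M s - M t))
  | ILoad r s => Config p.+1 (update M r (M (M s)))
  | IStore r s => Config p.+1 (update M (M r) (M s))
  | IRead r s => Config p.+1 (update M r (nth 0 input (M s)))
  | IJumpZ r k => Config (if M r == 0 then k else p.+1) M
  end.

Definition halted (P : program) (c : config) : bool := size P <= pc c.

Definition step (P : program) (input : seq nat) (c : config) : config :=
  if halted P c then c
  else exec_instr input (nth (IConst 0 0) P (pc c)) c.

Definition run (P : program) (input : seq nat) (t : nat) : config :=
  iter t (step P input) (Config 0 (fun=> 0)).

(* P halts on the input after at most T steps, and its final answer, stored in
   M[0] with 0 meaning "no", is correct for the question A. *)
Definition answers_within
    (P : program) (input : seq nat) (A : Prop) (T : nat) : Prop :=
  exists t : nat, [/\ t <= T, halted P (run P input t)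
    & (memory (run P input t) 0 != 0) <-> A].

(** * Instances

  The orders of both graphs, followed by their adjacency matrices, row by row,
  with respect to the canonical enumerations of the vertex types. *)

Definition adj_matrix (G : sgraph) : seq nat :=
  [seq nat_of_bool (adj x y) | x <- enum G, y <- enum G].

Definition encode (G H : sgraph) : seq nat :=
  [:: #|G|, #|H| & adj_matrix G ++ adj_matrix H].

(* Main.v *)
Require Import Defs.
From Stdlib Require Import Classical.
From mathcomp Require Import all_boot zify.

Set Implicit Arguments.
Unset Strict Implicit.
Unset Printing Implicit Defensive.

(** G can be identified to F exactly when there is a map f from G to F that sends
  each edge to a vertex or an edge and hits every vertex and every edge.  On a
  component C of G such a map extends prescribed values f(u_i) = x_i ("pins") as
  soon as d_F(x_i, x_j) <= d_G(u_i, u_j), because trees have the Helly property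
  for balls, and the image then contains all edges separating two of the x_i.

  Given a valid f, cut F at its O(l) vertices that do not have exactly one child.
  On each of the resulting paths at most two components, reaching furthest from
  either end, are needed among those whose image leaves the path; pinning O(l)
  vertices in each of these O(l) components forces all the edges they cover.
  What remains of each path is an interval (a "demand"), covered by components
  mapped inside the path, and there only the diameters matter: such components
  may be rearranged freely, so it suffices that for some assignment of components
  to demands the diameters add up to the lengths.

  Hence it is enough to enumerate the n^O(l^2) choices of pins and demands, and to
  decide the bin covering problem for the demands by dynamic programming over the
  n^O(l) vectors of covered lengths. *)

(** * A language of bounded loops *)

(** The obstacle is that G may have many components while only [n^O(l^2)] objects can be guessed. At
    most two components per cut vertex are pinned, hence at most [4l], with at most [l + 1] pins
    each; since [(l + 1) * 4l <= 8l^2] for [l >= 1], all pins fit in [8l^2] digits. Vertices and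
    lengths are digits in base [n + 2], so each guessed list is a single number below
    [N = (n + 2)^(8l^2)]. Loops and tables of length [N], nested to a constant depth, then cost a
    power of [N], and the exponent in the claim comes from [N] alone.

    The number [l] is not part of the input, so the machine has to compute [N]. This takes three
    stages: loop bound 2 gives [n + 2], this bound is enough to count the leaves of F and to
    multiply up to [N], and the search runs with bound [N]. Empty F and instances with fewer
    vertices in G than in F are settled in constant time, because the claimed bound is constant when
    F is empty or [n <= 1]. *)

(* Every loop runs over [0, N) for a single global bound N, so that the running
   time is polynomial in N by construction.  The accumulator of [EFold] is
   variable 0 of its body and the loop index is variable 1; [EIter] iterates N
   times a map on arrays of length N, whose body sees the cell as variable 0,
   the round as variable 1 and the previous array as table 0. *)
Inductive expr :=
| ENat of nat
| EBound
| EVar of nat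
| EAdd of expr & expr
| ESub of expr & expr
| EIn of expr
| EIf of expr & expr & expr
| EGet of nat & expr
| EWk of expr
| EWkT of expr
| EFold of expr & expr
| EIter of expr & expr.

Fixpoint den (N : nat) (inp env : seq nat) (tabs : seq (seq nat)) (e : expr)
    : nat :=
  match e with
  | ENat k => k
  | EBound => N
  | EVar i => nth 0 env i
  | EAdd a b => den N inp env tabs a + den N inp env tabs b
  | ESub a b => den N inp env tabs a - den N inp env tabs b
  | EIn a => nth 0 inp (den N inp env tabs a)
  | EIf a b c => if den N inp env tabs a != 0 then den N inp env tabs b
                 else den N inp env tabs c
  | EGet k a => nth 0 (nth [::] tabs k) (den N inp env tabs a)
  | EWk a => den N inp (behead env) tabs a
  | EWkT a => den N inp env (behead tabs) a
  | EFold a b => iteri N (fun i acc => den N inp (acc :: i :: env) tabs b)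
                   (den N inp env tabs a)
  | EIter b a =>
      nth 0 (iteri N (fun i V =>
               mkseq (fun x => den N inp (x :: i :: env) (V :: tabs) b) N) [::])
        (den N inp env tabs a)
  end.

(* Registers: 0 answer, 1 heap pointer, 2 loop bound, 3 constant 0, 4 constant 1.
   [rho] and [tau] locate the variables and the tables (base, length); the value
   is left in register [s], and registers below [s] are preserved. *)
Fixpoint comp (e : expr) (p : nat) (rho : seq nat) (tau : seq (nat * nat))
    (s : nat) : seq instr :=
  match e with
  | ENat k => [:: IConst s k]
  | EBound => [:: IAdd s 2 3]
  | EVar i => [:: IAdd s (nth 3 rho i) 3]
  | EAdd a b =>
      let ca := comp a p rho tau s in
      let cb := comp b (p + size ca) rho tau s.+1 in
      ca ++ cb ++ [:: IAdd s s s.+1]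
  | ESub a b =>
      let ca := comp a p rho tau s in
      let cb := comp b (p + size ca) rho tau s.+1 in
      ca ++ cb ++ [:: ISub s s s.+1]
  | EIn a => comp a p rho tau s ++ [:: IRead s s]
  | EIf a b c =>
      let ca := comp a p rho tau s in
      let pb := (p + size ca).+1 in
      let cb := comp b pb rho tau s in
      let pc := (pb + size cb).+1 in
      let cc := comp c pc rho tau s in
      ca ++ IJumpZ s pc :: cb ++ IJumpZ 3 (pc + size cc) :: cc
  | EGet k a =>
      let ca := comp a p rho tau s in
      let q := p + size ca in
      let t := nth (3, 3) tau k in
      ca ++ [:: ISub s.+1 t.2 s; IJumpZ s.+1 (q + 5); IAdd s t.1 s; ILoad s s;
                IJumpZ 3 (q + 6); IConst s 0]
  | EWk a => comp a p (behead rho) tau s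
  | EWkT a => comp a p rho (behead tau) s
  | EFold a b =>
      let ca := comp a p rho tau s in
      let q := (p + size ca).+1 in
      let cb := comp b q.+2 (s :: s.+1 :: rho) tau s.+2 in
      ca ++ IConst s.+1 0 :: ISub s.+2 2 s.+1
         :: IJumpZ s.+2 (q.+2 + size cb + 3)
         :: cb ++ [:: IAdd s s.+2 3; IAdd s.+1 s.+1 4; IJumpZ 3 q]
  | EIter b a =>
      let q := p + 3 in
      let r := q + 5 in
      let cb := comp b r.+2 [:: s + 4, s + 2 & rho] ((s, s + 1) :: tau) (s + 5) in
      let r' := r.+2 + size cb + 4 in
      let z := r' + 4 in
      let ca := comp a z rho tau (s + 2) in
      let z' := z + size ca in
      [:: IConst s 0, IConst (s + 1) 0, IConst (s + 2) 0,
          ISub (s + 5) 2 (s + 2), IJumpZ (s + 5) z, IAdd (s + 3) 1 3, IAdd 1 1 2,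
          IConst (s + 4) 0,
          ISub (s + 5) 2 (s + 4), IJumpZ (s + 5) r' &
       cb ++ [:: IAdd (s + 6) (s + 3) (s + 4), IStore (s + 6) (s + 5),
                 IAdd (s + 4) (s + 4) 4, IJumpZ 3 r,
                 IAdd s (s + 3) 3, IAdd (s + 1) 2 3, IAdd (s + 2) (s + 2) 4,
                 IJumpZ 3 q &
       ca ++ [:: ISub (s + 3) (s + 1) (s + 2); IJumpZ (s + 3) (z' + 5);
                 IAdd s s (s + 2); ILoad s s; IJumpZ 3 (z' + 6); IConst s 0]]]
  end.

(** Bounds the registers from [s] upwards that the code may write; the heap has to start beyond
    them. *)
Fixpoint regs (e : expr) : nat :=
  match e with
  | EAdd a b | ESub a b => maxn (regs a) (regs b).+1
  | EIn a | EWk a | EWkT a => regs a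
  | EIf a b c => maxn (regs a) (maxn (regs b) (regs c))
  | EGet _ a => (regs a).+2
  | EFold a b => maxn (regs a) (regs b).+3
  | EIter b a => (maxn (regs a) (regs b)) + 8
  | _ => 1
  end.

Lemma regs_gt0 e : 0 < regs e.
Proof. by elim: e => //= *; lia. Qed.

(** Both branches of a conditional are charged, which keeps the bound a polynomial in [N]. *)
Fixpoint cost (N : nat) (e : expr) : nat :=
  match e with
  | EAdd a b | ESub a b => cost N a + (cost N b + 1)
  | EIn a => cost N a + 1
  | EWk a | EWkT a => cost N a
  | EIf a b c => cost N a + (cost N b + cost N c + 2)
  | EGet _ a => cost N a + 6
  | EFold a b => cost N a + (1 + (N * (cost N b + 5) + 2))
  | EIter b a => 3 + (N * (5 + (N * (cost N b + 6) + 6)) + 2 + (cost N a + 6))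
  | _ => 1
  end.

(** Functions bounded by a power of [N.+2] are closed under sums and products; the base is at least
    2, so constants are absorbed even at [N = 0]. *)
Lemma cost_poly (e : expr) : exists c, forall N, cost N e <= N.+2 ^ c.
Proof.
have le2 N c d : N.+2 ^ c <= N.+2 ^ (c + d) by rewrite leq_exp2l ?leq_addr.
have k2 N k : k < N.+2 ^ k by apply: ltn_expl.
have sum a b : (exists c, forall N, a N <= N.+2 ^ c) ->
    (exists c, forall N, b N <= N.+2 ^ c) ->
    exists c, forall N, a N + b N <= N.+2 ^ c.
  move=> [c ca] [d cb]; exists (c + d).+1 => N; rewrite expnS.
  have A := leq_trans (ca N) (le2 N c d).
  have B := leq_trans (cb N) (le2 N d c); rewrite [d + c]addnC in B.
  nia.
have mul a b : (exists c, forall N, a N <= N.+2 ^ c) ->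
    (exists c, forall N, b N <= N.+2 ^ c) ->
    exists c, forall N, a N * b N <= N.+2 ^ c.
  move=> [c ca] [d cb]; exists (c + d) => N; rewrite expnD.
  exact: leq_mul.
have const k : exists c, forall N, k <= N.+2 ^ c.
  by exists k => N; apply: ltnW.
have id : exists c, forall N, N <= N.+2 ^ c by exists 1 => N; rewrite expn1; lia.
by elim: e => /= *; repeat first [assumption | exact: const | exact: id
  | apply sum | apply mul].
Qed.

(** * Compiled code computes the denotation within its cost *)

Section Machine.
Variables (P : program) (inp : seq nat).

(** A total-correctness triple with a budget [T] of steps, which a proof spends instruction by
    instruction. *)
Definition runs p M T p' (Q : (nat -> nat) -> Prop) : Prop :=
  exists t M', [/\ t <= T, iter t (step P inp) (Config p M) = Config p' M' & Q M'].

Definition instr_at p i : Prop := p < size P /\ nth (IConst 0 0) P p = i.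

Definition code_at p c : Prop :=
  exists pre post, P = pre ++ c ++ post /\ size pre = p.

Lemma code_at_cat p c1 c2 :
  code_at p (c1 ++ c2) -> code_at p c1 /\ code_at (p + size c1) c2.
Proof.
move=> [pre [post [EP <-]]]; split.
  by exists pre, (c2 ++ post); rewrite EP !catA.
by exists (pre ++ c1), post; rewrite EP size_cat !catA.
Qed.

Lemma code_at_cons p i c : code_at p (i :: c) -> instr_at p i /\ code_at p.+1 c.
Proof.
move=> [pre [post [EP <-]]]; split.
  by rewrite /instr_at EP !size_cat /= nth_cat ltnn subnn; split => //; lia.
by exists (rcons pre i), post; rewrite EP size_rcons cat_rcons.
Qed.

Lemma runs_done p M T p' (Q : (nat -> nat) -> Prop) :
  p = p' -> Q M -> runs p M T p' Q.
Proof. by move=> <- QM; exists 0, M. Qed.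

Lemma runs_step i p0 p M T p' Q :
  instr_at p0 i -> p = p0 -> 0 < T ->
  runs (pc (exec_instr inp i (Config p M))) (memory (exec_instr inp i (Config p M)))
    T.-1 p' Q ->
  runs p M T p' Q.
Proof.
move=> [ltp Pi] ep T0 [t [M' [le_t run_t QM']]]; rewrite -ep in ltp Pi.
exists t.+1, M'; split; [by lia | | by []].
rewrite iterSr -run_t; congr (iter _ _ _).
by rewrite /step /halted leqNgt ltp Pi; case: (exec_instr _ _ _).
Qed.

Lemma runs_goto k p0 p M T p' Q :
  instr_at p0 (IJumpZ 3 k) -> p = p0 -> 0 < T -> M 3 = 0 ->
  runs k M T.-1 p' Q -> runs p M T p' Q.
Proof. by move=> at0 ep T0 M3 H; apply: (runs_step at0) => //=; rewrite M3. Qed.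

Lemma runs_bind p1 T1 Q1 p M T p' Q :
  runs p M T1 p1 Q1 -> T1 <= T ->
  (forall M1, Q1 M1 -> runs p1 M1 (T - T1) p' Q) -> runs p M T p' Q.
Proof.
move=> [t1 [M1 [le1 run1 Q1M]]] leT /(_ _ Q1M) [t2 [M2 [le2 run2 Q2M]]].
by exists (t2 + t1), M2; rewrite iterD run1; split => //; lia.
Qed.

Section Layout.
Variables (S0 N : nat).

(** Register 1 is exempt because it holds the heap pointer, which may only advance; the cells from
    [S0] to the old pointer belong to tables in use. *)
Record agree (s : nat) (M M' : nat -> nat) : Prop := Agree {
  agree_heap : M 1 <= M' 1;
  agree_reg : forall r, r < s -> r != 1 -> M' r = M r;
  agree_mem : forall a, S0 <= a < M 1 -> M' a = M a }.

(** Only a nonempty table must lie in the heap: the empty ones, both the default [(3, 3)] and the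
    initial array of [EIter], have base 0. *)
Record holds_table (s : nat) (M : nat -> nat) (t : nat * nat) (V : seq nat) : Prop :=
  HoldsTable {
  table_base : t.1 < s /\ t.1 != 1;
  table_len : t.2 < s /\ t.2 != 1;
  table_size : M t.2 = size V;
  table_heap : M t.1 + size V <= M 1;
  table_low : 0 < size V -> S0 <= M t.1;
  table_cell : forall i, i < size V -> M (M t.1 + i) = nth 0 V i }.

(** An index outside [rho] or [tau] is sent to register 3, which holds 0 and so gives the same
    default as [nth] in [den]; hence the quantification over all [i] and [k]. *)
Record ok (s : nat) (M : nat -> nat) (rho : seq nat) (tau : seq (nat * nat))
    (env : seq nat) (tabs : seq (seq nat)) : Prop := Ok {
  ok_s : 4 < s;
  ok_bound : M 2 = N;
  ok_zero : M 3 = 0;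
  ok_one : M 4 = 1;
  ok_heap : S0 <= M 1;
  ok_reg : forall i, nth 3 rho i < s /\ nth 3 rho i != 1;
  ok_env : forall i, M (nth 3 rho i) = nth 0 env i;
  ok_tabs : forall k, holds_table s M (nth (3, 3) tau k) (nth [::] tabs k) }.

Lemma agree_refl s M : agree s M M.
Proof. by split. Qed.

Lemma agree_trans s s1 M M1 M2 :
  s <= s1 -> agree s M M1 -> agree s1 M1 M2 -> agree s M M2.
Proof.
move=> les [h1 r1 m1] [h2 r2 m2]; split; first by lia.
  by move=> r lt ne; rewrite r2 //; [apply: r1 | lia].
by move=> a lt; rewrite m2; [apply: m1 | lia].
Qed.

Lemma agree_update s M M' r x :
  agree s M M' -> s <= r < S0 -> r != 1 -> agree s M (update M' r x).
Proof.
move=> [h1 r1 m1] lt ne; split; rewrite /update.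
- by rewrite eq_sym (negPf ne).
- by move=> r' lt' ne'; case: eqP => [|_]; [lia | apply: r1].
- by move=> a lta; case: eqP => [|_]; [lia | apply: m1].
Qed.

Lemma agree_bump s M M' x :
  agree s M M' -> M' 1 <= x -> 1 < s <= S0 -> agree s M (update M' 1 x).
Proof.
move=> [h1 r1 m1] lex les; split; rewrite /update.
- by rewrite eqxx; lia.
- by move=> r lt ne; rewrite (negPf ne); apply: r1.
- by move=> a lta; case: eqP => [|_]; [lia | apply: m1].
Qed.

Lemma agree_store s M M' a x :
  agree s M M' -> M 1 <= a -> 1 < s <= S0 -> S0 <= a -> agree s M (update M' a x).
Proof.
move=> [h1 r1 m1] lea les leS; split; rewrite /update.
- by case: eqP => [|_]; [lia | apply: h1].
- by move=> r lt ne; case: eqP => [|_]; [lia | apply: r1].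
- by move=> a' lta; case: eqP => [|_]; [lia | apply: m1].
Qed.

Lemma table_agree s M M' t V : agree s M M' -> S0 <= M 1 ->
  holds_table s M t V -> holds_table s M' t V.
Proof.
move=> [h r m] hS [[b1 b2] [l1 l2] sz hp lw cl]; have e1 := r _ b1 b2; have e2 := r _ l1 l2.
split=> //; rewrite ?e1 ?e2 //; first by lia.
move=> i lti; rewrite m; first exact: cl.
by have := lw (leq_ltn_trans (leq0n _) lti); lia.
Qed.

Lemma table_weak s s' M t V : s <= s' -> holds_table s M t V -> holds_table s' M t V.
Proof. by move=> les [[b1 b2] [l1 l2] *]; split=> //; split=> //; lia. Qed.

Lemma ok_agree s s' M M' rho tau env tabs :
  agree s M M' -> s <= s' -> ok s M rho tau env tabs -> ok s' M' rho tau env tabs.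
Proof.
move=> ag les [s5 b z o h rg en tb]; case: (ag) => h1 r1 m1.
have r1' r : r < 5 -> r != 1 -> M' r = M r by move=> ? ?; apply: r1 => //; lia.
have [e2 e3 e4] : [/\ M' 2 = M 2, M' 3 = M 3 & M' 4 = M 4] by split; apply: r1'.
split; rewrite ?e2 ?e3 ?e4 //; try lia.
- by move=> i; have [? ?] := rg i; split=> //; lia.
- by move=> i; have [? ?] := rg i; rewrite r1.
- by move=> k; apply: table_weak les _; apply: table_agree ag h _.
Qed.

Lemma ok_cons s M rho tau env tabs r x :
  r < s -> r != 1 -> M r = x -> ok s M rho tau env tabs ->
  ok s M (r :: rho) tau (x :: env) tabs.
Proof. by move=> lt ne eM [*]; split=> //; case. Qed.

Lemma ok_consT s M rho tau env tabs t V :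
  holds_table s M t V -> ok s M rho tau env tabs ->
  ok s M rho (t :: tau) env (V :: tabs).
Proof. by move=> tV [*]; split=> //; case. Qed.

Definition correct e : Prop := forall p rho tau s M env tabs,
  code_at p (comp e p rho tau s) -> s + regs e <= S0 ->
  ok s M rho tau env tabs ->
  runs p M (cost N e) (p + size (comp e p rho tau s))
    (fun M' => M' s = den N inp env tabs e /\ agree s M M').

Local Ltac upd := rewrite /update /=; repeat (case: eqP => [?|?] //=; try lia).

Local Ltac stp H := apply: (runs_step H); [by lia | by lia |]; rewrite /=.

Lemma correct_bin (op : nat -> nat -> nat) mk a b p rho tau s M env tabs :
  (forall r t u q M', exec_instr inp (mk r t u) (Config q M')
     = Config q.+1 (update M' r (op (M' t) (M' u)))) ->
  correct a -> correct b ->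
  let ca := comp a p rho tau s in
  let cb := comp b (p + size ca) rho tau s.+1 in
  let c := ca ++ cb ++ [:: mk s s s.+1] in
  code_at p c -> s + maxn (regs a) (regs b).+1 <= S0 -> ok s M rho tau env tabs ->
  runs p M (cost N a + (cost N b + 1)) (p + size c)
    (fun M' => M' s = op (den N inp env tabs a) (den N inp env tabs b)
       /\ agree s M M').
Proof.
move=> exE Ha Hb ca cb c cd le ok0; have s5 := ok_s ok0.
have [cda /code_at_cat [cdb /code_at_cons [at1 _]]] := code_at_cat cd.
apply: runs_bind (Ha _ _ _ _ _ _ _ cda _ ok0) _ _; [by lia | by lia |].
move=> M1 [v1 ag1].
have ok1 : ok s.+1 M1 rho tau env tabs by apply: ok_agree ag1 _ ok0.
apply: runs_bind (Hb _ _ _ _ _ _ _ cdb _ ok1) _ _; [by lia | by lia |].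
move=> M2 [v2 ag2]; have v1' := agree_reg ag2 (ltnSn s).
apply: (runs_step at1); [by [] | by lia |]; rewrite exE /=.
apply: runs_done; first by rewrite /c /cb /ca !size_cat /= !addnA addn1.
split; first by rewrite /update eqxx v2 v1' ?v1 //; lia.
by apply: agree_update; [apply: agree_trans ag1 ag2 | lia | lia].
Qed.

Lemma correct_expr e : correct e.
Proof.
have reg0 := regs_gt0.
elim: e => [k||i|a Ha b Hb|a Ha b Hb|a Ha|a Ha b Hb c Hc|k a Ha|a Ha|a Ha
           |a Ha b Hb|b Hb a Ha] p rho tau s M env tabs /=.
- move=> /code_at_cons [at1 _] le ok0; have s5 := ok_s ok0; stp at1.
  apply: runs_done; first by lia.
  by split; [upd | apply: agree_update; [apply: agree_refl | lia | lia]].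
- move=> /code_at_cons [at1 _] le ok0; have s5 := ok_s ok0; stp at1.
  apply: runs_done; first by lia.
  split; last by apply: agree_update; [apply: agree_refl | lia | lia].
  by rewrite /update eqxx (ok_bound ok0) (ok_zero ok0) addn0.
- move=> /code_at_cons [at1 _] le ok0; have s5 := ok_s ok0; stp at1.
  apply: runs_done; first by lia.
  split; last by apply: agree_update; [apply: agree_refl | lia | lia].
  by rewrite /update eqxx (ok_env ok0) (ok_zero ok0) addn0.
- by move=> cd le ok0; apply: (correct_bin (mk := IAdd)).
- by move=> cd le ok0; apply: (correct_bin (mk := ISub)).
- move=> /code_at_cat [cda /code_at_cons [at1 _]] le ok0; have s5 := ok_s ok0.
  apply: runs_bind (Ha _ _ _ _ _ _ _ cda _ ok0) _ _; [by lia | by lia |].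
  move=> M1 [v1 ag1]; stp at1.
  apply: runs_done; first by rewrite size_cat /=; lia.
  split; last by have ra := reg0 a; apply: agree_update; [| lia | lia].
  by rewrite /update eqxx v1.
- move=> /code_at_cat [cda /code_at_cons [at1 /code_at_cat [cdb
    /code_at_cons [at2 cdc]]]] le ok0; have s5 := ok_s ok0.
  apply: runs_bind (Ha _ _ _ _ _ _ _ cda _ ok0) _ _; [by lia | by lia |].
  move=> M1 [v1 ag1]; stp at1; rewrite v1.
  have ok1 : ok s M1 rho tau env tabs by apply: ok_agree ag1 _ ok0.
  case: eqP => [v0|vn] /=.
    apply: runs_bind (Hc _ _ _ _ _ _ _ cdc _ ok1) _ _; [by lia | by lia |].
    move=> M2 [v2 ag2]; apply: runs_done.
      by rewrite !size_cat /= !size_cat /=; lia.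
    by split=> //; apply: agree_trans ag1 ag2.
  apply: runs_bind (Hb _ _ _ _ _ _ _ cdb _ ok1) _ _; [by lia | by lia |].
  move=> M2 [v2 ag2]; stp at2.
  rewrite (agree_reg ag2) ?(ok_zero ok1) /=; try lia.
  apply: runs_done; first by rewrite !size_cat /= !size_cat /=; lia.
  by split=> //; apply: agree_trans ag1 ag2.
- move=> /code_at_cat [cda /code_at_cons [at1 /code_at_cons [at2 /code_at_cons [at3
    /code_at_cons [at4 /code_at_cons [at5 /code_at_cons [at6 _]]]]]]] le ok0.
  have s5 := ok_s ok0.
  apply: runs_bind (Ha _ _ _ _ _ _ _ cda _ ok0) _ _; [by lia | by lia |].
  move=> M1 [v1 ag1].
  have ok1 : ok s M1 rho tau env tabs by apply: ok_agree ag1 _ ok0.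
  have [[b1 b2] [l1 l2] sz hp lw cl] := ok_tabs ok1 k.
  set t := nth _ tau k in at1 at3 b1 b2 l1 l2 sz hp lw cl *.
  set V := nth _ tabs k in sz hp lw cl *.
  stp at1; stp at2; rewrite {1}/update eqxx sz v1.
  case: eqP => [v0|vn].
    stp at6; apply: runs_done; first by rewrite size_cat /=; lia.
    split; first by rewrite nth_default; [upd | lia].
    apply: agree_update; [apply: agree_update | lia | lia]; by [| lia].
  have ltV : den N inp env tabs a < size V by lia.
  have lwV := lw (leq_ltn_trans (leq0n _) ltV).
  have updE M2 x : update M2 s x s = x by rewrite /update eqxx.
  have updS x r : r < s.+1 -> update M1 s.+1 x r = M1 r by move=> ?; upd.
  stp at3; rewrite !updS ?v1; try lia; stp at4; rewrite updE.
  apply: (runs_goto at5); [by lia | by lia | by upd; exact: (ok_zero ok1) |].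
  apply: runs_done; first by rewrite size_cat /=; lia.
  split; last by do 3 (apply: agree_update; try lia).
  by rewrite updE; upd; apply: cl.
- move=> cd le [*]; apply: Ha => //; split=> // i; rewrite !nth_behead; auto.
- move=> cd le [*]; apply: Ha => //; split=> // i; rewrite !nth_behead; auto.
- move=> /code_at_cat [cda /code_at_cons [at1 /code_at_cons [at2 /code_at_cons [at3
    /code_at_cat [cdb /code_at_cons [at4 /code_at_cons [at5 /code_at_cons
    [at6 _]]]]]]]] le ok0.
  have s5 := ok_s ok0.
  apply: runs_bind (Ha _ _ _ _ _ _ _ cda _ ok0) _ _; [by lia | by lia |].
  move=> M1 [v1 ag1]; stp at1.
  rewrite size_cat /= size_cat /=.
  set pend := (X in runs _ _ _ X _).
  pose f i acc := den N inp [:: acc, i & env] tabs b.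
  (* [k] is the number of rounds left; the final 2 pays for the loop test that exits. *)
  suff loop k i M2 : i + k = N -> M2 s.+1 = i ->
      M2 s = iteri i f (den N inp env tabs a) -> agree s M M2 ->
      runs (p + size (comp a p rho tau s)).+1 M2 (k * (cost N b + 5) + 2) pend (fun M' =>
        M' s = iteri N f (den N inp env tabs a) /\ agree s M M').
    have [||||T1 [M' [leT runT QT]]] := loop N 0 (update M1 s.+1 0).
    - by [].
    - by upd.
    - by rewrite -v1; upd.
    - by apply: agree_update; [| lia | lia].
    by exists T1, M'; split => //; lia.
  elim: k i M2 => [|k IHk] i M2 ik vi va ag2; have ok2 := ok_agree ag2 (leqnn s) ok0;
    stp at2; stp at3; rewrite {1}/update eqxx (ok_bound ok2) vi.
    case: eqP => [_|]; last by lia.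
    apply: runs_done; first by rewrite /pend; lia.
    split; last by apply: agree_update; [| lia | lia].
    by rewrite -[X in iteri X]ik addn0 -va; upd.
  case: eqP => [|_]; first by lia.
  set M3 := update _ _ _.
  have ag3 : agree s M M3 by apply: agree_update; [| lia | lia].
  have ok3 : ok s.+2 M3 [:: s, s.+1 & rho] tau [:: M2 s, i & env] tabs.
    by do 2 (apply: ok_cons; [lia | lia | by rewrite /M3; upd |]);
       apply: ok_agree ag3 _ ok0; lia.
  apply: runs_bind (Hb _ _ _ _ _ _ _ cdb _ ok3) _ _; [by lia | by lia |].
  move=> M4 [v4 ag4].
  have ag4' : agree s M M4 by apply: agree_trans ag3 ag4; lia.
  have ok4 := ok_agree ag4' (leqnn s) ok0.
  have v4' : M4 s.+1 = i by rewrite (agree_reg ag4) ?/M3; upd.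
  stp at4; stp at5.
  apply: (runs_goto at6); [by lia | by lia | by upd; exact: (ok_zero ok4) |].
  set M5 := update _ s.+1 _.
  have [||||T1 [M' [leT runT QT]]] := IHk i.+1 M5.
  - by lia.
  - by rewrite /M5; upd; rewrite v4' (ok_one ok4) addn1.
  - by rewrite /M5; upd; rewrite v4 (ok_zero ok4) addn0 va.
  - by do 2 (apply: agree_update; [| lia | lia]).
  by exists T1, M'; split => //; lia.
- move=> /code_at_cons [at1 /code_at_cons [at2 /code_at_cons [at3 /code_at_cons [at4
    /code_at_cons [at5 /code_at_cons [at6 /code_at_cons [at7 /code_at_cons [at8
    /code_at_cons [at9 /code_at_cons [at10 cd]]]]]]]]]].
  rewrite (_ : p.+4.+4.+2 = (p + 3 + 5).+2) in cd; last by lia.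
  move: cd => /code_at_cat [cdb /code_at_cons [at11
    /code_at_cons [at12 /code_at_cons [at13 /code_at_cons [at14 /code_at_cons [at15
    /code_at_cons [at16 /code_at_cons [at17 /code_at_cons [at18 cd]]]]]]]]].
  move: cd at5 at10 => /=; set cb := comp b _ _ _ _.
  rewrite -/cb in at11 at12 at13 at14 at15 at16 at17 at18 cdb.
  rewrite (_ : (_ + size cb).+4.+4 = (p + 3 + 5).+2 + size cb + 4 + 4); last by lia.
  move=> /code_at_cat [cda /code_at_cons [at19 /code_at_cons [at20 /code_at_cons [at21
    /code_at_cons [at22 /code_at_cons [at23 /code_at_cons [at24 _]]]]]]] at5 at10 le ok0.
  have s5 := ok_s ok0.
  pose f i V := mkseq (fun x => den N inp [:: x, i & env] (V :: tabs) b) N.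
  stp at1; stp at2; stp at3; set M1 := update _ (s + 2) 0.
  have ag1 : agree s M M1.
    by do 3 (apply: agree_update; [| lia | lia]); apply: agree_refl.
  have tab1 : holds_table (s + 2) M1 (s, s + 1) [::].
    by split=> //=; rewrite ?/M1; try lia; upd.
  have outer k i M2 : i + k = N -> M2 (s + 2) = i -> agree s M M2 ->
      holds_table (s + 2) M2 (s, s + 1) (iteri i f [::]) ->
      runs (p + 3) M2 (k * (5 + (N * (cost N b + 6) + 6)) + 2) ((p + 3 + 5).+2 + size cb + 4 + 4)
        (fun M' => agree s M M' /\
           holds_table (s + 2) M' (s, s + 1) (iteri N f [::])).
    elim: k i M2 => [|k IHk] i M2 ik vi ag2 tab2;
      have ok2 := ok_agree ag2 (leqnn s) ok0;
      stp at4; stp at5; rewrite {1}/update eqxx (ok_bound ok2) vi.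
      case: eqP => [_|]; last by lia.
      apply: runs_done; first by [].
      split; first by apply: agree_update; [| lia | lia].
      have iN : i = N by lia.
      rewrite iN in tab2; apply: table_agree tab2.
        by apply: agree_update; [apply: agree_refl | lia | lia].
      exact: ok_heap ok2.
    case: eqP => [|_]; first by lia.
    set V := iteri i f [::] in tab2.
    pose g x := den N inp [:: x, i & env] (V :: tabs) b.
    (* The block of [N] cells from [M2 1] on is reserved before its cells are computed, so nested
       iterations allocate above it and leave the finished cells alone. *)
    have inner l x M3 : x + l = N -> M3 (s + 4) = x -> M3 (s + 3) = M2 1 ->
        agree (s + 3) M2 M3 -> M2 1 + N <= M3 1 ->
        (forall y, y < x -> M3 (M2 1 + y) = g y) ->
        runs (p + 3 + 5) M3 (l * (cost N b + 6) + 2) ((p + 3 + 5).+2 + size cb + 4) (fun M' =>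
          [/\ M' (s + 3) = M2 1, agree (s + 3) M2 M', M2 1 + N <= M' 1 &
             forall y, y < N -> M' (M2 1 + y) = g y]).
      elim: l x M3 => [|l IHl] x M3 xl vx v3 ag3 hp3 cl3;
        have ok3 : ok s M3 rho tau env tabs
          by apply: (ok_agree (agree_trans _ ag2 ag3)) ok0; lia.
        stp at9; stp at10; rewrite {1}/update eqxx (ok_bound ok3) vx.
        case: eqP => [_|]; last by lia.
        apply: runs_done; first by [].
        have S1 := ok_heap ok2.
        split; [by upd | by apply: agree_update; [| lia | lia] | by upd |].
        by move=> y lty; rewrite -cl3; [upd | lia].
      stp at9; stp at10; rewrite {1}/update eqxx (ok_bound ok3) vx.
      case: eqP => [|_]; first by lia.
      set M4 := update _ _ _.
      have S1 := ok_heap ok2.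
      have ag4 : agree (s + 3) M2 M4 by apply: agree_update; [| lia | lia].
      have ag4' : agree s M M4 by apply: agree_trans ag2 ag4; lia.
      have ok4 : ok (s + 5) M4 [:: s + 4, s + 2 & rho] ((s, s + 1) :: tau)
          [:: x, i & env] (V :: tabs).
        apply: ok_consT.
          apply: table_weak (table_agree ag4 _ _); [lia | done |].
          by apply: table_weak tab2; lia.
        apply: ok_cons; [lia | lia | by rewrite /M4; upd |].
        apply: ok_cons; [lia | lia | by rewrite (agree_reg ag4) ?vi; lia |].
        by apply: ok_agree ag4' _ ok0; lia.
      apply: runs_bind (Hb _ _ _ _ _ _ _ cdb _ ok4) _ _; [by lia | by lia |].
      move=> M5 [v5 ag5]; rewrite -/cb.
      have ag5' : agree (s + 3) M2 M5 by apply: agree_trans ag4 ag5; lia.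
      have e51 : M3 1 <= M5 1 by have := agree_heap ag5; rewrite /M4; upd.
      have e53 : M5 (s + 3) = M2 1
        by rewrite (agree_reg ag5); [rewrite /M4; upd | lia | lia].
      have e54 : M5 (s + 4) = x
        by rewrite (agree_reg ag5); [rewrite /M4; upd | lia | lia].
      have ok5 : ok s M5 rho tau env tabs.
        by apply: ok_agree (agree_trans _ ag2 ag5') _ ok0; lia.
      stp at11; rewrite e53 e54; stp at12.
      have u6 y : update M5 (s + 6) y (s + 6) = y by upd.
      have u5 y : update M5 (s + 6) y (s + 5) = M5 (s + 5) by upd.
      rewrite u6 u5 v5; stp at13; set M6 := update (update M5 _ _) _ _.
      have M6E y : y < s + 6 -> M6 y = M5 y by move=> lty; rewrite /M6; upd.
      rewrite !M6E; try lia.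
      apply: (runs_goto at14); [by lia | by lia | by upd; rewrite M6E ?(ok_zero ok5); lia |].
      have [||||||T1 [M' [leT runT QT]]] := IHl x.+1 (update M6 (s + 4) (M5 (s + 4) + M5 4)).
      + by lia.
      + by upd; rewrite e54 (ok_one ok5) addn1.
      + by upd; rewrite M6E ?e53; lia.
      + apply: agree_update; [apply: agree_store | lia | lia]; try lia.
        by apply: agree_update; [| lia | lia].
      + by upd; rewrite M6E; lia.
      + move=> y lty; rewrite /update; case: eqP => [|_]; first by lia.
        rewrite /M6 /update; case: eqP => [|ne]; first by move=> /addnI ->.
        case: eqP => [|_]; first by lia.
        rewrite (agree_mem ag5); first by rewrite /M4 -cl3; [upd | lia].
        by rewrite /M4; upd.
      by exists T1, M'; split => //; lia.
    stp at6; stp at7; stp at8; set M3 := update _ (s + 4) 0.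
    have S1 := ok_heap ok2.
    have [||||||T1 [M' [leT runT [v3 ag3 hp3 cl3]]]] := inner N 0 M3.
    + by [].
    + by rewrite /M3; upd.
    + by rewrite /M3; upd; rewrite (ok_zero ok2) addn0.
    + apply: agree_update; [apply: agree_bump | lia | lia]; try lia.
      by do 2 (apply: agree_update; [| lia | lia]); apply: agree_refl.
    + by rewrite /M3; upd; rewrite (ok_bound ok2).
    + by [].
    rewrite (_ : (p + 3).+4.+1 = p + 3 + 5); last by lia.
    apply: (@runs_bind ((p + 3 + 5).+2 + size cb + 4) T1 (eq M')); first by exists T1, M'; split.
      by lia.
    move=> _ <-.
    have ok3 : ok s M' rho tau env tabs.
      by apply: (ok_agree (agree_trans _ ag2 ag3)) ok0; lia.
    have e2 : M' (s + 2) = i by rewrite (agree_reg ag3) //; lia.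
    stp at15; stp at16; stp at17.
    apply: (runs_goto at18); [by lia | by lia | by upd; exact: (ok_zero ok3) |].
    set M4 := update _ (s + 2) _.
    have [||||T2 [M5 [leT2 runT2 QT2]]] := IHk i.+1 M4.
    + by lia.
    + by rewrite /M4; upd; rewrite e2 (ok_one ok3) addn1.
    + do 3 (apply: agree_update; [| lia | lia]).
      by apply: agree_trans ag2 ag3; lia.
    + have e4 : M4 s = M2 1 by rewrite /M4; upd; rewrite v3 (ok_zero ok3) addn0.
      split=> //=; rewrite ?e4 ?size_mkseq; try lia.
      * by rewrite /M4; upd; rewrite (ok_bound ok3) (ok_zero ok3) addn0.
      * by rewrite /M4; upd.
      * move=> y lty; rewrite nth_mkseq //; rewrite /M4; upd; exact: cl3.
    by exists T2, M5; split => //; lia.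
  have [T1 [M2 [leT runT [ag2 tab2]]]] :=
    outer N 0 M1 (erefl _) (ltac:(by rewrite /M1; upd)) ag1 tab1.
  apply: (@runs_bind ((p + 3 + 5).+2 + size cb + 4 + 4) T1 (eq M2)).
    by rewrite -[p.+3]addn3; exists T1, M2; split.
    by lia.
  move=> _ <-.
  have ok2 : ok (s + 2) M2 rho tau env tabs by apply: ok_agree ag2 _ ok0; lia.
  apply: runs_bind (Ha _ _ _ _ _ _ _ cda _ ok2) _ _; [by lia | by lia |].
  move=> M3 [v3 ag3].
  have ag3' : agree s M M3 by apply: agree_trans ag2 ag3; lia.
  have ok3 : ok s M3 rho tau env tabs by apply: ok_agree ag3' _ ok0.
  have [_ _ /= sz hp lw cl] := table_agree ag3 (ok_heap ok2) tab2.
  set V := iteri N f [::] in sz hp lw cl *.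
  stp at19; stp at20; rewrite {1}/update eqxx sz v3.
  case: eqP => [v0|vn].
    stp at24; apply: runs_done; first by rewrite !size_cat /= size_cat /=; lia.
    split; first by rewrite nth_default; [upd | lia].
    by do 2 (apply: agree_update; [| lia | lia]).
  have ltV : den N inp env tabs a < size V by lia.
  have lwV := lw (leq_ltn_trans (leq0n _) ltV).
  have updE M4 x : update M4 s x s = x by rewrite /update eqxx.
  have updS x r : r < s + 3 -> update M3 (s + 3) x r = M3 r by move=> ?; upd.
  stp at21; rewrite !updS ?v3; try lia; stp at22; rewrite updE.
  apply: (runs_goto at23); [by lia | by lia | by upd; exact: (ok_zero ok3) |].
  apply: runs_done; first by rewrite !size_cat /= size_cat /=; lia.
  split; last by do 3 (apply: agree_update; try lia).
  by rewrite updE; upd; apply: cl.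
Qed.

End Layout.
End Machine.

Lemma ok_nil S0 N M : M 2 = N -> M 3 = 0 -> M 4 = 1 -> S0 <= M 1 ->
  ok S0 N 5 M [::] [::] [::] [::].
Proof.
move=> M2 M3 M4 M1; split=> // [i|i|k]; rewrite ?nth_nil //.
by split; rewrite //= ?M3.
Qed.

(* Each stage computes the loop bound of the next one. *)
Lemma staged_program (e0 e1 e2 : expr) : exists (P : program) (c : nat),
  forall inp N1 N2, N1 = den 2 inp [::] [::] e0 -> N2 = den N1 inp [::] [::] e1 ->
  exists t, [/\ t <= c + N1.+2 ^ c + N2.+2 ^ c, halted P (run P inp t)
    & memory (run P inp t) 0 = den N2 inp [::] [::] e2].
Proof.
(* Registers 0 to 4 are reserved, evaluation starts at register 5, and the heap lies above all
   registers of the three expressions. *)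
pose S0 := 5 + maxn (regs e0) (maxn (regs e1) (regs e2)).
pose ci : seq instr := [:: IConst 1 S0; IConst 2 2; IConst 3 0; IConst 4 1].
pose c0 := comp e0 4 [::] [::] 5.
pose c1 := comp e1 (4 + size c0).+1 [::] [::] 5.
pose c2 := comp e2 ((4 + size c0).+1 + size c1).+1 [::] [::] 5.
pose P := ci ++ c0 ++ IAdd 2 5 3 :: c1 ++ IAdd 2 5 3 :: c2 ++ [:: IAdd 0 5 3].
have [k1 H1] := cost_poly e1; have [k2 H2] := cost_poly e2.
exists P, (7 + cost 2 e0 + k1 + k2) => inp N1 N2 N1E N2E.
have S5 : 5 < S0 by rewrite /S0; have := regs_gt0 e0; lia.
have : code_at P 0 P by exists [::], [::]; rewrite cats0.
rewrite {2}/P => /code_at_cat [/code_at_cons [at1 /code_at_cons [at2 /code_at_cons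
  [at3 /code_at_cons [at4 _]]]] /code_at_cat [cd0 /code_at_cons [at5 /code_at_cat
  [cd1 /code_at_cons [at6 /code_at_cat [cd2 /code_at_cons [at7 _]]]]]]].
suff [t [M' [le_t run_t v]]] : runs P inp 0 (fun=> 0)
    (7 + cost 2 e0 + cost N1 e1 + cost N2 e2) (size P)
    (fun M' => M' 0 = den N2 inp [::] [::] e2).
  exists t; rewrite /run run_t; split=> //; last by rewrite /halted.
  have leX N k k' : k <= k' -> N.+2 ^ k <= N.+2 ^ k' by move=> ?; rewrite leq_exp2l.
  have A := leq_trans (H1 N1) (leX N1 k1 (7 + cost 2 e0 + k1 + k2) (ltac:(lia))).
  have B := leq_trans (H2 N2) (leX N2 k2 (7 + cost 2 e0 + k1 + k2) (ltac:(lia))).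
  by lia.
apply: (runs_step at1); [by [] | by lia |]; rewrite /=.
apply: (runs_step at2); [by [] | by lia |]; rewrite /=.
apply: (runs_step at3); [by [] | by lia |]; rewrite /=.
apply: (runs_step at4); [by [] | by lia |]; rewrite /=.
set M0 := update _ 4 1.
have ok0 : ok S0 2 5 M0 [::] [::] [::] [::] by apply: ok_nil.
have le0 : 5 + regs e0 <= S0 by rewrite /S0; lia.
have le1 : 5 + regs e1 <= S0 by rewrite /S0; lia.
have le2 : 5 + regs e2 <= S0 by rewrite /S0; lia.
have R0 : runs P inp 4 _ _ (4 + size c0) _ :=
  @correct_expr P inp S0 2 e0 _ _ _ _ _ _ _ cd0 le0 ok0.
apply: (runs_bind R0); first by lia.
move=> M1 [v1 ag1]; have ok1 := ok_agree ag1 (leqnn 5) ok0.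
apply: (runs_step at5); [by [] | by lia |]; rewrite /= v1 (ok_zero ok1) addn0 -N1E.
set M2 := update _ 2 _.
have ok2 : ok S0 N1 5 M2 [::] [::] [::] [::].
  by apply: ok_nil; rewrite /M2 /update /= ?(ok_zero ok1) ?(ok_one ok1) ?(ok_heap ok1).
have R1 : runs P inp (4 + size c0).+1 _ _ ((4 + size c0).+1 + size c1) _ :=
  @correct_expr P inp S0 N1 e1 _ _ _ _ _ _ _ cd1 le1 ok2.
apply: (runs_bind R1); first by lia.
move=> M3 [v3 ag3]; have ok3 := ok_agree ag3 (leqnn 5) ok2.
apply: (runs_step at6); [by [] | by lia |]; rewrite /= v3 (ok_zero ok3) addn0 -N2E.
set M4 := update _ 2 _.
have ok4 : ok S0 N2 5 M4 [::] [::] [::] [::].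
  by apply: ok_nil; rewrite /M4 /update /= ?(ok_zero ok3) ?(ok_one ok3) ?(ok_heap ok3).
have R2 : runs P inp ((4 + size c0).+1 + size c1).+1 _ _
    (((4 + size c0).+1 + size c1).+1 + size c2) _ :=
  @correct_expr P inp S0 N2 e2 _ _ _ _ _ _ _ cd2 le2 ok4.
apply: (runs_bind R2); first by lia.
move=> M5 [v5 ag5]; have ok5 := ok_agree ag5 (leqnn 5) ok4.
apply: (runs_step at7); [by [] | by lia |]; rewrite /= v5 (ok_zero ok5) addn0.
apply: runs_done; last by rewrite /update.
by rewrite /P !size_cat /= !size_cat /= size_cat /=; lia.
Qed.

(** * Definable functions *)

Record context (A : Type) := Context {
  cx_bound : A -> nat;
  cx_input : A -> seq nat;
  cx_vars : A -> seq nat;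
  cx_tabs : A -> seq (seq nat) }.

(** One expression serves all states [a], so a function of loop bound and input becomes one program.
    A binder pairs the state with the bound value. *)
Definition definable A (X : context A) (f : A -> nat) : Prop :=
  exists e, forall a, den (cx_bound X a) (cx_input X a) (cx_vars X a) (cx_tabs X a) e
    = f a.

Definition add_var A (X : context A) : context (A * nat) :=
  Context (fun p => cx_bound X p.1) (fun p => cx_input X p.1)
    (fun p => p.2 :: cx_vars X p.1) (fun p => cx_tabs X p.1).

Definition add_tab A (X : context A) : context (A * seq nat) :=
  Context (fun p => cx_bound X p.1) (fun p => cx_input X p.1)
    (fun p => cx_vars X p.1) (fun p => p.2 :: cx_tabs X p.1).

Definition base_context : context (nat * seq nat) :=
  Context fst snd (fun=> [::]) (fun=> [::]).

Section Definable.
Variables (A : Type) (X : context A).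
Implicit Types f g h : A -> nat.

Lemma def_add_var f : definable X f -> definable (add_var X) (fun p => f p.1).
Proof. by move=> [e He]; exists (EWk e) => -[a i] /=; rewrite -He. Qed.

Lemma def_add_tab f : definable X f -> definable (add_tab X) (fun p => f p.1).
Proof. by move=> [e He]; exists (EWkT e) => -[a i] /=; rewrite -He. Qed.

Lemma def_var i f : (forall a, nth 0 (cx_vars X a) i = f a) -> definable X f.
Proof. by exists (EVar i). Qed.

Lemma def_nat k : definable X (fun=> k).
Proof. by exists (ENat k). Qed.

Lemma def_bound : definable X (cx_bound X).
Proof. by exists EBound. Qed.

Lemma def_add f g : definable X f -> definable X g -> definable X (fun a => f a + g a).
Proof. by move=> [e He] [d Hd]; exists (EAdd e d) => a /=; rewrite He Hd. Qed.

Lemma def_succ f : definable X f -> definable X (fun a => (f a).+1).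
Proof. by move=> [e He]; exists (EAdd (ENat 1) e) => a /=; rewrite He. Qed.

Lemma def_sub f g : definable X f -> definable X g -> definable X (fun a => f a - g a).
Proof. by move=> [e He] [d Hd]; exists (ESub e d) => a /=; rewrite He Hd. Qed.

Lemma def_input f : definable X f -> definable X (fun a => nth 0 (cx_input X a) (f a)).
Proof. by move=> [e He]; exists (EIn e) => a /=; rewrite He. Qed.

Lemma def_get k (V : A -> seq nat) f :
  (forall a, nth [::] (cx_tabs X a) k = V a) ->
  definable X f -> definable X (fun a => nth 0 (V a) (f a)).
Proof. by move=> HV [e He]; exists (EGet k e) => a /=; rewrite He HV. Qed.

Lemma def_if (b : A -> bool) f g :
  definable X (fun a => b a) -> definable X f -> definable X g ->
  definable X (fun a => if b a then f a else g a).
Proof.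
move=> [e He] [d Hd] [c Hc]; exists (EIf e d c) => a /=.
by rewrite He Hd Hc; case: (b a).
Qed.

Lemma def_ifb (b c d : A -> bool) : definable X (fun a => b a) ->
  definable X (fun a => c a) -> definable X (fun a => d a) ->
  definable X (fun a => if b a then c a else d a).
Proof.
move=> db dc dd; have [e He] := def_if db dc dd; exists e => a.
by rewrite He; case: (b a).
Qed.

Lemma def_not (b : A -> bool) :
  definable X (fun a => b a) -> definable X (fun a => ~~ b a).
Proof.
move=> [e He]; exists (ESub (ENat 1) e) => a /=.
by rewrite He; case: (b a).
Qed.

Lemma def_and (b c : A -> bool) : definable X (fun a => b a) ->
  definable X (fun a => c a) -> definable X (fun a => b a && c a).
Proof.
move=> [e He] [d Hd]; exists (EIf e d (ENat 0)) => a /=.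
by rewrite He Hd; case: (b a).
Qed.

Lemma def_or (b c : A -> bool) : definable X (fun a => b a) ->
  definable X (fun a => c a) -> definable X (fun a => b a || c a).
Proof.
move=> [e He] [d Hd]; exists (EIf e (ENat 1) d) => a /=.
by rewrite He Hd; case: (b a).
Qed.

Lemma def_imply (b c : A -> bool) : definable X (fun a => b a) ->
  definable X (fun a => c a) -> definable X (fun a => b a ==> c a).
Proof.
move=> [e He] [d Hd]; exists (EIf e d (ENat 1)) => a /=.
by rewrite He Hd; case: (b a).
Qed.

Lemma def_leq f g : definable X f -> definable X g ->
  definable X (fun a => f a <= g a).
Proof.
move=> [e He] [d Hd]; exists (ESub (ENat 1) (ESub e d)) => a /=.
by rewrite He Hd /leq; case: (_ - g a).
Qed.

Lemma def_eq f g : definable X f -> definable X g ->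
  definable X (fun a => f a == g a).
Proof.
move=> df dg; have [e He] := def_and (def_leq df dg) (def_leq dg df).
by exists e => a; rewrite He eqn_leq.
Qed.

Lemma def_fold (f : A -> nat) (g : A -> nat -> nat -> nat) : definable X f ->
  definable (add_var (add_var X)) (fun p => g p.1.1 p.1.2 p.2) ->
  definable X (fun a => iteri (cx_bound X a) (g a) (f a)).
Proof.
move=> [e He] [d Hd]; exists (EFold e d) => a /=; rewrite He.
elim: (X in iteri X _ _ = iteri X _ _) => //= n ->.
exact: (Hd ((a, n), _)).
Qed.

Lemma def_iter (g : A -> nat -> seq nat -> nat -> nat) (f : A -> nat) :
  definable (add_tab (add_var (add_var X))) (fun p => g p.1.1.1 p.1.1.2 p.2 p.1.2) ->
  definable X f ->
  definable X (fun a => nth 0 (iteri (cx_bound X a)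
    (fun i V => mkseq (g a i V) (cx_bound X a)) [::]) (f a)).
Proof.
move=> [e He] [d Hd]; exists (EIter e d) => a /=; rewrite Hd.
congr (nth 0 _ _); elim: {1 4}(cx_bound X a) => //= n ->.
by apply: eq_mkseq => x; apply: (He (a, n, x, _)).
Qed.

End Definable.

Section BoundedQuantifiers.
Variables (A : Type) (X : context A).

Lemma def_has (b : A -> nat -> bool) :
  definable (add_var X) (fun p => b p.1 p.2) ->
  definable X (fun a => has (b a) (iota 0 (cx_bound X a))).
Proof.
move=> db; have dacc : definable (add_var (add_var X)) (fun p => p.2).
  by exists (EVar 0).
have [e He] := def_fold (g := fun a i acc => if acc == 0 then b a i : nat else 1)
  (def_nat X 0) (def_if (def_eq dacc (def_nat _ 0)) (def_add_var db) (def_nat _ 1)).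
exists e => a; rewrite He; elim: (cx_bound X a) => // n IHn.
rewrite -[in iota 0 n.+1]addn1 iotaD has_cat /= orbF IHn.
by case: (has _ _).
Qed.

Lemma def_all (b : A -> nat -> bool) :
  definable (add_var X) (fun p => b p.1 p.2) ->
  definable X (fun a => all (b a) (iota 0 (cx_bound X a))).
Proof.
move=> db; have [e He] := def_not (def_has (b := fun a i => ~~ b a i) (def_not db)).
by exists e => a; rewrite He has_predC negbK.
Qed.

Lemma def_sum (f : A -> nat -> nat) :
  definable (add_var X) (fun p => f p.1 p.2) ->
  definable X (fun a => \sum_(0 <= i < cx_bound X a) f a i).
Proof.
move=> df; have dacc : definable (add_var (add_var X)) (fun p => p.2).
  by exists (EVar 0).
have [e He] := def_fold (g := fun a i acc => acc + f a i) (def_nat X 0)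
  (def_add dacc (def_add_var df)).
exists e => a; rewrite He; elim: (cx_bound X a) => [|n IHn] /=.
  by rewrite big_geq.
by rewrite big_nat_recr //= -IHn.
Qed.

End BoundedQuantifiers.

Ltac lift_def X H :=
  match type of H with
  | @definable _ X _ => H
  | _ => match X with
         | add_var ?Y => let H' := lift_def Y H in constr:(def_add_var H')
         | add_tab ?Y => let H' := lift_def Y H in constr:(def_add_tab H')
         end
  end.

Ltac def_hyp :=
  match goal with
  | |- @definable _ ?X _ =>
      match goal with
      | H : definable _ _ |- _ => let H' := lift_def X H in exact H'
      end
  end.

Ltac def_var_step := first
  [ exact: (@def_var _ _ 0 _ (fun=> erefl)) | exact: (@def_var _ _ 1 _ (fun=> erefl))
  | exact: (@def_var _ _ 2 _ (fun=> erefl)) | exact: (@def_var _ _ 3 _ (fun=> erefl))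
  | exact: (@def_var _ _ 4 _ (fun=> erefl)) | exact: (@def_var _ _ 5 _ (fun=> erefl))
  | exact: (@def_var _ _ 6 _ (fun=> erefl)) | exact: (@def_var _ _ 7 _ (fun=> erefl))
  | exact: (@def_var _ _ 8 _ (fun=> erefl)) | exact: (@def_var _ _ 9 _ (fun=> erefl)) ].

(** The head symbol selects the closure lemma, so that definability proofs follow the syntax of the
    definitions. *)
Ltac def_step := cbv beta; lazymatch goal with
  | |- definable _ (fun a => nat_of_bool (@?b a && @?c a)) => apply: def_and
  | |- definable _ (fun a => nat_of_bool (@?b a || @?c a)) => apply: def_or
  | |- definable _ (fun a => nat_of_bool (@?b a ==> @?c a)) => apply: def_imply
  | |- definable _ (fun a => nat_of_bool (~~ @?b a)) => apply: def_not
  | |- definable _ (fun a => nat_of_bool (@?f a <= @?g a)) => apply: def_leq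
  | |- definable _ (fun a => nat_of_bool (@?f a == @?g a)) => apply: def_eq
  | |- definable _ (fun a => nat_of_bool (has (@?b a) (@?w1 a))) => apply: def_has
  | |- definable _ (fun a => nat_of_bool (all (@?b a) (@?w1 a))) => apply: def_all
  | |- definable _ (fun a => (@?f a).+1) => first [exact: def_nat | apply: def_succ]
  | |- definable _ (fun a => @?f a + @?g a) => apply: def_add
  | |- definable _ (fun a => @?f a - @?g a) => apply: def_sub
  | |- definable _ (fun a => nth 0 (@?V a) (@?f a)) =>
      first [ apply: (@def_get _ _ 0 V); [by [] |] | apply: def_input ]
  | |- definable _ (fun a => nat_of_bool (@?b a)) => first [ def_hyp | apply: def_ifb ]
  | |- definable _ (fun a => 0) => exact: def_nat
  | |- _ => first [ def_hyp | def_var_step | exact: def_bound | apply: def_if ]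
  end.

(** * The algorithm *)

Section Algorithm.
Variables (N : nat) (inp : seq nat).

(* Truncated to y <= N. *)
Definition mulc x y := iteri N (fun i acc => if i < y then acc + x else acc) 0.

(** The quotient is the number of positive multiples of [b] up to [w]. *)
Definition divc w b := \sum_(0 <= i < N) (mulc b i.+1 <= w).

(** Division is repeated because the power [b ^ j] may exceed [N]. *)
Definition dropc b w j := iteri N (fun i acc => if i < j then divc acc b else acc) w.

Definition order_G := nth 0 inp 0.
Definition order_F := nth 0 inp 1.

Definition digc w j :=
  dropc order_G.+2 w j - mulc (divc (dropc order_G.+2 w j) order_G.+2) order_G.+2.

(** The offset 2 skips the two orders at the head of the input. *)
Definition edge_G u v := [&& u < order_G, v < order_G
  & nth 0 inp (mulc u order_G + v).+2 != 0].

Definition edge_F x y := [&& x < order_F, y < order_F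
  & nth 0 inp (mulc order_G order_G + (mulc x order_F + y)).+2 != 0].

(* G if c = 0, and F minus the edge {y, z} otherwise. *)
Definition edgec c y z u v := if c == 0 then edge_G u v else
  edge_F u v && ~~ ((u == y) && (v == z) || (u == z) && (v == y)).

(** Round 0 marks [u], each of rounds 1 to [k] adds the neighbours of the marked vertices, and later
    rounds copy the table. *)
Definition walkc c y z k u v := nth 0 (iteri N (fun i V => mkseq (fun x =>
  if i == 0 then x == u : nat
  else if i <= k then
    (nth 0 V x != 0) || has (fun w => (nth 0 V w != 0) && edgec c y z w x) (iota 0 N) : nat
  else nth 0 V x) N) [::]) v != 0.

Definition connc u v := walkc 0 0 0 N u v.

(* Digits are shifted by one: 0 means absent. *)
Definition pinc U X i := (0 < digc U i <= order_G) && (0 < digc X i <= order_F).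

(** Comparing walks of every length [k] states that distances in F are at most those in G without
    computing either. *)
Definition pin_distances U X := all (fun i => all (fun j =>
  pinc U X i && pinc U X j ==> all (fun k =>
    walkc 0 0 0 k (digc U i - 1) (digc U j - 1) ==>
    walkc 1 0 0 k (digc X i - 1) (digc X j - 1)) (iota 0 N)) (iota 0 N)) (iota 0 N).

Definition demandc a b j := (0 < digc a j <= order_F) && (0 < digc b j <= order_F).

Definition edges_covered U X a b := all (fun y => all (fun z => edge_F y z ==>
  has (fun i => has (fun j => [&& pinc U X i, pinc U X j,
      connc (digc U i - 1) (digc U j - 1)
    & ~~ walkc 1 y z N (digc X i - 1) (digc X j - 1)]) (iota 0 N)) (iota 0 N)
  || has (fun j => demandc a b j && ~~ walkc 1 y z N (digc a j - 1) (digc b j - 1))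
       (iota 0 N)) (iota 0 N)) (iota 0 N).

Definition isolated_covered U X := all (fun x => (x < order_F) ==>
  has (fun y => edge_F x y) (iota 0 N)
  || has (fun i => pinc U X i && (digc X i - 1 == x)) (iota 0 N)) (iota 0 N).

Definition demands_long a b r := all (fun j => demandc a b j ==>
  walkc 1 0 0 (digc r j) (digc a j - 1) (digc b j - 1)) (iota 0 N).

Definition free_component U X v := [&& v < order_G,
  all (fun w => (w < v) ==> ~~ connc v w) (iota 0 N)
  & all (fun i => pinc U X i ==> ~~ connc v (digc U i - 1)) (iota 0 N)].

(** The component of [v] has diameter at least [d]. *)
Definition wide v d := has (fun u => has (fun w => [&& connc v u, connc v w
  & (d == 0) || ~~ walkc 0 0 0 (d - 1) u w]) (iota 0 N)) (iota 0 N).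

(** A free component serves a single demand, hence the change in one digit only. *)
Definition supply_step v r r' := has (fun j =>
  all (fun j' => (j' == j) || (digc r' j' == digc r j')) (iota 0 N)
  && wide v (digc r j - digc r' j)) (iota 0 N).

(* Cell r of round i tells whether the unpinned components represented by
   vertices < i can cover r_j edges of each demand j. *)
Definition supplied U X r := nth 0 (iteri N (fun i V => mkseq (fun r =>
  if i == 0 then r == 0 : nat else
  (nth 0 V r != 0) || free_component U X (i - 1) &&
     has (fun r' => (nth 0 V r' != 0) && supply_step (i - 1) r r') (iota 0 N) : nat)
  N) [::]) r != 0.

Definition certificate U X a b r := [&& pin_distances U X, edges_covered U X a b,
  isolated_covered U X, demands_long a b r & supplied U X r].

(** Identifications never add vertices, so [order_F <= order_G] is necessary; it also makes the
    vertices of F digits in base [order_G.+2]. *)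
Definition answer := if order_F == 0 then order_G == 0 else
  (order_F <= order_G) && has (fun U => has (fun X => has (fun a => has (fun b =>
    has (fun r => certificate U X a b r) (iota 0 N)) (iota 0 N)) (iota 0 N))
    (iota 0 N)) (iota 0 N).

Definition trivial_instance := (order_F == 0) || (order_G < order_F).

Definition bound1 := if trivial_instance then 2 else order_G.+2.

Definition leaf_count := \sum_(0 <= x < N)
  ((x < order_F) && (\sum_(0 <= y < N) edge_F x y <= 1)).

(** Eight factors [order_G.+2] for each pair of leaves make room for [8 * leaf_count ^ 2] digits. *)
Definition bound2 := if trivial_instance then 2 else
  iteri N (fun i acc => if i < leaf_count then
    iteri N (fun j acc' => if j < leaf_count then
      mulc (mulc (mulc (mulc (mulc (mulc (mulc (mulc acc'
        order_G.+2) order_G.+2) order_G.+2) order_G.+2)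
        order_G.+2) order_G.+2) order_G.+2) order_G.+2
      else acc') acc else acc) 1.

End Algorithm.

(** * The algorithm is definable by expressions *)

Section AlgorithmDefinable.
Variables (A : Type) (X : context A).
Local Notation NN := (cx_bound X).
Local Notation II := (cx_input X).
Implicit Types f g h : A -> nat.

Lemma def_mulc f g : definable X f -> definable X g ->
  definable X (fun a => mulc (NN a) (f a) (g a)).
Proof. by move=> df dg; apply: def_fold; repeat def_step. Qed.

Lemma def_order_G : definable X (fun a => order_G (II a)).
Proof. by apply: def_input; apply: def_nat. Qed.

Lemma def_order_F : definable X (fun a => order_F (II a)).
Proof. by apply: def_input; apply: def_nat. Qed.

End AlgorithmDefinable.

Ltac def_step1 := cbv beta; lazymatch goal with
  | |- definable _ (fun a => order_G (@?w1 a)) => exact: def_order_G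
  | |- definable _ (fun a => order_F (@?w1 a)) => exact: def_order_F
  | |- definable _ (fun a => mulc (@?w1 a) (@?w2 a) (@?w3 a)) => apply: def_mulc
  | |- _ => def_step
  end.

Lemma def_divc A (X : context A) f g : definable X f -> definable X g ->
  definable X (fun a => divc (cx_bound X a) (f a) (g a)).
Proof. by move=> df dg; apply: def_sum; repeat def_step1. Qed.

Lemma def_dropc A (X : context A) f g h :
  definable X f -> definable X g -> definable X h ->
  definable X (fun a => dropc (cx_bound X a) (f a) (g a) (h a)).
Proof.
move=> df dg dh; apply: def_fold => //.
by repeat first [apply: def_divc | def_step1].
Qed.

Lemma def_digc A (X : context A) f g : definable X f -> definable X g ->
  definable X (fun a => digc (cx_bound X a) (cx_input X a) (f a) (g a)).
Proof.
move=> df dg; rewrite /digc.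
by repeat first [apply: def_dropc | apply: def_divc | def_step1].
Qed.

Lemma def_edge_G A (X : context A) f g : definable X f -> definable X g ->
  definable X (fun a => edge_G (cx_bound X a) (cx_input X a) (f a) (g a)).
Proof. by move=> df dg; rewrite /edge_G; repeat def_step1. Qed.

Lemma def_edge_F A (X : context A) f g : definable X f -> definable X g ->
  definable X (fun a => edge_F (cx_bound X a) (cx_input X a) (f a) (g a)).
Proof. by move=> df dg; rewrite /edge_F; repeat def_step1. Qed.

Lemma def_walkc A (X : context A) c y z k u v :
  definable X c -> definable X y -> definable X z -> definable X k ->
  definable X u -> definable X v ->
  definable X (fun a => walkc (cx_bound X a) (cx_input X a) (c a) (y a) (z a) (k a)
    (u a) (v a)).
Proof.
move=> dc dy dz dk du dv; rewrite /walkc /edgec.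
apply: def_not; apply: def_eq; last exact: def_nat.
apply: def_iter; last by [].
by repeat lazymatch goal with
  | |- definable _ (fun a => nat_of_bool (edge_G (@?w1 a) (@?w2 a) (@?w3 a) (@?w4 a))) =>
      apply: def_edge_G
  | |- definable _ (fun a => nat_of_bool (edge_F (@?w1 a) (@?w2 a) (@?w3 a) (@?w4 a))) =>
      apply: def_edge_F
  | |- _ => def_step1
  end.
Qed.

Lemma def_connc A (X : context A) u v : definable X u -> definable X v ->
  definable X (fun a => connc (cx_bound X a) (cx_input X a) (u a) (v a)).
Proof. by move=> du dv; apply: def_walkc; repeat def_step1. Qed.

Ltac def_step2 := cbv beta; lazymatch goal with
  | |- definable _ (fun a => digc (@?w1 a) (@?w2 a) (@?w3 a) (@?w4 a)) => apply: def_digc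
  | |- definable _ (fun a => nat_of_bool (edge_G (@?w1 a) (@?w2 a) (@?w3 a) (@?w4 a))) =>
      apply: def_edge_G
  | |- definable _ (fun a => nat_of_bool (edge_F (@?w1 a) (@?w2 a) (@?w3 a) (@?w4 a))) =>
      apply: def_edge_F
  | |- definable _ (fun a => nat_of_bool (connc (@?w1 a) (@?w2 a) (@?w3 a) (@?w4 a))) =>
      apply: def_connc
  | |- definable _ (fun a => nat_of_bool (walkc (@?w1 a) (@?w2 a) (@?w3 a) (@?w4 a)
         (@?w5 a) (@?w6 a) (@?w7 a) (@?w8 a))) => apply: def_walkc
  | |- _ => def_step1
  end.

Lemma def_answer : definable base_context (fun a => answer a.1 a.2).
Proof.
have dpin A (X : context A) f g h : definable X f -> definable X g -> definable X h ->
    definable X (fun a => pinc (cx_bound X a) (cx_input X a) (f a) (g a) (h a)).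
  by move=> *; rewrite /pinc; repeat def_step2.
have ddem A (X : context A) f g h : definable X f -> definable X g -> definable X h ->
    definable X (fun a => demandc (cx_bound X a) (cx_input X a) (f a) (g a) (h a)).
  by move=> *; rewrite /demandc; repeat def_step2.
have dfree A (X : context A) f g h : definable X f -> definable X g -> definable X h ->
    definable X (fun a => free_component (cx_bound X a) (cx_input X a) (f a) (g a) (h a)).
  by move=> *; rewrite /free_component;
    repeat (try (apply: dpin; repeat def_step2); def_step2).
have dwide A (X : context A) f g : definable X f -> definable X g ->
    definable X (fun a => wide (cx_bound X a) (cx_input X a) (f a) (g a)).
  by move=> *; rewrite /wide; repeat def_step2.
have dstep A (X : context A) f g h : definable X f -> definable X g -> definable X h ->
    definable X (fun a => supply_step (cx_bound X a) (cx_input X a) (f a) (g a) (h a)).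
  move=> *; rewrite /supply_step; apply: def_has; apply: def_and.
    by repeat def_step2.
  by apply: dwide; repeat def_step2.
have dsup A (X : context A) f g h : definable X f -> definable X g -> definable X h ->
    definable X (fun a => supplied (cx_bound X a) (cx_input X a) (f a) (g a) (h a)).
  move=> *; rewrite /supplied; apply: def_not; apply: def_eq; last exact: def_nat.
  apply: def_iter; last by [].
  repeat lazymatch goal with
  | |- definable _ (fun a => nat_of_bool (free_component (@?w1 a) (@?w2 a) (@?w3 a)
         (@?w4 a) (@?w5 a))) => apply: dfree
  | |- definable _ (fun a => nat_of_bool (supply_step (@?w1 a) (@?w2 a) (@?w3 a)
         (@?w4 a) (@?w5 a))) => apply: dstep
  | |- _ => def_step2
  end.
rewrite /answer /certificate /pin_distances /edges_covered /isolated_covered /demands_long.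
repeat lazymatch goal with
  | |- definable _ (fun a => nat_of_bool (pinc (@?w1 a) (@?w2 a) (@?w3 a)
         (@?w4 a) (@?w5 a))) => apply: dpin
  | |- definable _ (fun a => nat_of_bool (demandc (@?w1 a) (@?w2 a) (@?w3 a)
         (@?w4 a) (@?w5 a))) => apply: ddem
  | |- definable _ (fun a => nat_of_bool (supplied (@?w1 a) (@?w2 a) (@?w3 a)
         (@?w4 a) (@?w5 a))) => apply: dsup
  | |- _ => def_step2
  end.
Qed.

Lemma def_bound1 : definable base_context (fun a => bound1 a.2).
Proof. by rewrite /bound1 /trivial_instance; repeat def_step2. Qed.

Lemma def_bound2 : definable base_context (fun a => bound2 a.1 a.2).
Proof.
have dl A (X : context A) :
    definable X (fun a => leaf_count (cx_bound X a) (cx_input X a)).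
  by apply: def_sum; apply: def_and; [|apply: def_leq; first apply: def_sum];
    repeat def_step2.
rewrite /bound2 /trivial_instance; apply: def_if; [repeat def_step2..|].
apply: def_fold; first exact: def_nat.
apply: def_if; [by apply: def_leq; [repeat def_step2 | apply: dl] | | def_step2].
apply: def_fold; first by def_step2.
apply: def_if; [by apply: def_leq; [repeat def_step2 | apply: dl] | | def_step2].
by repeat def_step2.
Qed.

(** * Digits *)

Lemma mulcE N x y : mulc N x y = x * minn y N.
Proof.
rewrite /mulc; elim: N => [|N /= ->]; first by rewrite minn0 muln0.
by case: ltnP => ?; [rewrite (_ : minn y N.+1 = N.+1) ?(minn_idPr _); nia
                    | rewrite !(minn_idPl _) //; lia].
Qed.

Lemma divcE N w b : 0 < b -> w <= N -> divc N w b = w %/ b.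
Proof.
move=> b0 leN; have qN : w %/ b <= N by rewrite (leq_trans (leq_div _ _)).
rewrite /divc (big_cat_nat (leq0n (w %/ b)) qN) /=.
have divE i : i < N -> (mulc N b i.+1 <= w) = (i < w %/ b).
  by move=> lti; rewrite mulcE (minn_idPl lti) mulnC leq_divRL.
rewrite (eq_big_nat _ _ (F2 := fun=> 1)) => [|i lti]; last first.
  by rewrite divE; lia.
rewrite [X in _ + X](eq_big_nat _ _ (F2 := fun=> 0)) => [|i lti]; last first.
  by rewrite divE; lia.
by rewrite !sum_nat_const_nat muln0 muln1 addn0 subn0.
Qed.

Lemma dropcE N b w j : 0 < b -> w <= N -> j <= N -> dropc N b w j = w %/ b ^ j.
Proof.
move=> b0 leN lej.
suff H k : iteri k (fun i acc => if i < j then divc N acc b else acc) w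
    = w %/ b ^ minn j k by rewrite /dropc H (minn_idPl lej).
elim: k => [|k /= ->]; first by rewrite minn0 divn1.
case: ltnP => ltk; last by rewrite (minn_idPl (leqW ltk)).
rewrite (minn_idPr ltk) divcE // ?expnSr ?divnMA //.
exact: leq_trans (leq_div _ _) leN.
Qed.

Definition digit b w j := (w %/ b ^ j) %% b.

Lemma digcE N inp w j : (order_G inp).+2 <= N -> w <= N -> j <= N ->
  digc N inp w j = digit (order_G inp).+2 w j.
Proof.
move=> leb lew lej; rewrite /digc dropcE // divcE //; last first.
  exact: leq_trans (leq_div _ _) lew.
by rewrite mulcE (minn_idPl leb) /digit {1}(divn_eq (w %/ _) (order_G inp).+2) addKn.
Qed.

Lemma digit_code b K (g : nat -> nat) : 0 < b -> (forall j, g j < b) ->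
  exists2 w, w < b ^ K & forall j, digit b w j = if j < K then g j else 0.
Proof.
move=> b0; elim: K g => [|K IHK] g ltg.
  by exists 0 => // j; rewrite /digit div0n mod0n.
have [w ltw Hw] := IHK (fun j => g j.+1) (fun j => ltg j.+1).
exists (w * b + g 0) => [|[|j]]; first by rewrite expnSr; have := ltg 0; nia.
  by rewrite /digit divn1 modnMDl modn_small.
by rewrite /digit expnS divnMA divnMDl // (divn_small (ltg 0)) addn0; apply: Hw.
Qed.

(** * Walks *)

Definition walk (e : rel nat) k u v : Prop :=
  exists p, [/\ path e u p, last u p = v & size p <= k].

Section Walks.
Variable e : rel nat.

Lemma walk_refl k u : walk e k u u.
Proof. by exists [::]. Qed.

Lemma walk_leq k k' u v : k <= k' -> walk e k u v -> walk e k' u v.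
Proof. by move=> lek [p [ep lp sp]]; exists p; split=> //; apply: leq_trans lek. Qed.

Lemma walk1 u v : e u v -> walk e 1 u v.
Proof. by move=> euv; exists [:: v]; rewrite /= euv. Qed.

Lemma walk_trans k k' u v w : walk e k u v -> walk e k' v w -> walk e (k + k') u w.
Proof.
move=> [p [ep lp sp]] [q [eq lq sq]]; exists (p ++ q).
by rewrite cat_path last_cat ep lp eq lq size_cat leq_add.
Qed.

Lemma walk_sym k u v : symmetric e -> walk e k u v -> walk e k v u.
Proof.
move=> syme [p [ep <- sp]]; exists (rev (belast u p)).
rewrite rev_path size_rev size_belast; split=> //.
  by rewrite (eq_path (e' := e)) // => x y; rewrite syme.
case: p {ep sp} => //= x p; by rewrite rev_cons last_rcons.
Qed.

Lemma walk_last k u v : walk e k.+1 u v <->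
  walk e k u v \/ exists2 w, walk e k u w & e w v.
Proof.
split=> [[p [ep lp sp]]|[/(walk_leq (leqnSn k)) //|[w wk ewv]]]; last first.
  by rewrite -addn1; apply: walk_trans wk (walk1 ewv).
case/lastP: p ep lp sp => [|p x]; first by move=> _ /= <- _; left; apply: walk_refl.
rewrite rcons_path last_rcons size_rcons => /andP [ep ex] <- sp.
by right; exists (last u p) => //; exists p.
Qed.

Lemma walk0 u v : walk e 0 u v <-> u = v.
Proof.
split=> [[p [_ lp]]|->]; last exact: walk_refl.
by rewrite leqn0 => /nilP ep; rewrite -lp ep.
Qed.

Lemma walk_shorten n k u v : (forall x y, e x y -> y < n) ->
  walk e k u v -> walk e n u v.
Proof.
move=> bnd [p [ep lp _]]; case/shortenP: ep lp => q eq uq _ lq.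
exists q; split=> //; rewrite -(size_iota 0 n).
move: uq => /= /andP [_ uq]; apply: uniq_leq_size => // x.
rewrite mem_iota add0n leq0n /= => /(nthP 0) [i lti <-].
by have /pathP := eq => /(_ 0 i lti); apply: bnd.
Qed.

Lemma walk_head k u v : walk e k u v -> u = v \/ exists2 w, e u w & 0 < k /\ walk e k.-1 w v.
Proof.
move=> [[|x p] [/= ep lp sp]]; first by left.
move: ep => /andP [eux ep]; right; exists x => //; split; first by lia.
by exists p; split=> //; lia.
Qed.

End Walks.

(** A map that keeps or contracts edges does not increase distances; this makes the distance
    condition on pins necessary. *)
Lemma walk_image (e e' : rel nat) (f : nat -> nat) k u v :
  (forall x y, e x y -> f x = f y \/ e' (f x) (f y)) ->
  walk e k u v -> walk e' k (f u) (f v).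
Proof.
move=> hom [p [ep lp sp]]; elim: p k u ep lp sp => [|x p IHp] [|k] u //=.
- by move=> _ -> _; apply: walk_refl.
- by move=> _ -> _; apply: walk_refl.
move=> /andP [eux ep] lp sp; have wk := IHp k x ep lp sp.
case: (hom _ _ eux) => [->|e'ux]; first exact: walk_leq wk.
by rewrite -add1n; apply: walk_trans (walk1 e'ux) wk.
Qed.

Section WalkTable.
Variables (N : nat) (inp : seq nat).
Hypotheses (leN : (order_G inp).+2 <= N) (lemn : order_F inp <= order_G inp).

Lemma edgec_bound c y z u v : edgec N inp c y z u v ->
  u < order_G inp /\ v < order_G inp.
Proof.
rewrite /edgec; case: eqP => _; first by move=> /and3P [].
by move=> /andP [/and3P [? ? _] _]; split; lia.
Qed.

Lemma walkcP c y z k u v : u < N -> v < N ->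
  reflect (walk (edgec N inp c y z) k u v) (walkc N inp c y z k u v).
Proof.
move=> ltu ltv; set e := edgec N inp c y z.
have bnd x x' : e x x' -> x' < order_G inp by move=> /edgec_bound [].
(* Round 0 only initializes, so [N] rounds reach [N.-1] steps. The cut is harmless, as every walk
   shortens to at most [order_G inp] steps. *)
apply: (@equivP (walk e (minn k N.-1) u v)); last first.
  split; first by apply: walk_leq; apply: geq_minl.
  move=> wk; have := walk_shorten bnd wk; case: (leqP k N.-1) => [//|ltk].
  by apply: walk_leq; lia.
rewrite /walkc; set step := fun i V => _.
have NE : N.-1.+1 = N by lia.
suff H i x : x < N -> nth 0 (iteri i.+1 step [::]) x != 0 <-> walk e (minn k i) u x.
  by have := H N.-1 v ltv; rewrite NE => HN; apply: (iffP idP) => /HN.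
elim: i x => [|i IHi] x ltx.
  rewrite minn0 walk0 /= nth_mkseq //=.
  by split=> [|->]; [case: (x =P u) | rewrite eqxx].
rewrite [iteri i.+2 _ _]/= {1}/step nth_mkseq //.
rewrite [i.+1 == 0]/=; case: (leqP i.+1 k) => lek; last first.
  by rewrite IHi // (minn_idPl _) //; lia.
rewrite walk_last; move: IHi; rewrite (minn_idPr (ltnW lek)) => IHi.
rewrite -(IHi x ltx).
have -> b : ((nat_of_bool b) != 0) = b by case: b.
split=> [/orP [|/hasP [w]]|[->//|[w wk ewx]]]; first by left.
  rewrite mem_iota add0n => /andP [_ ltw] /andP [/IHi wk ewx].
  by right; exists w => //; apply: wk.
apply/orP; right; apply/hasP; exists w.
  by rewrite mem_iota add0n /=; have [? _] := edgec_bound ewx; lia.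
by apply/andP; split=> //; apply/IHi => //; have [? _] := edgec_bound ewx; lia.
Qed.

End WalkTable.

(** * Identifications as maps *)

(** These are the compactions of G onto F with a loop added at every vertex; fibres need not be
    connected, as any two vertices may be identified. *)
Record good (G F : sgraph) (f : G -> F) : Prop := Good {
  good_onto : forall x, exists u, f u = x;
  good_hom : forall u v, adj u v -> f u = f v \/ adj (f u) (f v);
  good_edge : forall x y, adj x y -> exists u v, [/\ adj u v, f u = x & f v = y] }.

Lemma good_comp (G H F : sgraph) (g : G -> H) (f : H -> F) :
  good g -> good f -> good (f \o g).
Proof.
move=> [g1 g2 g3] [f1 f2 f3]; split=> [x|u v auv|x y axy] /=.
- by have [y <-] := f1 x; have [u <-] := g1 y; exists u.
- by have [->|/f2] := g2 _ _ auv; [left|].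
- have [a [b [aab <- <-]]] := f3 _ _ axy; have [u [v [auv <- <-]]] := g3 _ _ aab.
  by exists u, v.
Qed.

Section Quotient.
Variables (G : sgraph) (u v : G).
Hypothesis neq_uv : u != v.

Definition quotient_map (w : G) : identify u v := insub w.

Variant quotient_spec (w : G) : identify u v -> Prop :=
| QuotientSome (x : {x : G | (x != u) && (x != v)}) :
    val x = w -> quotient_spec w (Some x : identify u v)
| QuotientNone : w = u \/ w = v -> quotient_spec w (None : identify u v).

Lemma quotientP w : quotient_spec w (quotient_map w).
Proof.
rewrite /quotient_map; case: insubP => [x _ <-|]; first exact: QuotientSome.
by rewrite negb_and !negbK => /orP [] /eqP ->; constructor; [left | right].
Qed.

Lemma quotient_val (x : {x : G | (x != u) && (x != v)}) :
  quotient_map (val x) = Some x.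
Proof. exact: valK. Qed.

Lemma quotient_u : quotient_map u = None.
Proof. by rewrite /quotient_map insubF ?eqxx. Qed.

Lemma quotient_v : quotient_map v = None.
Proof. by rewrite /quotient_map insubF ?eqxx ?andbF. Qed.

Lemma quotient_good : good quotient_map.
Proof.
split=> [[x|]|a b|[x|] [y|]] //=.
- by exists (val x); apply: quotient_val.
- by exists u; apply: quotient_u.
- case: quotientP => [x <-|ea]; case: quotientP => [y <-|eb] /=.
  + by right.
  + by case: eb => ->; rewrite adj_sym => ax; right; rewrite ax ?orbT.
  + by case: ea => -> ax; right; rewrite ax ?orbT.
  + by left.
- by move=> axy; exists (val x), (val y); rewrite !quotient_val.
- move=> /orP [] ax; [exists (val x), u | exists (val x), v].
    by rewrite quotient_val quotient_u adj_sym.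
  by rewrite quotient_val quotient_v adj_sym.
- move=> /orP [] ax; [exists u, (val y) | exists v, (val y)].
    by rewrite quotient_val quotient_u.
  by rewrite quotient_val quotient_v.
Qed.

Lemma card_identify : #|identify u v| < #|G|.
Proof.
rewrite card_option card_sig; have := cardC (pred2 u v).
rewrite card2 neq_uv (@eq_card _ (predC (pred2 u v)) [pred x | (x != u) && (x != v)]).
  by move=> <-.
by move=> x; rewrite !inE negb_or.
Qed.

(** Edges stay covered: an edge of F has distinct ends, so an edge of G above it is not collapsed by
    the quotient. *)
Lemma good_factor (F : sgraph) (f : G -> F) : f u = f v -> good f ->
  exists g : identify u v -> F, good g.
Proof.
move=> fuv [f1 f2 f3].
pose g (x : identify u v) := if x is Some w then f (val w) else f u.
have gE w : g (quotient_map w) = f w.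
  by case: quotientP => [x <-|[->|->]].
exists g; split=> [x|a b aab|x y axy].
- by have [w <-] := f1 x; exists (quotient_map w).
- have [a' [b' [aab' <- <-]]] := good_edge quotient_good aab.
  by rewrite !gE; apply: f2.
- have [a [b [aab ea eb]]] := f3 _ _ axy; exists (quotient_map a), (quotient_map b).
  rewrite !gE; split=> //; case: (good_hom quotient_good aab) => // eqab.
  by move: axy; rewrite -ea -eb -!gE eqab adj_irrefl.
Qed.

End Quotient.

(** For the converse, induction on the order of G: an injective good map is an isomorphism, and any
    other factors through the identification of two vertices with equal images. *)
Lemma identification_good (G F : sgraph) :
  Identification G F <-> exists f : G -> F, good f.
Proof.
split.
  elim=> {}G; last by move=> u v neq _ [f gf]; exists (f \o @quotient_map G u v);
    apply: good_comp gf; apply: quotient_good.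
  move=> [f [g fK gK] mono]; exists f; split=> [x|u v|x y axy].
  - by exists (g x).
  - by rewrite -mono; right.
  - by exists (g x), (g y); rewrite -mono !gK.
move=> [f]; have [k] := ubnP #|G|; elim: k G f => // k IHk G f ltk gf.
case: (boolP (injectiveb f)) => [/injectiveP injf|].
  apply: identifies_iso; exists f => [|u v].
    apply: inj_card_bij => //; rewrite leqNgt; apply/negP => ltc.
    have [g Hg] := fin_all_exists (good_onto gf).
    have injg : injective g by move=> x y eg; rewrite -(Hg x) eg Hg.
    by have := leq_card _ injg; lia.
  apply/idP/idP => [afuv|auv].
    by have [u' [v' [auv /injf <- /injf <-]]] := good_edge gf afuv.
  case: (good_hom gf auv) => // /injf euv.
  by move: auv; rewrite euv adj_irrefl.
move=> /injectivePn [u [v neq fuv]]; apply: (identifies_step neq).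
have [g gg] := good_factor fuv gf; apply: IHk gg.
exact: leq_trans (card_identify neq) ltk.
Qed.

(** * Instances as relations on natural numbers *)

Record good_map (n m : nat) (eG eF : rel nat) (f : nat -> nat) : Prop := GoodMap {
  map_lt : forall u, u < n -> f u < m;
  map_onto : forall x, x < m -> exists2 u, u < n & f u = x;
  map_hom : forall u v, eG u v -> f u = f v \/ eF (f u) (f v);
  map_edge : forall x y, eF x y -> exists u v, [/\ eG u v, f u = x & f v = y] }.

Lemma nth_allpairs (T S : Type) (f : T -> S -> nat) x0 y0 s t i j :
  i < size s -> j < size t ->
  nth 0 [seq f x y | x <- s, y <- t] (i * size t + j) = f (nth x0 s i) (nth y0 t j).
Proof.
move=> + ltj; elim: s i => [|x s IHs] [|i] //= lti; rewrite nth_cat size_map.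
  by rewrite ltj (nth_map y0).
by rewrite ltnNge mulSn -addnA leq_addr addKn IHs.
Qed.

Lemma size_adj_matrix (G : sgraph) : size (adj_matrix G) = #|G| * #|G|.
Proof. by rewrite size_allpairs -cardE. Qed.

Lemma nth_adj_matrix (G : sgraph) (u v : G) s :
  nth 0 (adj_matrix G ++ s) (enum_rank u * #|G| + enum_rank v) = adj u v.
Proof.
have ltu := ltn_ord (enum_rank u); have ltv := ltn_ord (enum_rank v).
have ltM a b c : a < c -> b < c -> a * c + b < c * c by nia.
rewrite nth_cat size_adj_matrix ifT; last exact: ltM.
rewrite /adj_matrix [X in _ * X]cardE (nth_allpairs _ u v) -?cardE //.
by rewrite !nth_enum_rank.
Qed.

Section Encoding.
Variables (N : nat) (G F : sgraph).
Hypotheses (leN : #|G| <= N) (lemn : #|F| <= #|G|).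
Local Notation inp := (encode G F).
Local Notation rk := (fun x => nat_of_ord (enum_rank x)).

Lemma edge_GE (u v : G) : edge_G N inp (rk u) (rk v) = adj u v.
Proof.
rewrite /edge_G /order_G /= !ltn_ord /= mulcE (minn_idPl leN) nth_adj_matrix.
by case: (adj u v).
Qed.

Lemma edge_FE (x y : F) : edge_F N inp (rk x) (rk y) = adj x y.
Proof.
rewrite /edge_F /order_F /order_G /= !ltn_ord /= !mulcE (minn_idPl leN).
rewrite (minn_idPl (leq_trans lemn leN)) nth_cat size_adj_matrix ltnNge leq_addr addKn.
by rewrite /= -[adj_matrix F]cats0 nth_adj_matrix; case: (adj x y).
Qed.

Lemma rank_onto (T : finType) i : i < #|T| -> exists x : T, rk x = i.
Proof. by move=> lti; exists (enum_val (Ordinal lti)); rewrite enum_valK. Qed.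

Lemma rank_inj (T : finType) (x y : T) : rk x = rk y -> x = y.
Proof. by move=> /ord_inj /enum_rank_inj. Qed.

Lemma extend_rank (T : finType) (g : T -> nat) :
  exists h : nat -> nat, forall x, h (rk x) = g x.
Proof.
exists (nth 0 [seq g x | x <- enum T]) => x.
by rewrite (nth_map x) ?nth_enum_rank // -cardE.
Qed.

Lemma edge_G_rank u v : edge_G N inp u v ->
  exists a b : G, [/\ rk a = u, rk b = v & adj a b].
Proof.
move=> euv; have /and3P [ltu ltv _] := euv.
have [a ea] := rank_onto ltu; have [b eb] := rank_onto ltv.
by exists a, b; split=> //; rewrite -edge_GE ea eb.
Qed.

Lemma edge_F_rank u v : edge_F N inp u v ->
  exists a b : F, [/\ rk a = u, rk b = v & adj a b].
Proof.
move=> euv; have /and3P [ltu ltv _] := euv.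
have [a ea] := rank_onto ltu; have [b eb] := rank_onto ltv.
by exists a, b; split=> //; rewrite -edge_FE ea eb.
Qed.

Lemma identification_map : Identification G F <->
  exists f, good_map #|G| #|F| (edge_G N inp) (edge_F N inp) f.
Proof.
rewrite identification_good; split=> [[f [f1 f2 f3]]|[f [f0 f1 f2 f3]]].
  have [h hE] := extend_rank (fun u => rk (f u)).
  exists h; split=> [u ltu|x ltx|u v|x y].
  - by have [a <-] := rank_onto ltu; rewrite hE.
  - have [a <-] := rank_onto ltx; have [u <-] := f1 a.
    by exists (rk u); rewrite ?hE.
  - move=> /edge_G_rank [a [b [<- <- /f2 aab]]]; rewrite !hE edge_FE.
    by case: aab => [->|]; [left | right].
  - move=> /edge_F_rank [a [b [<- <- /f3 [u [v [auv <- <-]]]]]].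
    by exists (rk u), (rk v); rewrite edge_GE !hE.
have [g gE] : exists g : G -> F, forall u, rk (g u) = f (rk u).
  apply: (fin_all_exists (P := fun u x => rk x = f (rk u))) => u.
  by apply: rank_onto; apply: f0.
exists g; split=> [x|u v auv|x y axy].
- have [u ltu fu] := f1 (rk x) (ltn_ord _); have [a ea] := rank_onto ltu.
  by exists a; apply: rank_inj; rewrite gE ea.
- have := auv; rewrite -edge_GE => /f2; rewrite -!gE edge_FE.
  by case=> [/rank_inj|]; [left | right].
- have := axy; rewrite -edge_FE => /f3 [u [v [/edge_G_rank [a [b [ea eb aab]]] fu fv]]].
  by exists a, b; split=> //; apply: rank_inj; rewrite gE ?ea ?eb.
Qed.

End Encoding.

(** * Rooted forests *)

Section Forest.
Variable F : sgraph.
Hypothesis forestF : is_forest F.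

(** If every vertex of [A] had two neighbours in [A], a path could be extended without turning back
    and beyond the order of F, since a new end already on the path would close a cycle. *)
Lemma forest_leaf (A : {set F}) x0 : x0 \in A ->
  exists2 x, x \in A & #|[set y in A | adj x y]| <= 1.
Proof.
move=> Ax0; case: (boolP [exists x in A, #|[set y in A | adj x y]| <= 1]).
  by move=> /existsP [x /andP [Ax le1]]; exists x.
rewrite negb_exists => /forallP deg2.
suff [x [p [up _ _ sp]]] : exists x p, [/\ uniq (x :: p), path (@adj F) x p,
    x \in A & size p = #|F|].
  have := card_uniqP up; rewrite /= sp => cp.
  by have := max_card [in x :: p]; rewrite cp ltnn.
elim: #|F| => [|k [x [p [up pp Ax sp]]]]; first by exists x0, [::].
have := deg2 x; rewrite Ax /= -ltnNge => /card_gt1P [y [z [+ + neq]]].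
rewrite !inE => /andP [Ay axy] /andP [Az axz].
(* The path grows at its head [x]. For empty [p] the default of [head] is [x] itself, which is no
   neighbour of [x]. *)
have [w [Aw axw nw]] : exists w, [/\ w \in A, adj x w & w != head x p].
  case: (eqVneq y (head x p)) => [ey|ny]; last by exists y.
  by exists z; rewrite -ey eq_sym.
have wx : w != x by apply: contraTneq axw => ->; rewrite adj_irrefl.
case: (boolP (w \in p)) => wp; last first.
  exists w, (x :: p); split=> //=; last by rewrite sp.
    by rewrite inE negb_or wx wp.
  by rewrite adj_sym axw.
case/splitPr: wp up pp nw {sp} => p1 p2 up pp nw.
have: ucycle (@adj F) (x :: rcons p1 w).
  apply/andP; split.
    rewrite /= rcons_path; move: pp; rewrite cat_path rcons_path /= last_rcons.
    by move=> /and3P [-> -> _]; rewrite adj_sym axw.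
  move: up; rewrite -cat_rcons -cat_cons cat_uniq => /andP [//].
move=> /forestF /=; rewrite size_rcons; case: p1 nw {up pp} => //=.
by rewrite eqxx.
Qed.

(** Remove a leaf, root the rest, and hang the leaf below its only neighbour or make it a root.
    Roots are their own parents, which keeps [par] total. *)
Lemma forest_rooted : exists (par : F -> F) (dep : F -> nat),
  (forall x y, adj x y = (x != y) && ((par x == y) || (par y == x))) /\
  (forall x, dep x = if par x == x then 0 else (dep (par x)).+1).
Proof.
suff [par [dep [_ H1 H2]]] : exists (par : F -> F) (dep : F -> nat),
    [/\ (forall x, x \in [set: F] -> par x \in [set: F]),
    (forall x y, x \in [set: F] -> y \in [set: F] ->
      adj x y = (x != y) && ((par x == y) || (par y == x))) &
    (forall x, x \in [set: F] -> dep x = if par x == x then 0 else (dep (par x)).+1)].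
  by exists par, dep; split=> *; [apply: H1 | apply: H2]; rewrite inE.
have [k] := ubnP #|[set: F]|; elim: k [set: F] => // k IHk A ltk.
have [->|[x0 Ax0]] := set_0Vmem A; first by exists id, (fun=> 0); split=> ?; rewrite ?inE.
have [x Ax le1] := forest_leaf Ax0.
have [|par [dep [H0 H1 H2]]] := IHk (A :\ x).
  by have := cardsD1 x A; rewrite Ax; lia.
have inA y : y \in A -> y != x -> y \in A :\ x by move=> Ay ny; rewrite !inE ny Ay.
case: (set_0Vmem [set y in A | adj x y]) => [nbr0|[p]].
  exists (fun y => if y == x then x else par y),
         (fun y => if y == x then 0 else dep y).
  have nx y : y \in A -> adj x y = false.
    by move=> Ay; have /setP /(_ y) := nbr0; rewrite !inE Ay.
  split=> [y|y z|y] Ay.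
  - case: eqP => // /eqP ny; by have := H0 y (inA _ Ay ny); rewrite inE => /andP [].
  - move=> Az; case: (eqVneq y x) => [->|ny].
      rewrite (nx _ Az); case: (eqVneq z x) => [//|nz].
      apply/esym/negP => /eqP epz.
      by have := H0 z (inA _ Az nz); rewrite epz !inE eqxx.
    case: (eqVneq z x) => [->|nz]; last by apply: H1; apply: inA.
    rewrite adj_sym (nx _ Ay) ny /= [x == y]eq_sym (negPf ny) orbF.
    apply/esym/negP => /eqP epy.
    by have := H0 y (inA _ Ay ny); rewrite epy !inE eqxx.
  - case: (eqVneq y x) => [->|ny]; first by rewrite eqxx.
    rewrite (H2 y (inA _ Ay ny)); have := H0 y (inA _ Ay ny); rewrite !inE => /andP [n _].
    by rewrite (negPf n).
rewrite inE => /andP [Ap axp].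
have px : p != x by apply: contraTneq axp => ->; rewrite adj_irrefl.
have nx y : y \in A -> adj x y = (y == p).
  move=> Ay; apply/idP/eqP => [axy|->//].
  move: le1; rewrite leqNgt => /card_gt1P le1.
  by apply/eqP; apply/negPn/negP => ne; apply: le1; exists y, p; rewrite !inE Ay Ap.
exists (fun y => if y == x then p else par y),
       (fun y => if y == x then (dep p).+1 else dep y).
split=> [y|y z|y] Ay.
- case: eqP => // /eqP ny; by have := H0 y (inA _ Ay ny); rewrite inE => /andP [].
- move=> Az; case: (eqVneq y x) => [->|ny].
    rewrite (nx _ Az); case: (eqVneq z x) => [->|nz].
      by rewrite eq_sym (negPf px).
    rewrite eq_sym; case: eqP => //= _.
    apply/esym/negP => /eqP epz.
    by have := H0 z (inA _ Az nz); rewrite epz !inE eqxx.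
  case: (eqVneq z x) => [->|nz]; last by apply: H1; apply: inA.
  rewrite adj_sym (nx _ Ay) ny /= [p == y]eq_sym orbC; case: eqP => //= _.
  apply/esym/negP => /eqP epy.
  by have := H0 y (inA _ Ay ny); rewrite epy !inE eqxx.
- case: (eqVneq y x) => [->|ny]; first by rewrite (negPf px).
  rewrite (H2 y (inA _ Ay ny)); have := H0 y (inA _ Ay ny); rewrite !inE => /andP [n _].
  by rewrite (negPf n).
Qed.

End Forest.

Record rooted (m : nat) (e : rel nat) (par dep : nat -> nat) : Prop := Rooted {
  par_lt : forall x, x < m -> par x < m;
  edge_par : forall x y, e x y <-> [/\ x < m, y < m, x != y & par x = y \/ par y = x];
  dep_par : forall x, x < m -> dep x = if par x == x then 0 else (dep (par x)).+1 }.

Lemma forest_encoding_rooted N (G F : sgraph) : #|G| <= N -> #|F| <= #|G| ->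
  is_forest F -> exists par dep, rooted #|F| (edge_F N (encode G F)) par dep.
Proof.
move=> leN lemn forestF; have [par [dep [H1 H2]]] := forest_rooted forestF.
have [P PE] := extend_rank (fun x => enum_rank (par x) : nat).
have [D DE] := extend_rank dep.
have rkE (x y : F) : (nat_of_ord (enum_rank x) == enum_rank y) = (x == y).
  by apply/eqP/eqP => [/rank_inj|->].
exists P, D; split=> [x|x y|x].
- by move=> /rank_onto [a <-]; rewrite PE.
- split=> [/(edge_F_rank leN lemn) [a [b [<- <- aab]]]|].
    move: aab; rewrite H1 => /andP [ne /orP pp]; split=> //; first by rewrite rkE.
    by rewrite !PE; case: pp => /eqP ->; [left | right].
  move=> [/rank_onto [a <-] /rank_onto [b <-]]; rewrite rkE edge_FE // !PE H1 => ->.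
  by case=> /rank_inj ->; rewrite eqxx ?orbT.
- by move=> /rank_onto [a <-]; rewrite PE DE rkE H2; case: eqP => // _; rewrite DE.
Qed.

(** * Certificates *)

Lemma exists_min (T : Type) (P : T -> Prop) (F : T -> nat) :
  (exists x, P x) -> exists2 x, P x & forall y, P y -> F x <= F y.
Proof.
move=> [x]; have [k] := ubnP (F x); elim: k x => // k IHk x ltk Px.
case: (classic (exists2 y, P y & F y < F x)) => [[y Py lty]|no].
  by apply: (IHk y) => //; lia.
exists x => // y Py; rewrite leqNgt; apply/negP => lty.
by apply: no; exists y.
Qed.

Lemma exists_max (T : Type) (P : T -> Prop) (F : T -> nat) B :
  (forall x, P x -> F x <= B) -> (exists x, P x) ->
  exists2 x, P x & forall y, P y -> F y <= F x.
Proof.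
move=> leB /(exists_min (fun x => B - F x)) [x Px minx]; exists x => // y Py.
by have := minx y Py; have := leB x Px; have := leB y Py; lia.
Qed.

Lemma finite_choice (T : Type) (t0 : T) n (R : nat -> T -> Prop) :
  (forall i, i < n -> exists t, R i t) -> exists f, forall i, i < n -> R i (f i).
Proof.
elim: n => [|n IHn] H; first by exists (fun=> t0).
have [f Hf] := IHn (fun i lti => H i (ltnW lti)); have [t Rt] := H n (ltnSn n).
exists (fun i => if i == n then t else f i) => i lti.
by case: eqP => [->//|ne]; apply: Hf; lia.
Qed.

Definition delete_edge (e : rel nat) y z : rel nat := fun u v =>
  e u v && ~~ ((u == y) && (v == z) || (u == z) && (v == y)).

Definition connected (e : rel nat) u v : Prop := exists k, walk e k u v.

Section Cert.
Variables (n m : nat) (eG eF : rel nat) (pin : nat -> nat -> Prop).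

Definition free_comp v : Prop := [/\ v < n, forall w, w < v -> ~ connected eG v w
  & forall u x, pin u x -> ~ connected eG v u].

Definition wide_comp v d : Prop := exists u w, [/\ connected eG v u, connected eG v w
  & d = 0 \/ ~ walk eG d.-1 u w].

(* The free components represented by vertices < i can cover [r j] edges of the
   j-th demand, for all j simultaneously. *)
Inductive supply : nat -> (nat -> nat) -> Prop :=
| supply0 r : (forall j, r j = 0) -> supply 0 r
| supply_skip i r : supply i r -> supply i.+1 r
| supply_use i r r' j : supply i r' -> free_comp i ->
    (forall j', j' <> j -> r' j' = r j') -> wide_comp i (r j - r' j) -> supply i.+1 r.

(** By [pin_dist] and [dem_long] the two vertices in [edge_cover] are joined in F, so an edge whose
    deletion separates them lies on the path between them. *)
Record cert (J : nat) (dem : nat -> nat -> nat -> Prop) (r : nat -> nat) : Prop := Cert {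
  pin_lt : forall u x, pin u x -> u < n /\ x < m;
  pin_dist : forall u x u' x' k, pin u x -> pin u' x' ->
    walk eG k u u' -> walk eF k x x';
  edge_cover : forall y z, eF y z ->
    (exists u x u' x', [/\ pin u x, pin u' x', connected eG u u'
       & ~ connected (delete_edge eF y z) x x']) \/
    (exists j a b, dem j a b /\ ~ connected (delete_edge eF y z) a b);
  isolated_cover : forall x, x < m -> (exists y, eF x y) \/ exists u, pin u x;
  dem_lt : forall j a b, dem j a b -> [/\ j < J, a < m & b < m];
  dem_fun : forall j a b a' b', dem j a b -> dem j a' b' -> a = a' /\ b = b';
  dem_long : forall j a b, dem j a b -> walk eF (r j) a b }.

End Cert.

Lemma connected_trans e u v w : connected e u v -> connected e v w -> connected e u w.
Proof. by move=> [k wk] [k' wk']; exists (k + k'); apply: walk_trans wk wk'. Qed.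

Lemma connected_sym e u v : symmetric e -> connected e u v -> connected e v u.
Proof. by move=> syme [k wk]; exists k; apply: walk_sym. Qed.

Lemma connected_edge (e : rel nat) u v : e u v -> connected e u v.
Proof. by move=> euv; exists 1; apply: walk1. Qed.

Lemma connected_refl e u : connected e u u.
Proof. by exists 0; apply: walk_refl. Qed.

Definition is_dist (e : rel nat) u v d : Prop :=
  walk e d u v /\ forall k, walk e k u v -> d <= k.

Lemma has_dist e u v : connected e u v -> exists d, is_dist e u v d.
Proof. by move=> /(exists_min id) [d wd mind]; exists d. Qed.

Lemma dist_step (e : rel nat) u v w d d' : symmetric e -> e v w ->
  is_dist e u v d -> is_dist e u w d' -> d <= d'.+1 /\ d' <= d.+1.
Proof.
move=> syme evw [wd mind] [wd' mind']; split; rewrite -addn1.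
  by apply: mind; apply: walk_trans wd' _; apply: walk1; rewrite syme.
by apply: mind'; apply: walk_trans wd _; apply: walk1.
Qed.

Lemma dist_level (e : rel nat) u v d k : is_dist e u v d -> k < d ->
  exists w w', [/\ e w w', is_dist e u w k & is_dist e u w' k.+1].
Proof.
elim: d v => // d IHd v [/walk_last wd mind] ltk.
case: wd => [/mind|[w wd ewv]]; first by rewrite ltnn.
have dw : is_dist e u w d.
  split=> // k' wk'.
  by rewrite -ltnS -[k'.+1]addn1; apply: mind; apply: walk_trans wk' (walk1 ewv).
case: (eqVneq k d) => [->|ne]; last by apply: (IHd w dw); lia.
by exists w, v; split=> //; split=> //; apply/walk_last; right; exists w.
Qed.

(** * From certificates to maps *)

Section Sound.
Variables (n m : nat) (eG eF : rel nat) (par dep : nat -> nat).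
Hypotheses (symG : symmetric eG) (bndG : forall u v, eG u v -> u < n /\ v < n).
Hypothesis (rF : rooted m eF par dep).

Lemma symF : symmetric eF.
Proof.
move=> x y; apply/idP/idP => /(edge_par rF) [ltx lty ne pp]; apply/(edge_par rF).
  by split=> //; [rewrite eq_sym | case: pp; auto].
by split=> //; [rewrite eq_sym | case: pp; auto].
Qed.

Lemma bndF x y : eF x y -> x < m /\ y < m.
Proof. by move=> /(edge_par rF) []. Qed.

Lemma dep_par1 x : x < m -> dep (par x) = (dep x).-1.
Proof.
by move=> ltx; have := dep_par rF ltx; case: eqP => [px d0|_ ->//]; rewrite px d0.
Qed.

Lemma iter_par_lt t x : x < m -> iter t par x < m.
Proof. by move=> ltx; elim: t => //= t; apply: (par_lt rF). Qed.

Lemma dep_iter t x : x < m -> dep (iter t par x) = dep x - t.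
Proof.
move=> ltx; elim: t => [|t IHt]; first by rewrite subn0.
by rewrite iterS dep_par1 ?IHt ?iter_par_lt //; lia.
Qed.

Lemma root_dep0 x : x < m -> dep x = 0 -> par x = x.
Proof. by move=> ltx; rewrite (dep_par rF ltx); case: eqP. Qed.

Lemma par_neq x : x < m -> 0 < dep x -> par x <> x.
Proof. by move=> ltx; rewrite (dep_par rF ltx); case: eqP. Qed.

Lemma iter_par_root t x : x < m -> dep x = 0 -> iter t par x = x.
Proof. by move=> ltx d0; elim: t => //= t ->; apply: root_dep0. Qed.

Lemma iter_par_same t t' x : x < m ->
  dep (iter t par x) = dep (iter t' par x) -> iter t par x = iter t' par x.
Proof.
move=> ltx; wlog le : t t' / t <= t'.
  by move=> H; case: (leqP t t') => [|/ltnW] le eqd; [|symmetry]; apply: H.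
rewrite -(subnK le) iterD; set z := iter t par x => eqd.
have ltz : z < m by apply: iter_par_lt.
have := eqd; rewrite dep_iter // => eqd'; case: (posnP (t' - t)) => [->//|pos].
by rewrite iter_par_root //; lia.
Qed.

(** Only a walk going straight up gains [k] levels in [k] steps; if [k] exceeds the depth of [x],
    both vertices are the root. *)
Lemma ancestor_at k x z : x < m -> walk eF k x z ->
  dep z <= dep (iter k par x) -> iter k par x = z.
Proof.
elim: k x => [|k IHk] x ltx; first by move=> /walk0.
move=> /walk_head [exz|[w exw [_ wk]]] le.
  subst z; move: le; rewrite dep_iter // => le; apply: iter_par_root => //; lia.
have [_ ltw _ [pw|pw]] := (edge_par rF x w).1 exw.
  by rewrite iterSr pw; apply: IHk => //; move: le; rewrite iterSr pw.
have ltz : iter k par w < m by apply: iter_par_lt.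
have eqk : iter k.+1 par x = par (par (iter k par w)).
  by rewrite -pw -iterSr -!iterS.
have := le; rewrite eqk !dep_par1 ?(par_lt rF) // => le'.
have ez := IHk w ltw wk ltac:(lia); rewrite ez; rewrite ez in le' ltz.
by rewrite root_dep0 ?(par_lt rF) ?root_dep0 //; lia.
Qed.

(** Were the two ancestors distinct, the path from [x] to [x'] would climb above both and take at
    least [t + t' + 2] steps. *)
Lemma ancestors_meet k t t' x x' : x < m -> walk eF k x x' -> k <= (t + t').+1 ->
  dep (iter t par x) = dep (iter t' par x') -> iter t par x = iter t' par x'.
Proof.
elim: k t x => [|k IHk] t x ltx.
  by move=> /walk0 <- _; apply: iter_par_same.
move=> /walk_head [<- _|[w exw [_ wk]] le eqd]; first exact: iter_par_same.
have [_ ltw nexw [pw|pw]] := (edge_par rF x w).1 exw; last first.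
  by move: eqd; rewrite -pw -iterSr => eqd; apply: IHk wk _ eqd => //; lia.
case: t le eqd => [|t] le eqd.
  have ltx' : x' < m.
    have [p [ep <- _]] := wk; case/lastP: p ep => [//|p z].
    by rewrite rcons_path last_rcons => /andP [_ /bndF []].
  have dx : dep x = (dep w).+1.
    by rewrite (dep_par rF ltx) pw eq_sym (negPf nexw).
  have wk' : walk eF t' x' w by apply: walk_leq (walk_sym symF wk); lia.
  have := ancestor_at ltx' wk'; rewrite -eqd /= dx => /(_ (leqnSn _)) ew.
  by move: eqd; rewrite ew /= dx; lia.
by move: eqd; rewrite iterSr pw => eqd; apply: IHk wk _ eqd => //; lia.
Qed.

Section FromCert.
Variables (pin : nat -> nat -> Prop) (J : nat) (dem : nat -> nat -> nat -> Prop).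
Variable r : nat -> nat.
Hypothesis ct : cert n m eG eF pin J dem r.
Hypothesis m0 : 0 < m.

Definition pinned u : Prop := exists u' x, pin u' x /\ connected eG u u'.

(* The gate of the root in the intersection of the balls of radius d(u, u') around
   the targets x of the pins (u', x): an explicit Helly-type extension. *)
Definition gate u y : Prop :=
  (exists u' x t, [/\ pin u' x, walk eG t u u' & y = iter t par x]) /\
  forall u' x t, pin u' x -> walk eG t u u' -> dep x <= dep y + t.

(** The ball of radius [t] about [x] has its top at depth [dep x - t]; the gate is the deepest of
    these tops. *)
Lemma gate_exists u : pinned u -> exists y, gate u y.
Proof.
move=> [u' [x [pu [t wt]]]].
have [||[[v z] k] /= [pv wk] maxv] := @exists_max ((nat * nat) * nat)
  (fun p => pin p.1.1 p.1.2 /\ walk eG p.2 u p.1.1) (fun p => dep p.1.2 - p.2)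
  (\max_(x < m) dep x).
- move=> [[v z] k] /= [/(pin_lt ct) [_ ltz] _].
  by apply: leq_trans (leq_subr _ _) _; apply: (leq_bigmax (Ordinal ltz)).
- by exists ((u', x), t).
exists (iter k par z); split; first by exists v, z, k.
move=> v' z' k' pv' wk'; have := maxv ((v', z'), k') (conj pv' wk').
by rewrite /= dep_iter; [lia | have [] := pin_lt ct pv].
Qed.

Lemma gate_lt u y : gate u y -> y < m.
Proof.
by move=> [[u' [x [t [/(pin_lt ct) [_ ltx] _ ->]]]] _]; apply: iter_par_lt.
Qed.

(** The ball of radius 0 about [x] forces the gate down to depth [dep x], while the pin defining the
    gate lies within [t] of [x]; so [x] is its [t]-th ancestor. *)
Lemma gate_pin u x y : pin u x -> gate u y -> y = x.
Proof.
move=> pu [[u' [x' [t [pu' wt yE]]]] maxy]; subst y.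
have le := maxy u x 0 pu (walk_refl eG 0 u); rewrite addn0 in le.
have [_ ltx'] := pin_lt ct pu'.
by apply: ancestor_at => //; apply: walk_sym symF _; apply: pin_dist ct _ _ _ _ _ pu pu' wt.
Qed.

(** Passing to a neighbour changes the radii by at most 1, so the depths of the gates differ by at
    most 1. The spare step in [ancestors_meet] pays for the edge [u v] when the depths agree. *)
Lemma gate_hom u v y z : eG u v -> gate u y -> gate v z -> y = z \/ eF y z.
Proof.
wlog le : u v y z / dep y <= dep z.
  move=> H euv gy gz; case: (leqP (dep y) (dep z)) => [|/ltnW] le; first exact: H euv gy gz.
  have evu : eG v u by rewrite symG.
  by have [->|] := H _ _ _ _ le evu gz gy; [left | rewrite symF; right].
move=> euv gy gz; have lty := gate_lt gy; have ltz := gate_lt gz.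
move: gy gz => [[u' [x [t [pu wt yE]]]] maxy] [[v' [x' [t' [pv wt' zE]]]] maxz].
have wvv : walk eG t'.+1 u v' by rewrite -add1n; apply: walk_trans (walk1 euv) wt'.
have lez := maxy _ _ _ pv wvv.
have [_ ltx] := pin_lt ct pu; have [_ ltx'] := pin_lt ct pv.
have dz : dep z = dep x' - t' by rewrite zE dep_iter.
have wx : walk eF (t + t'.+1) x x'.
  apply: pin_dist ct _ _ _ _ _ pu pv _; apply: walk_trans wvv.
  exact: walk_sym symG wt.
case: (eqVneq (dep y) (dep z)) => [eqd|neqd].
  by left; rewrite yE zE; apply: (ancestors_meet ltx wx); [lia | rewrite -yE -zE].
right; apply/(edge_par rF).
have pz : par z = y.
  rewrite yE zE -iterS; apply/esym; apply: (ancestors_meet ltx wx); first by lia.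
  by rewrite -yE iterS -zE dep_par1 //; lia.
by split=> //; [apply: contraNneq neqd => -> | right].
Qed.

(** A walk padded to an infinite sequence with pauses, so that any position on it may be used as an
    image. *)
Definition route (q : nat -> nat) L a b : Prop :=
  [/\ forall t, q t < m, forall t, q t = q t.+1 \/ eF (q t) (q t.+1), q 0 = a & q L = b].

Lemma walk_route L a b : a < m -> walk eF L a b -> exists q, route q L a b.
Proof.
elim: L b => [|L IHL] b lta.
  by move=> /walk0 <-; exists (fun=> a); split=> //; left.
move=> /walk_last wL; have [c [wc cb]] : exists c, walk eF L a c /\ (c = b \/ eF c b).
  by case: wL => [wk|[c wk ecb]]; [exists b | exists c]; auto.
have [q [q1 q2 q3 q4]] := IHL c lta wc.
have ltb : b < m.
  by case: cb => [<-|/bndF []] //; rewrite -q4.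
exists (fun t => if t <= L then q t else b); split=> [t|t||] //=.
- by case: ifP.
- case: (ltnP t L) => ltt; first by rewrite (ltnW ltt); apply: q2.
  by case: (leqP t L) => le; [rewrite (_ : t = L) ?q4; lia || exact: cb | left].
- by rewrite ltnn.
Qed.

(** The component of [i] is folded onto the stretch of route [j] from position [s' j] to [s j]: a
    vertex at distance [k] from one vertex of a far pair goes to position [s' j + minn d k].
    Neighbours differ by at most 1 in distance, hence go to equal or adjacent vertices. *)
Lemma supply_map (q : nat -> nat -> nat) i s :
  (forall j t, q j t < m) ->
  (forall j t, q j t = q j t.+1 \/ eF (q j t) (q j t.+1)) ->
  supply n eG pin i s -> exists g : nat -> nat, [/\ forall u, u < n -> g u < m,
    forall u v, eG u v -> g u = g v \/ eF (g u) (g v) &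
    forall j t, t < s j -> q j t = q j t.+1 \/ exists w u v, [/\ w < i /\ free_comp n eG pin w,
      connected eG w u, eG u v, g u = q j t & g v = q j t.+1]].
Proof.
move=> q1 q2; elim=> {i s} [s s0|i s _ [g [g1 g2 g3]]|i s s' j _ [g [g1 g2 g3]] fr eqs
    [u0 [u1 [cu0 cu1 wide]]]].
- by exists (fun=> 0); split=> // [u v _|j t]; [left | rewrite s0].
- exists g; split=> // j t /g3 [|[w [u [v [[ltw fw] ? ? ? ?]]]]]; [by left|right].
  by exists w, u, v; split=> //; split=> //; lia.
set d := s j - s' j in wide.
have [lti repi _] := fr.
have con u : connected eG i u -> connected eG u0 u.
  by move=> ciu; apply: connected_trans ciu; apply: connected_sym.
have [h hE] : exists h : nat -> nat, forall w, w < n ->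
    (connected eG i w -> exists2 k, is_dist eG u0 w k & h w = q j (s' j + minn d k)) /\
    (~ connected eG i w -> h w = g w).
  apply: (@finite_choice _ 0 n (fun w y =>
    (connected eG i w -> exists2 k, is_dist eG u0 w k & y = q j (s' j + minn d k)) /\
    (~ connected eG i w -> y = g w))) => w ltw.
  case: (classic (connected eG i w)) => cw.
    have [k dk] := has_dist (con _ cw).
    by exists (q j (s' j + minn d k)); split=> // _; exists k.
  by exists (g w).
exists h; split=> [u ltu|u v euv|j' t ltt].
- have [h1 h2] := hE u ltu; case: (classic (connected eG i u)) => cu.
    by have [k _ ->] := h1 cu.
  by rewrite h2 //; apply: g1.
- have [ltu ltv] := bndG euv; have [h1 h2] := hE u ltu; have [h3 h4] := hE v ltv.
  case: (classic (connected eG i u)) => cu.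
    have cv := connected_trans cu (connected_edge euv).
    have [k dk ->] := h1 cu; have [k' dk' ->] := h3 cv.
    have [le1 le2] := dist_step symG euv dk dk'.
    have : minn d k = minn d k' \/ minn d k' = (minn d k).+1
        \/ minn d k = (minn d k').+1 by lia.
    case=> [|[]] ->; first by left.
      by rewrite addnS; apply: q2.
    by rewrite addnS; have [->|] := q2 j (s' j + minn d k'); [left | rewrite symF; right].
  have cv : ~ connected eG i v.
    move=> cv; apply: cu; apply: connected_trans cv _; apply: connected_edge.
    by rewrite symG.
  by rewrite h2 // h4 //; apply: g2.
(* Earlier stretches keep their witnesses: a component with a smaller representative is not that of
   [i]. *)
have old : t < s' j' -> q j' t = q j' t.+1 \/ exists w u v,
    [/\ w < i.+1 /\ free_comp n eG pin w, connected eG w u, eG u v, h u = q j' t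
      & h v = q j' t.+1].
  move=> /g3 [|[w [u [v [[ltw fw] cwu euv gu gv]]]]]; [by left | right].
  have [ltu ltv] := bndG euv.
  have ncu x : connected eG w x -> ~ connected eG i x.
    move=> cwx cix; apply: (repi w ltw); apply: connected_trans cix _.
    exact: connected_sym.
  exists w, u, v; split=> //; first by split=> //; lia.
    by rewrite (hE u ltu).2 //; apply: ncu.
  rewrite (hE v ltv).2 //; apply: ncu.
  exact: connected_trans cwu (connected_edge euv).
case: (ltnP t (s' j')) => [/old //|let'].
case: (eqVneq j' j) => [ej|/eqP nj]; last by move: ltt; rewrite -eqs //; lia.
subst j'; right.
(* Unless [d] is 0, [u1] is at distance at least [d] from [u0], so some edge of the component leads
   from each level below [d] to the next. *)
have [D [D1 D2]] := has_dist (con _ cu1).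
have ltD : t - s' j < D.
  case: wide => [|nw]; first by rewrite /d; lia.
  rewrite ltnNge; apply/negP => leD; apply: nw; apply: walk_leq D1.
  by rewrite /d; lia.
have [w [w' [eww' dw dw']]] := dist_level (conj D1 D2) ltD.
have [ltw ltw'] := bndG eww'.
have cw : connected eG i w.
  by apply: connected_trans cu0 _; exists (t - s' j); case: dw.
have cw' := connected_trans cw (connected_edge eww').
have uniq_dist x k k' : is_dist eG u0 x k -> is_dist eG u0 x k' -> k = k'.
  by move=> [wk mk] [wk' mk']; apply/eqP; rewrite eqn_leq mk ?mk'.
exists i, w, w'; split=> //.
  have [k dk ->] := (hE w ltw).1 cw; rewrite (uniq_dist _ _ _ dk dw) /d.
  by congr (q j _); lia.
have [k dk ->] := (hE w' ltw').1 cw'; rewrite (uniq_dist _ _ _ dk dw') /d.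
by congr (q j _); lia.
Qed.

(** The image of the walk has to use the deleted edge, and symmetry of [eG] gives the witness in the
    order [y], [z]. *)
Lemma cut_crossed (f : nat -> nat) y z k u v : walk eG k u v ->
  (forall a b, eG a b -> f a = f b \/ eF (f a) (f b)) ->
  ~ connected (delete_edge eF y z) (f u) (f v) ->
  exists a b, [/\ connected eG u a, eG a b, f a = y & f b = z].
Proof.
move=> [p [ep <- _]] hom; elim: p u ep => [|x p IHp] u /=.
  by move=> _ []; apply: connected_refl.
move=> /andP [eux ep] nc.
case: (classic (connected (delete_edge eF y z) (f u) (f x))) => [cux|ncux].
  have [|a [b [ca eab fa fb]]] := IHp x ep.
    by move=> cx; apply: nc; apply: connected_trans cux cx.
  exists a, b; split=> //; exact: connected_trans (connected_edge eux) ca.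
case: (hom _ _ eux) => [eq|eF1]; first by case: ncux; rewrite eq; apply: connected_refl.
have : ~~ delete_edge eF y z (f u) (f x).
  by apply/negP => d; apply: ncux; apply: connected_edge.
rewrite /delete_edge eF1 /= negbK => /orP [] /andP [/eqP e1 /eqP e2].
  by exists u, x; split=> //; apply: connected_refl.
by exists x, u; split=> //; [apply: connected_edge | rewrite symG].
Qed.

Lemma route_crossed (q : nat -> nat) y z L a b : route q L a b ->
  ~ connected (delete_edge eF y z) a b -> exists2 t, t < L &
    (q t = y /\ q t.+1 = z) \/ (q t = z /\ q t.+1 = y).
Proof.
move=> [q1 q2 q3 <-] nc; apply: NNPP => no; apply: nc; rewrite -q3.
have : forall t, t <= L -> connected (delete_edge eF y z) (q 0) (q t).
  elim=> [|t IHt] ltt; first exact: connected_refl.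
  apply: connected_trans (IHt (ltnW ltt)) _; case: (q2 t) => [->|eqt].
    exact: connected_refl.
  apply: connected_edge; rewrite /delete_edge eqt /=; apply/negP => H.
  apply: no; exists t => //.
  by case/orP: H => /andP [/eqP -> /eqP ->]; [left | right].
by apply.
Qed.

(** Gates are used on pinned components and the folding on all others; an edge of G lies in one
    component, so the two pieces never meet. *)
Lemma cert_sound i : supply n eG pin i r -> exists f, good_map n m eG eF f.
Proof.
move=> si.
have [q qE] : exists q : nat -> nat -> nat, forall j, j < J ->
    [/\ forall t, q j t < m, forall t, q j t = q j t.+1 \/ eF (q j t) (q j t.+1)
     & forall a b, dem j a b -> route (q j) (r j) a b].
  apply: (@finite_choice _ (fun=> 0) J (fun j q =>
    [/\ forall t, q t < m, forall t, q t = q t.+1 \/ eF (q t) (q t.+1)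
     & forall a b, dem j a b -> route q (r j) a b])) => j ltj.
  case: (classic (exists a b, dem j a b)) => [[a [b dj]]|no]; last first.
    by exists (fun=> 0); split=> [||a b dj] //; [left | case: no; exists a, b].
  have [_ lta ltb] := dem_lt ct dj; have [q rq] := walk_route lta (dem_long ct dj).
  have [q1 q2 q3 q4] := rq; exists q; split=> // a' b' dj'.
  by have [<- <-] := dem_fun ct dj dj'.
pose q' j := if j < J then q j else fun=> 0.
have q1 j t : q' j t < m.
  by rewrite /q'; case: (ltnP j J) => [ltj|//]; have [H _ _] := qE j ltj; apply: H.
have q2 j t : q' j t = q' j t.+1 \/ eF (q' j t) (q' j t.+1).
  by rewrite /q'; case: (ltnP j J) => [ltj|_]; [have [_ H _] := qE j ltj; apply: H | left].
have [g [g1 g2 g3]] := supply_map q1 q2 si.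
have [f fE] : exists f : nat -> nat, forall u, u < n ->
    (pinned u -> gate u (f u)) /\ (~ pinned u -> f u = g u).
  apply: (@finite_choice _ 0 n (fun u y =>
    (pinned u -> gate u y) /\ (~ pinned u -> y = g u))) => u ltu.
  case: (classic (pinned u)) => pu.
    by have [y gy] := gate_exists pu; exists y.
  by exists (g u).
have hom u v : eG u v -> f u = f v \/ eF (f u) (f v).
  move=> euv; have [ltu ltv] := bndG euv; have [f1 f2] := fE u ltu; have [f3 f4] := fE v ltv.
  case: (classic (pinned u)) => pu.
    have pv : pinned v.
      move: pu => [u' [x [pu cu]]]; exists u', x; split=> //.
      by apply: connected_trans cu; apply: connected_edge; rewrite symG.
    exact: gate_hom euv (f1 pu) (f3 pv).
  have pv : ~ pinned v.
    move=> [u' [x [pv cv]]]; apply: pu; exists u', x; split=> //.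
    by apply: connected_trans cv; apply: connected_edge.
  by rewrite f2 // f4 //; apply: g2.
have fpin u x : pin u x -> f u = x.
  move=> pu; have [ltu _] := pin_lt ct pu; apply: gate_pin (pu) _.
  by apply: (fE u ltu).1; exists u, x; split=> //; apply: connected_refl.
have edge x y : eF x y -> exists u v, [/\ eG u v, f u = x & f v = y].
  move=> exy; case: (edge_cover ct exy) => [[u [a [v [b [pu pv [k wk] nc]]]]]|].
    rewrite -(fpin _ _ pu) -(fpin _ _ pv) in nc.
    by have [c [d [_ ecd fc fd]]] := cut_crossed wk hom nc; exists c, d.
  move=> [j [a [b [dj nc]]]]; have [ltj _ _] := dem_lt ct dj.
  have [_ _ /(_ _ _ dj) rq] := qE j ltj; have [t ltt tE] := route_crossed rq nc.
  have nexy : x <> y by have [_ _ /eqP] := (edge_par rF x y).1 exy.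
  have := g3 j t ltt; rewrite /q' ltj => -[eqt|[w [u [v [[_ fw] cwu euv gu gv]]]]].
    by case: nexy; case: tE => -[<- <-].
  have [ltu ltv] := bndG euv; have [_ _ fr] := fw.
  have npin c : connected eG w c -> ~ pinned c.
    move=> cwc [u' [z [pz cz]]]; apply: (fr u' z pz); exact: connected_trans cwc cz.
  have fu : f u = g u by apply: (fE u ltu).2; apply: npin.
  have fv : f v = g v.
    by apply: (fE v ltv).2; apply: npin; apply: connected_trans cwu (connected_edge euv).
  case: tE => -[tx ty]; [exists u, v | exists v, u].
    by rewrite fu fv gu gv.
  by rewrite symG fu fv gu gv.
exists f; split=> // [u ltu|x ltx].
  case: (classic (pinned u)) => pu; first exact: gate_lt ((fE u ltu).1 pu).
  by rewrite (fE u ltu).2 //; apply: g1.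
case: (isolated_cover ct ltx) => [[y /edge [u [v [euv <- _]]]]|[u pu]].
  by exists u => //; have [] := bndG euv.
by exists u; [have [] := pin_lt ct pu | apply: fpin].
Qed.

End FromCert.
End Sound.

(** * Small certificates *)

Lemma sub_in_count (T : eqType) (a b : pred T) s :
  {in s, forall x, a x -> b x} -> count a s <= count b s.
Proof.
move=> ab; rewrite -!sum1_count big_mkcond [X in _ <= X]big_mkcond /= !big_seq.
by apply: leq_sum => x xs; case: (boolP (a x)) => // /(ab x xs) ->.
Qed.

(** A union of small witnesses, for properties that survive enlarging; the products in the bounds on
    components and pins come from here. *)
Lemma gather (S T : eqType) (L : seq S) k (Q : T -> Prop) (P : S -> seq T -> Prop) :
  (forall s B B', {subset B <= B'} -> P s B -> P s B') ->
  (forall s, s \in L -> exists B, [/\ size B <= k, forall c, c \in B -> Q c & P s B]) ->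
  exists B, [/\ size B <= k * size L, forall c, c \in B -> Q c
    & forall s, s \in L -> P s B].
Proof.
move=> mono; elim: L => [|s L IHL] H; first by exists [::]; rewrite muln0.
have [B [szB QB PB]] := H s (mem_head _ _).
have [|B' [szB' QB' PB']] := IHL; first by move=> t tL; apply: H; rewrite inE tL orbT.
exists (B ++ B'); split=> [|c|t].
- by rewrite size_cat mulnS leq_add.
- by rewrite mem_cat => /orP [/QB|/QB'].
- rewrite inE => /predU1P [->|/PB'].
    by apply: mono PB => c cB; rewrite mem_cat cB.
  by apply: mono => c cB; rewrite mem_cat cB orbT.
Qed.

(** * From maps to small certificates *)

Section Complete.
Variables (n m : nat) (eG eF : rel nat) (par dep : nat -> nat).
Hypotheses (symG : symmetric eG) (bndG : forall u v, eG u v -> u < n /\ v < n).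
Hypothesis (rF : rooted m eF par dep).
Hypothesis m0 : 0 < m.

(** A root is its own parent but must not count as its own child. *)
Let is_child x y := (0 < dep y) && (par y == x).
Let children x := count (is_child x) (iota 0 m).

Definition leaf_number := count (fun x => count (eF x) (iota 0 m) <= 1) (iota 0 m).

Definition special := [seq s <- iota 0 m | children s != 1].

Let mem_m x : (x \in iota 0 m) = (x < m).
Proof. by rewrite mem_iota. Qed.

Lemma mem_special s : (s \in special) = (children s != 1) && (s < m).
Proof. by rewrite mem_filter mem_m. Qed.

Lemma count_pred1_iota a : count (pred1 a) (iota 0 m) <= 1.
Proof. by rewrite count_uniq_mem ?iota_uniq // leq_b1. Qed.

Lemma childless_leaf x : x < m -> children x = 0 -> count (eF x) (iota 0 m) <= 1.
Proof.
move=> ltx c0; apply: leq_trans (count_pred1_iota (par x)).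
apply: sub_in_count => y; rewrite mem_m => lty /(edge_par rF) [_ _ ne [->|py]] /=.
  exact: eqxx.
have : has (is_child x) (iota 0 m).
  apply/hasP; exists y; first by rewrite mem_m.
  rewrite /is_child py eqxx andbT (dep_par rF lty) py; by rewrite (negPf ne).
by rewrite has_count -/(children x) c0.
Qed.

Lemma childless_count : count (fun x => children x == 0) (iota 0 m) <= leaf_number.
Proof.
apply: sub_in_count => x; rewrite mem_m => ltx /eqP c0.
exact: childless_leaf.
Qed.

(** The numbers of children add up to at most [m], so at most as many vertices have several children
    as have none, and childless vertices are leaves. *)
Lemma size_special : size special <= 2 * leaf_number.
Proof.
have cE (a : pred nat) : \sum_(x <- iota 0 m) (a x : nat) = count a (iota 0 m).
  by rewrite -sum1_count [RHS]big_mkcond; apply: eq_bigr => x _; case: (a x).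
have sumc : \sum_(x <- iota 0 m) children x <= m.
  under eq_bigr => x _ do rewrite /children -cE.
  rewrite exchange_big /= -[X in _ <= X](size_iota 0 m) -sum1_size.
  apply: leq_sum => y _; apply: leq_trans (count_pred1_iota (par y)).
  by rewrite cE; apply: sub_in_count => x _ /andP [_ /eqP <-] /=.
have : \sum_(x <- iota 0 m) ((children x != 1) + 1)
    <= \sum_(x <- iota 0 m) (children x + ((children x == 0) + (children x == 0))).
  by apply: leq_sum => x _; case: (children x) => [|[|k]] //; lia.
rewrite !big_split /= sum1_size size_iota.
rewrite !cE /special size_filter.
have ar a b c k l : a + k <= c + (b + b) -> c <= k -> b <= l -> a <= 2 * l by lia.
by move=> H; apply: ar H sumc childless_count.
Qed.

Let D := \max_(x < m) dep x.

Lemma dep_max x : x < m -> dep x <= D.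
Proof. by move=> ltx; apply: (leq_bigmax (Ordinal ltx)). Qed.

Let the_child x := head x [seq y <- iota 0 m | is_child x y].

(** [k] is fuel: each step goes down one level, so [D.+1 - dep x] never runs out. *)
Fixpoint bot_rec k x :=
  if k is k'.+1 then if children x == 1 then bot_rec k' (the_child x) else x else x.

(* The lower end of the maximal path through x whose vertices above the lower end
   all have exactly one child. *)
Definition bot x := bot_rec (D.+1 - dep x) x.

Lemma the_childE x y : x < m -> y < m -> 0 < dep y -> par y = x -> children x = 1 ->
  the_child x = y.
Proof.
move=> ltx lty dy py; rewrite /children /the_child -size_filter.
have : y \in [seq z <- iota 0 m | is_child x z].
  by rewrite mem_filter mem_m lty /is_child dy py eqxx.
by case: [seq _ <- _ | _] => [|z [|z' s]] //=; rewrite inE => /eqP.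
Qed.

Lemma bot_special s : s \in special -> bot s = s.
Proof.
rewrite mem_special /bot => /andP [/negPf c1 _].
by case: (D.+1 - _) => //= k; rewrite c1.
Qed.

Lemma bot_par y : y < m -> 0 < dep y -> par y \notin special -> bot (par y) = bot y.
Proof.
move=> lty dy; have ltp := par_lt rF lty.
rewrite mem_special ltp andbT negbK => c1; rewrite /bot (dep_par1 rF lty).
have leD := dep_max lty.
have -> : D.+1 - (dep y).-1 = (D.+1 - dep y).+1 by lia.
by rewrite /= c1 (@the_childE _ y) //; apply/eqP.
Qed.

Lemma child_exists x : x < m -> 0 < children x ->
  exists y, [/\ y < m, 0 < dep y & par y = x].
Proof.
by move=> ltx; rewrite /children -has_count => /hasP [y]; rewrite mem_m => lty
  /andP [dy /eqP py]; exists y.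
Qed.

Lemma child_dep y : y < m -> 0 < dep y -> dep y = (dep (par y)).+1.
Proof. by move=> lty dy; rewrite (dep_par1 rF lty); lia. Qed.

Lemma bot_spec y : y < m -> [/\ bot y \in special, dep y <= dep (bot y),
  iter (dep (bot y) - dep y) par (bot y) = y &
  forall i, i <= dep (bot y) - dep y -> bot (iter i par (bot y)) = bot y].
Proof.
have [k] := ubnP (D - dep y); elim: k y => // k IHk y ltk lty.
case: (boolP (y \in special)) => sy.
  rewrite bot_special // subnn; split=> // i; rewrite leqn0 => /eqP ->.
  exact: bot_special.
have c1 : children y = 1 by move: sy; rewrite mem_special lty andbT negbK => /eqP.
have [|z [ltz dz pz]] := child_exists lty; first by rewrite c1.
have bz : bot y = bot z by rewrite -pz bot_par // pz.
have dzy := child_dep ltz dz; rewrite pz in dzy; have leD := dep_max ltz.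
have [|b1 b2 b3 b4] := IHk z _ ltz; first by lia.
have e3 : iter (dep (bot y) - dep y) par (bot y) = y.
  have -> : dep (bot y) - dep y = (dep (bot z) - dep z).+1 by rewrite bz; lia.
  by rewrite iterS bz b3.
split=> //; rewrite ?bz //; first by lia.
move=> i lei; case: (leqP i (dep (bot z) - dep z)) => [/b4 //|lti].
have -> : i = dep (bot z) - dep y by lia.
by rewrite -[in LHS]bz e3.
Qed.

Lemma bot_lt y : y < m -> bot y < m.
Proof. by move=> /bot_spec [+ _ _ _]; rewrite mem_special => /andP []. Qed.

(** [y] is an ancestor of [x] or [x] itself. *)
Definition under y x : Prop := dep y <= dep x /\ iter (dep x - dep y) par x = y.

Lemma under_refl y : under y y.
Proof. by split=> //; rewrite subnn. Qed.

Lemma under_bot y : y < m -> under y (bot y).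
Proof. by move=> /bot_spec []. Qed.

Lemma under_eq y x : under y x -> dep x <= dep y -> x = y.
Proof.
move=> [le e] le'; rewrite -[RHS]e (_ : dep x - dep y = 0) //; lia.
Qed.

Lemma under_up y x : x < m -> under y x -> x <> y -> under y (par x).
Proof.
move=> ltx yx ne; have lt : dep y < dep x.
  by rewrite ltnNge; apply/negP => /(under_eq yx).
move: yx => [_ e]; split; rewrite (dep_par1 rF) //; first by lia.
by rewrite -iterSr -[RHS]e; congr (iter _ par x); lia.
Qed.

Lemma under_down y x : x < m -> 0 < dep x -> under y (par x) -> under y x.
Proof.
move=> ltx dx [le e]; rewrite (dep_par1 rF) // in le e; split; first by lia.
by rewrite -[RHS]e -iterSr; congr (iter _ par x); lia.
Qed.

Lemma under_chain y x l : l < m -> under y l -> under x l -> dep y <= dep x -> under y x.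
Proof.
move=> ltl [ly ey] [lx ex] le; split=> //.
by rewrite -[in X in iter _ _ X]ex -iterD -[RHS]ey; congr (iter _ par l); lia.
Qed.

Lemma under_trans y x l : under y x -> under x l -> under y l.
Proof.
move=> [ly ey] [lx ex]; split; first by lia.
by rewrite (_ : dep l - dep y = (dep x - dep y) + (dep l - dep x)) ?iterD ?ex //; lia.
Qed.

Lemma under_par y x : y < m -> under y x -> under (par y) x.
Proof.
move=> lty [le e]; case: (posnP (dep y)) => [d0|dy].
  by rewrite (root_dep0 rF).
split; rewrite (dep_par1 rF) //; first by lia.
by rewrite -[in RHS]e -iterS; congr (iter _ par x); lia.
Qed.

Lemma same_bot_under y z : y < m -> z < m -> bot y = bot z -> dep y <= dep z -> under y z.
Proof.
move=> lty ltz eb; apply: (under_chain (bot_lt ltz)); last exact: under_bot.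
by rewrite -eb; apply: under_bot.
Qed.

Lemma same_bot_between y z a : y < m -> z < m -> a < m -> bot y = bot a ->
  under z a -> dep y <= dep z -> bot z = bot a.
Proof.
move=> lty ltz lta eb za leyz.
have [_ le1 _ b4] := bot_spec lty; have [lez ez] := under_trans za (under_bot lta).
by rewrite -[in LHS]ez -eb b4 //; rewrite eb; lia.
Qed.

(** Downwards, a path of single children can be left only through its lower end. *)
Lemma under_same_bot y x : y < m -> x < m -> under y x -> bot x = bot y \/ under (bot y) x.
Proof.
move=> lty; have [k] := ubnP (dep x - dep y); elim: k x => // k IHk x ltk ltx yx.
case: (classic (x = y)) => [->|ne]; first by left.
have ltp := par_lt rF ltx.
have lt : dep y < dep x by rewrite ltnNge; apply/negP => /(under_eq yx).
have dx : 0 < dep x by lia.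
have [|eb|ub] := IHk (par x) _ ltp (under_up ltx yx ne).
- by rewrite (dep_par1 rF) //; lia.
- case: (boolP (par x \in special)) => sp.
    right; apply: under_down => //; rewrite -eb bot_special //; exact: under_refl.
  by left; rewrite -bot_par.
- by right; apply: under_down.
Qed.

(** Lying below [y] is invariant along all edges of F but the one from [y] to its parent. *)
Lemma cut_under y p q x x' : y < m -> 0 < dep y ->
  (p = y /\ q = par y) \/ (p = par y /\ q = y) ->
  under y x -> ~ under y x' -> ~ connected (delete_edge eF p q) x x'.
Proof.
move=> lty dy pq yx nyx' [k [w [ew lw _]]]; apply: nyx'; rewrite -lw.
elim: w x ew yx {lw} => //= b w IHw a /andP [eab ew] ya; apply: IHw ew _.
move: eab => /andP [/(edge_par rF) [lta ltb ne [pa|pb]] nd].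
  rewrite -pa; apply: under_up => // ay; subst a; move: nd; rewrite -pa.
  by case: pq => -[-> ->]; rewrite !eqxx ?orbT.
apply: under_down => //; last by rewrite pb.
by rewrite (dep_par rF ltb) pb (negPf ne).
Qed.

Lemma dep_walk k x x' : x < m -> walk eF k x x' -> dep x <= dep x' + k.
Proof.
elim: k x => [|k IHk] x ltx; first by move=> /walk0 ->; rewrite addn0.
move=> /walk_head [->|[w /(edge_par rF) [_ ltw ne pp] [_ wk]]]; first by lia.
have := IHk w ltw wk; case: pp => [pw|pw].
  by rewrite (dep_par rF ltx) pw eq_sym (negPf ne); lia.
by rewrite (dep_par rF ltw) pw (negPf ne); lia.
Qed.

Lemma walk_up k a : a < m -> k <= dep a -> walk eF k a (iter k par a).
Proof.
elim: k => [|k IHk] lta lek; first exact: walk_refl.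
apply/walk_last; right; exists (iter k par a); first by apply: IHk => //; lia.
have ltk := iter_par_lt rF k lta; apply/(edge_par rF); split=> //.
- exact: par_lt rF _ ltk.
- by apply/eqP => e; apply: (par_neq rF ltk); [rewrite (dep_iter rF) //; lia | rewrite {2}e].
- by left.
Qed.

Lemma childless_below y : y < m -> exists l, [/\ l < m, children l = 0 & under y l].
Proof.
move=> lty; have [||l [ltl yl] maxl] := @exists_max nat (fun l => l < m /\ under y l) dep D.
- by move=> x [ltx _]; apply: dep_max.
- by exists y; split=> //; apply: under_refl.
exists l; split=> //; apply/eqP; rewrite -leqn0 leqNgt; apply/negP => /(child_exists ltl).
move=> [z [ltz dz pz]]; have := maxl z; rewrite (child_dep ltz dz) pz ltnn => H.
by suff: false by []; apply: H; split=> //; apply: under_down; rewrite ?pz.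
Qed.

(** * Pins and demands read off a valid map *)

Section ForMap.
Variable f : nat -> nat.
Hypothesis gf : good_map n m eG eF f.

Definition touch c x : Prop := exists u, [/\ u < n, connected eG c u & f u = x].

(** Edges of F are named by their lower ends. *)
Definition covers c y : Prop :=
  exists w w', [/\ connected eG c w, eG w w', f w = y & f w' = par y].

Definition inside c s : Prop := forall u, u < n -> connected eG c u -> bot (f u) = s.

Lemma covers_touch c y : covers c y -> touch c y /\ touch c (par y).
Proof.
move=> [w [w' [cw eww <- <-]]]; have [ltw ltw'] := bndG eww.
split; [exists w | exists w'] => //; split=> //.
exact: connected_trans cw (connected_edge eww).
Qed.

Lemma touch_lt c x : touch c x -> x < m.
Proof. by move=> [u [ltu _ <-]]; apply: map_lt gf _ ltu. Qed.

Lemma covers_between c y x x' : y < m -> 0 < dep y -> touch c x -> touch c x' ->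
  under y x -> ~ under y x' -> covers c y.
Proof.
move=> lty dy [u [ltu cu fu]] [v [ltv cv fv]] yx nyx'; subst x x'.
have nc := cut_under lty dy (or_introl (conj erefl erefl)) yx nyx'.
have [k wk] := connected_trans (connected_sym symG cu) cv.
have [a [b [ca eab fa fb]]] := cut_crossed symG wk (map_hom gf) nc.
by exists a, b; split=> //; apply: connected_trans cu ca.
Qed.

(** Under this condition [y] does not lie between two edges of the path that [B] leaves
    uncovered. *)
Definition covered_side (B : seq nat) s y : Prop :=
  (forall y2, y2 < m -> 0 < dep y2 -> bot y2 = s -> dep y <= dep y2 ->
     exists2 c, c \in B & covers c y2) \/
  (forall y2, y2 < m -> 0 < dep y2 -> bot y2 = s -> dep y2 <= dep y ->
     exists2 c, c \in B & covers c y2).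

Definition dominates (B : seq nat) s : Prop :=
  (exists2 c, c \in B & touch c s) /\
  (forall c y, c < n -> y < m -> 0 < dep y -> bot y = s -> covers c y ->
     touch c s \/ ~ inside c s -> covered_side B s y).

(** The components serving a demand lie inside a path and miss its lower end; anchored ones are
    thereby kept apart from them. *)
Definition anchored c : Prop := c < n /\
  forall s, s \in special -> touch c s \/ ~ inside c s.

(* Among the components reaching s, the one climbing highest, and among those
   entering the path above s from outside, the one descending deepest. *)
Lemma dominating_pair s : s \in special -> exists B : seq nat,
  [/\ size B <= 2, forall c, c \in B -> anchored c & dominates B s].
Proof.
move=> ss; have lts : s < m by move: ss; rewrite mem_special => /andP [].
have [u0 ltu0 fu0] := map_onto gf lts.
have [|[c1 z1] /= [ltc1 ts1 tz1 z1s] min1] := @exists_min (nat * nat) (fun p =>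
    [/\ p.1 < n, touch p.1 s, touch p.1 p.2 & under p.2 s]) (fun p => dep p.2).
  exists (u0, s); split=> //=; last exact: under_refl;
    by exists u0; split=> //; apply: connected_refl.
have anc1 : anchored c1.
  split=> // s' ss'; case: (eqVneq s' s) => [->|/eqP ne]; [by left | right=> ins].
  have [u [ltu cu fu]] := ts1; apply: ne; rewrite -(ins u ltu cu) fu.
  exact: bot_special.
(* A component reaching [s] climbs no higher than [c1], so [c1] covers all edges from [y] down to
   [s]. *)
have low B c y : c1 \in B -> c < n -> y < m -> 0 < dep y -> bot y = s -> covers c y ->
    touch c s -> covered_side B s y.
  move=> Bc1 ltc lty dy by_ cy ts; left=> y2 lty2 dy2 by2 le; exists c1 => //.
  have ys : under y s by rewrite -by_; apply: under_bot.
  have := min1 (c, par y) (And4 ltc ts (covers_touch cy).2 (under_par lty ys)).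
  rewrite /= (dep_par1 rF) // => lez.
  apply: (covers_between lty2 dy2 ts1 tz1); first by rewrite -by2; apply: under_bot.
  by move=> [le2 _]; lia.
(* If all vertices outside the path were below [s] and [s] were missed, the component could not get
   from [y] to them. *)
have reach c y : c < n -> y < m -> 0 < dep y -> bot y = s -> covers c y ->
    ~ inside c s -> touch c s \/ exists x, [/\ touch c x, bot x <> s & ~ under s x].
  move=> ltc lty dy by_ cy nins.
  have [x [tx bx]] : exists x, touch c x /\ bot x <> s.
    apply: NNPP => no; apply: nins => u ltu cu; apply: NNPP => bu; apply: no.
    by exists (f u); split=> //; exists u.
  case: (classic (under s x)) => sx; last by right; exists x.
  have [les _] : under y s by rewrite -by_; apply: under_bot.
  left; have ds : 0 < dep s by lia.
  have cs : covers c s.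
    apply: (covers_between lts ds tx (covers_touch cy).2 sx).
    by rewrite /under (dep_par1 rF) // => -[]; lia.
  exact: (covers_touch cs).1.
case: (classic (exists p : nat * nat, [/\ p.1 < n, p.2 < m, 0 < dep p.2
    & [/\ bot p.2 = s, covers p.1 p.2 & exists x,
         [/\ touch p.1 x, bot x <> s & ~ under s x]]])) => [ex|no]; last first.
  exists [:: c1]; split=> // [c|]; first by rewrite inE => /eqP ->.
  split; first by exists c1; rewrite ?mem_head.
  move=> c y ltc lty dy by_ cy []; first by apply: low; rewrite ?mem_head.
  move=> /(reach c y ltc lty dy by_ cy) [|ex]; first by apply: low; rewrite ?mem_head.
  by case: no; exists (c, y).
have [p [p1 p2 p3 p4]|[c2 y2] /= [ltc2 lty2 dy2 [by2 cy2 [x [tx bx nsx]]]] max2] :=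
    @exists_max _ _ (fun p => dep p.2) D _ ex; first exact: dep_max.
exists [:: c1; c2]; split=> // [c|].
  rewrite !inE => /orP [] /eqP -> //; split=> // s' ss'; right=> ins.
  have [[u [ltu cu fu]] _] := covers_touch cy2; have [v [ltv cv fv]] := tx.
  by apply: bx; rewrite -fv (ins v ltv cv) -by2 -fu (ins u ltu cu).
split; first by exists c1; rewrite ?mem_head.
move=> c y ltc lty dy by_ cy []; first by apply: low; rewrite ?mem_head.
move=> /(reach c y ltc lty dy by_ cy) [|ex']; first by apply: low; rewrite ?mem_head.
right=> y3 lty3 dy3 by3 le; exists c2; first by rewrite !inE eqxx orbT.
have := max2 (c, y) (And4 ltc lty dy (And3 by_ cy ex')); rewrite /= => le2.
apply: (covers_between lty3 dy3 (covers_touch cy2).1 tx).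
  by apply: same_bot_under => //; [rewrite by3 by2 | lia].
move=> u3; have := under_same_bot lty3 (touch_lt tx) u3.
by rewrite by3 => -[].
Qed.

Lemma dominating_set : exists B : seq nat, [/\ size B <= 2 * size special,
  forall c, c \in B -> anchored c & forall s, s \in special -> dominates B s].
Proof.
apply: gather; last exact: dominating_pair.
move=> s B B' sub [[c cB tc] H]; split; first by exists c => //; apply: sub.
move=> c' y *; have [H1|H1] := H c' y ltac:(done) ltac:(done) ltac:(done)
    ltac:(done) ltac:(done) ltac:(done); [left|right];
  by move=> y2 *; have [||||d dB dc] := H1 y2; rewrite //; exists d => //; apply: sub.
Qed.

(** The pins mark a highest image vertex and, towards each childless vertex, a deepest one. Every
    edge covered by the component separates the former from one of the latter. *)
Definition pins_component c (L : seq (nat * nat)) : Prop :=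
  (exists2 p, p \in L & connected eG c p.1 /\ forall z, touch c z -> dep p.2 <= dep z) /\
  (forall l z, l < m -> children l = 0 -> touch c z -> under z l ->
    exists2 p, p \in L & [/\ connected eG c p.1, under p.2 l & dep z <= dep p.2]).

Lemma component_pins c : c < n -> exists L : seq (nat * nat),
  [/\ size L <= leaf_number.+1,
     forall p, p \in L -> [/\ p.1 < n, p.2 = f p.1 & connected eG c p.1]
   & pins_component c L].
Proof.
move=> ltc.
have [|u0 [ltu0 cu0] min0] := @exists_min nat (fun u => u < n /\ connected eG c u)
    (fun u => dep (f u)); first by exists c; split=> //; apply: connected_refl.
pose W := [seq l <- iota 0 m | children l == 0].
have [||L [szL QL PL]] := @gather nat (nat * nat)%type W 1
  (fun p => [/\ p.1 < n, p.2 = f p.1 & connected eG c p.1])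
  (fun l L => forall z, touch c z -> under z l ->
    exists2 p, p \in L & [/\ connected eG c p.1, under p.2 l & dep z <= dep p.2]).
- by move=> l B B' sub H z tz zl; have [p pB] := H z tz zl; exists p => //; apply: sub.
- move=> l; rewrite mem_filter mem_m => /andP [_ ltl].
  case: (classic (exists u, [/\ u < n, connected eG c u & under (f u) l])) => [ex|no].
    have [u [ltu _ _]|u [ltu cu ul] maxu] := @exists_max _ _ (fun u => dep (f u)) D _ ex.
      exact: dep_max (map_lt gf ltu).
    exists [:: (u, f u)]; split=> // [p|z [v [ltv cv <-]] vl].
      by rewrite inE => /eqP ->.
    by exists (u, f u); rewrite ?mem_head //; split=> //=; apply: maxu.
  exists [::]; split=> // z [v [ltv cv fv]] zl; case: no; exists v.
  by rewrite fv.
exists ((u0, f u0) :: L); split.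
- rewrite /= ltnS (leq_trans szL) // mul1n size_filter.
  exact: childless_count.
- by move=> p; rewrite inE => /predU1P [->|/QL].
split.
  exists (u0, f u0); rewrite ?mem_head //; split=> //= z [v [ltv cv <-]].
  exact: min0.
move=> l z ltl cl tz zl; have [|p pL Hp] := PL l _ z tz zl.
  by rewrite mem_filter mem_m ltl cl.
by exists p => //; rewrite inE pL orbT.
Qed.

Lemma pins_exist (B : seq nat) : (forall c, c \in B -> c < n) ->
  exists L : seq (nat * nat), [/\ size L <= leaf_number.+1 * size B,
    forall p, p \in L -> [/\ p.1 < n, p.2 = f p.1 & exists2 c, c \in B & connected eG c p.1]
   & forall c, c \in B -> pins_component c L].
Proof.
move=> ltB; apply: gather.
  move=> c L L' sub [[p pL Hp] H]; split; first by exists p => //; apply: sub.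
  by move=> l z ? ? ? ?; have [||||q qL Hq] := H l z => //; exists q => //; apply: sub.
move=> c cB; have [L [szL QL PL]] := component_pins (ltB c cB).
by exists L; split=> // p /QL [? ? ?]; split=> //; exists c.
Qed.

(** The edges, by lower ends, of the path of [s] from [ab.1] up to [ab.2]; the upper end names the
    edge above it, hence the strict bound there. *)
Definition interval s (ab : nat * nat) y :=
  [&& y < m, 0 < dep y, bot y == s & dep ab.2 < dep y <= dep ab.1].

Lemma intervalP s ab y : reflect
  [/\ y < m, 0 < dep y, bot y = s & dep ab.2 < dep y <= dep ab.1] (interval s ab y).
Proof.
apply: (iffP and4P) => -[h1 h2 h3 h4]; split=> //; first exact/eqP.
by rewrite h3.
Qed.

Record demand (B : seq nat) s (ab : nat * nat) : Prop := Demand {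
  demand_lt : ab.1 < m /\ ab.2 < m;
  demand_uncovered : forall y, y < m -> 0 < dep y -> bot y = s ->
    (forall c, c \in B -> ~ covers c y) -> interval s ab y;
  demand_free : forall y, interval s ab y -> forall c, c < n -> covers c y ->
    c \notin B /\ inside c s;
  demand_cut : forall y, interval s ab y -> under y ab.1;
  demand_walk : walk eF (count (interval s ab) (iota 0 m)) ab.1 ab.2 }.

(** The demand runs from the deepest uncovered vertex to the parent of the highest one. If a
    component leaving the path or touching [s] covered an edge in between, domination would have one
    of these two covered. *)
Lemma demand_exists B s : s \in special -> (forall c, c \in B -> anchored c) ->
  dominates B s -> exists ab, demand B s ab.
Proof.
move=> ss anc [_ dom]; have lts : s < m by move: ss; rewrite mem_special => /andP [].
pose unc y := [/\ y < m, 0 < dep y, bot y = s & forall c, c \in B -> ~ covers c y].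
case: (classic (exists y, unc y)) => [ex|no]; last first.
  (* With no uncovered edge, the empty interval at [s] serves. *)
  have none y : ~~ interval s (s, s) y by apply/negP => /intervalP [_ _ _ /=]; lia.
  exists (s, s); split=> //=.
  - by move=> y *; case: no; exists y.
  - by move=> y; rewrite (negPf (none y)).
  - by move=> y; rewrite (negPf (none y)).
  - exact: walk_refl.
have [y [lty _ _ _]|a [lta da ba ua] maxa] := exists_max (F := dep) (B := D) _ ex.
  exact: dep_max.
have [h [lth dh bh uh] minh] := exists_min dep ex.
have dph : dep (par h) = (dep h).-1 by rewrite (dep_par1 rF).
have leha : dep h <= dep a by apply: maxa; split.
have ha : under h a by apply: same_bot_under => //; rewrite bh ba.
have free y c : interval s (a, par h) y -> c < n -> covers c y ->
    ~ (touch c s \/ ~ inside c s).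
  move=> /intervalP [lty dy by_ /= ley] ltc cy out; rewrite dph in ley.
  case: (dom c y ltc lty dy by_ cy out) => H.
    by have [||||c' c'B] := H a => //; [lia | apply: ua].
  by have [||||c' c'B] := H h => //; [lia | apply: uh].
have lep := par_lt rF lth.
exists (a, par h); split=> //=.
- move=> y lty dy by_ uy; apply/intervalP; rewrite /= dph; split=> //.
  have uy' : unc y by split.
  by have := maxa y uy'; have := minh y uy'; lia.
- move=> y Iy c ltc cy; have nout := free y c Iy ltc cy; split.
    by apply/negP => /anc [_ /(_ s ss)].
  by apply: NNPP => nins; apply: nout; right.
- move=> y /intervalP [lty dy by_ /= /andP [_ le]].
  by apply: same_bot_under => //; rewrite by_ ba.
have [_ eh] := ha.
have lek : (dep a - dep h).+1 <= dep a by lia.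
have wk := walk_up lta lek; rewrite iterS eh in wk; apply: walk_leq wk.
rewrite -size_filter -(size_iota 0 (dep a - dep h).+1).
rewrite -(size_map (fun i => iter i par a)); apply: uniq_leq_size.
  rewrite map_inj_in_uniq ?iota_uniq // => i j; rewrite !mem_iota !add0n /= => lti ltj e.
  by have := congr1 dep e; rewrite !(dep_iter rF) //; lia.
move=> y /mapP [i]; rewrite mem_iota add0n => /andP [_ lti] ->.
have ltz := iter_par_lt rF i lta; have dz := dep_iter rF i lta.
rewrite mem_filter mem_m ltz andbT; apply/intervalP; rewrite /= dph dz.
split=> //; [by lia | | by lia].
rewrite -ba; apply: (same_bot_between lth ltz lta); [by rewrite bh ba | | by lia].
by split; rewrite dz; [lia | congr (iter _ par a); lia].
Qed.

(** The edges of one path have distinct depths. *)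
Lemma count_interval_dep s ab (P : pred nat) lo hi :
  (forall y, interval s ab y -> P y -> lo <= dep y <= hi) ->
  count (fun y => interval s ab y && P y) (iota 0 m) <= hi.+1 - lo.
Proof.
move=> H; rewrite -size_filter -(size_map dep) -[X in _ <= X](size_iota lo).
have inP y : y \in [seq y <- iota 0 m | interval s ab y && P y] -> interval s ab y && P y.
  by rewrite mem_filter => /andP [].
apply: uniq_leq_size.
  rewrite map_inj_in_uniq ?filter_uniq ?iota_uniq // => y z.
  move=> /inP /andP [/intervalP [lty _ by_ _] _] /inP /andP [/intervalP [ltz _ bz _] _] e.
  apply: esym; apply: under_eq; last by rewrite e.
  by apply: same_bot_under => //; rewrite ?by_ ?bz ?e.
move=> d /mapP [y /inP /andP [Iy Py] ->]; rewrite mem_iota.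
by have := H y Iy Py; lia.
Qed.

(** The sizes reflect two pinned components and one demand for each of the at most [2 * leaf_number]
    special vertices, and [leaf_number.+1] pins per component. The vectors [s i] trace a run of the
    dynamic program. *)
Lemma small_certificate : exists (L E : seq (nat * nat)) (s : nat -> nat -> nat),
  let pin u x := (u, x) \in L in
  let dem j a b := j < size E /\ nth (0, 0) E j = (a, b) in
  [/\ size L <= leaf_number.+1 * (4 * leaf_number), size E <= 2 * leaf_number,
    cert n m eG eF pin (size E) dem (s n),
    (forall j, s 0 j = 0) /\
    (forall i j, s i j <= m /\ (size E <= j -> s i j = 0)) &
    forall i, i < n -> (forall j, s i.+1 j = s i j) \/ exists j,
      [/\ j < size E, free_comp n eG pin i, forall j', j' <> j -> s i j' = s i.+1 j'
        & wide_comp eG i (s i.+1 j - s i j)]].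
Proof.
have [B [szB ancB domB]] := dominating_set.
have [L [szL QL PL]] := @pins_exist B (fun c cB => (ancB c cB).1).
pose k := size special.
have spk j : j < k -> nth 0 special j \in special by apply: mem_nth.
have [E0 E0P] : exists E0 : nat -> nat * nat,
    forall j, j < k -> demand B (nth 0 special j) (E0 j).
  apply: (@finite_choice _ (0, 0) k (fun j ab => demand B (nth 0 special j) ab)) => j ltj.
  by apply: demand_exists => //; [apply: spk | apply: domB; apply: spk].
pose E := mkseq E0 k; have szE : size E = k by rewrite size_mkseq.
pose pin u x := (u, x) \in L.
pose loose c := forall u x, pin u x -> ~ connected eG c u.
(* [K y] credits the edge of [y] to the least vertex whose component is unpinned and covers it, and
   is [n] if there is none. By minimality a credited vertex represents its component. *)
have [K KP] : exists K : nat -> nat, forall y, y < m ->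
    (forall c, c < n -> loose c -> covers c y -> K y <= c) /\
    (K y < n -> loose (K y) /\ covers (K y) y).
  apply: (@finite_choice _ 0 m (fun y i =>
    (forall c, c < n -> loose c -> covers c y -> i <= c) /\
    (i < n -> loose i /\ covers i y))) => y lty.
  case: (classic (exists c, [/\ c < n, loose c & covers c y])) => [ex|no]; last first.
    by exists n; split=> [c *|]; [case: no; exists c | rewrite ltnn].
  have [c [ltc lc cc] minc] := exists_min id ex.
  by exists c; split=> // d *; apply: minc.
pose I j := interval (nth 0 special j) (E0 j).
(* Counts the edges of demand [j] credited to vertices below [i]. *)
pose s i j := if j < k then count (fun y => I j y && (K y < i)) (iota 0 m) else 0.
have looseB c : c < n -> ~ loose c -> exists2 b, b \in B & connected eG b c.
  move=> ltc nl; apply: NNPP => no; apply: nl => u x /QL [_ _ [b bB cb]] cu.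
  by apply: no; exists b => //; apply: connected_trans cb (connected_sym symG cu).
have covers_conn c c' y : connected eG c c' -> covers c' y -> covers c y.
  by move=> cc [w [w' [cw *]]]; exists w, w'; split=> //; apply: connected_trans cc cw.
have covered y : y < m -> 0 < dep y -> exists2 c, c < n & covers c y.
  move=> lty dy; have eyp : eF y (par y).
    apply/(edge_par rF); split=> //; [exact: par_lt rF _ lty | | by left].
    by apply/eqP => e; apply: (par_neq rF lty dy).
  have [u [v [euv fu fv]]] := map_edge gf eyp; have [ltu _] := bndG euv.
  by exists u => //; exists u, v; split=> //; apply: connected_refl.
(* Every edge of a demand is credited: if a pinned component covered it, so would some [b] in [B],
   against [demand_free]. *)
have sN j : j < k -> s n j = count (I j) (iota 0 m).
  move=> ltj; rewrite /s ltj; apply: eq_in_count => y; rewrite mem_m => lty.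
  case: (boolP (I j y)) => //= Iy.
  have /intervalP [_ dy by_ _] := Iy; have [c ltc cy] := covered y lty dy.
  have := E0P j ltj => -[_ _ fr _ _]; have [ncB ins] := fr y Iy c ltc cy.
  case: (classic (loose c)) => [lc|/(looseB _ ltc) [b bB cb]].
    by rewrite (leq_ltn_trans _ ltc) //; apply: (KP y lty).1.
  have [ltb _] := ancB b bB.
  by have [] := fr y Iy b ltb (covers_conn _ _ _ cb cy); rewrite bB.
exists L, E, s => /=; rewrite szE; split.
- apply: leq_trans szL _; rewrite leq_mul2l; apply/orP; right.
  by apply: leq_trans szB _; have := size_special; lia.
- exact: size_special.
- split.
  + by move=> u x /QL /= [ltu -> _]; split=> //; apply: map_lt gf _ ltu.
  + move=> u x u' x' l /QL /= [_ -> _] /QL /= [_ -> _]; apply: walk_image.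
    exact: map_hom gf.
  + suff main y p q : y < m -> 0 < dep y -> (p = y /\ q = par y) \/ (p = par y /\ q = y) ->
      (exists u x u' x', [/\ (u, x) \in L, (u', x') \in L, connected eG u u'
         & ~ connected (delete_edge eF p q) x x']) \/
      (exists j a b, (j < k /\ nth (0, 0) E j = (a, b)) /\
         ~ connected (delete_edge eF p q) a b).
      move=> y z /(edge_par rF) [lty ltz ne [pyz|pzy]].
        apply: (main y) => //; last by left.
        by rewrite (dep_par rF lty) pyz eq_sym (negPf ne).
      apply: (main z) => //; last by right.
      by rewrite (dep_par rF ltz) pzy (negPf ne).
    move=> lty dy pq; case: (classic (exists2 c, c \in B & covers c y)) => [[c cB cy]|no].
      left; have [[[u' x'] /= pL' [cu' minx']] H] := PL c cB.
      have [ty tpy] := covers_touch cy; have [l [ltl cl yl]] := childless_below lty.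
      have [[u x] /= pL [cu xl lex]] := H l y ltl cl ty yl.
      exists u, x, u', x'; split=> //.
        by apply: connected_trans (connected_sym symG cu) cu'.
      apply: (cut_under lty dy pq); first exact: under_chain ltl yl xl lex.
      by move=> [le _]; have := minx' _ tpy; rewrite (dep_par1 rF) //; lia.
    right; have [bs _ _ _] := bot_spec lty.
    pose j := index (bot y) special; have ltj : j < k by rewrite index_mem.
    have [[lt1 lt2] unc _ cut _] := E0P j ltj.
    have Iy : interval (nth 0 special j) (E0 j) y.
      by apply: unc => //; [rewrite nth_index | move=> c cB cy; apply: no; exists c].
    exists j, (E0 j).1, (E0 j).2; split.
      by rewrite nth_mkseq //; split=> //; case: (E0 j).
    apply: (cut_under lty dy pq); first exact: cut.
    by move: Iy => /intervalP [_ _ _ ley] [le _]; lia.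
  + move=> x ltx; case: (classic (exists y, eF x y)) => [|no]; [by left | right].
    have cx : children x = 0.
      apply/eqP; rewrite -leqn0 leqNgt; apply/negP => /(child_exists ltx) [y [lty dy py]].
      apply: no; exists y; apply/(edge_par rF); split=> //; last by right.
      by apply/eqP => e; apply: (par_neq rF lty dy); rewrite py.
    have sx : x \in special by rewrite mem_special cx ltx.
    have [[c cB tc] _] := domB x sx.
    have [[u x'] /= pL [cu ux le]] := (PL c cB).2 x x ltx cx tc (under_refl x).
    by exists u; rewrite (under_eq ux le).
  + move=> j a b [ltj]; rewrite nth_mkseq // => e.
    by have [[] + + _ _ _ _] := E0P j ltj; rewrite e.
  + by move=> j a b a' b' [_ ->] [_ [-> ->]].
  + move=> j a b [ltj]; rewrite nth_mkseq // => e.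
    by have [_ _ _ _] := E0P j ltj; rewrite sN // /I e.
- split=> [j|i j]; rewrite /s.
    case: ltnP => // _; apply/eqP; rewrite -leqn0 leqNgt -has_count.
    by apply/hasPn => y _; rewrite andbF.
  by case: ltnP => // _; split=> //; rewrite -{2}(size_iota 0 m) count_size.
move=> i lti.
case: (classic (exists j y, [/\ j < k, I j y & K y = i]))
  => [[j [y0 [ltj Iy0 Ky0]]]|no]; last first.
  left=> j; rewrite /s; case: ltnP => // ltj; apply: eq_in_count => y _.
  case: (boolP (I j y)) => //= Iy; rewrite ltnS leq_eqVlt; case: eqP => // Ki.
  by case: no; exists j, y.
have /intervalP [lty0 dy0 by0 _] := Iy0.
have [loosei covi] : loose i /\ covers i y0 by rewrite -Ky0; apply: (KP y0 lty0).2; rewrite Ky0.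
have [_ _ fr _ _] := E0P j ltj; have [_ ins] := fr y0 Iy0 i lti covi.
have covK y : y < m -> K y = i -> covers i y.
  by move=> lty Ky; have [|_] := (KP y lty).2; rewrite Ky.
have splitK j' : count (fun y => I j' y && (K y < i.+1)) (iota 0 m)
    = count (fun y => I j' y && (K y < i)) (iota 0 m)
      + count (fun y => I j' y && (K y == i)) (iota 0 m).
  rewrite -count_predUI [X in _ = _ + X](eq_count (a2 := pred0)) ?count_pred0 ?addn0.
    apply: eq_count => y /=; rewrite ltnS leq_eqVlt orbC.
    by case: (I j' y).
  by move=> y /=; case: (I j' y) => //=; case: eqP => [->|]; rewrite ?ltnn ?andbF.
right; exists j; split=> //.
- split=> // w ltw ciw.
  have lew : K y0 <= w.
    apply: (KP y0 lty0).1; first by lia.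
      by move=> u x pu cwu; apply: (loosei u x pu); apply: connected_trans ciw cwu.
    exact: covers_conn (connected_sym symG ciw) covi.
  by lia.
(* The component stays inside one path, so no edge of another demand is credited to it. *)
- move=> j' ne; rewrite /s; case: ltnP => // ltj'; rewrite splitK.
  rewrite [X in _ = _ + X](_ : _ = 0) ?addn0 //; apply/eqP; rewrite -leqn0 leqNgt -has_count.
  apply/negP => /hasP [y]; rewrite mem_m => lty /andP [Iy /eqP Ky].
  have /intervalP [_ _ by_ _] := Iy.
  have [[u [ltu cu fu]] _] := covers_touch (covK y lty Ky).
  apply: ne; apply/eqP; rewrite -(nth_uniq 0 ltj' ltj) ?filter_uniq ?iota_uniq //.
  by rewrite -by_ -fu (ins u ltu cu).
(* The edges credited to [i] have distinct depths between those of [h] and [a], so a vertex mapped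
   to [a] and one mapped to [par h] are at least that far apart in G. *)
rewrite /s ltj splitK addKn.
pose Y y := [/\ y < m, I j y & K y = i].
have exY : exists y, Y y by exists y0.
have [y [lty _ _]|a [lta Ia Ka] maxa] := exists_max (F := dep) (B := D) _ exY.
  exact: dep_max.
have [h [lth Ih Kh] minh] := exists_min dep exY.
have [[u [ltu cu fu]] _] := covers_touch (covK a lta Ka).
have [_ [v [ltv cv fv]]] := covers_touch (covK h lth Kh).
exists u, v; split=> //; right=> wk.
have ltfu : f u < m by rewrite fu.
have := dep_walk ltfu (walk_image (map_hom gf) wk); rewrite fu fv (dep_par1 rF) //.
have := @count_interval_dep (nth 0 special j) (E0 j) (fun y => K y == i) (dep h) (dep a).
have /intervalP [_ dh _ _] := Ih.
have leha : dep h <= dep a by apply: maxa; split.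
move=> H; have {}H := H ltac:(by move=> y Iy /eqP Ky; have /intervalP [lty _ _ _] := Iy;
  rewrite minh ?maxa //; split).
rewrite -/(I j) in H.
set d := count _ _ in H *; case: (posnP d) => [d0|]; last by lia.
move=> _; suff : has (fun y => I j y && (K y == i)) (iota 0 m) by rewrite has_count -/d d0.
by apply/hasP; exists y0; rewrite ?mem_m // Iy0 Ky0 eqxx.
Qed.

End ForMap.
End Complete.

(** * Correctness of the algorithm *)

Lemma has_ltP N (b : pred nat) :
  reflect (exists2 i, i < N & b i) (has b (iota 0 N)).
Proof.
by apply: (iffP hasP) => -[i]; rewrite ?mem_iota => lti bi; exists i; rewrite ?mem_iota.
Qed.

Lemma all_ltP N (b : pred nat) :
  reflect (forall i, i < N -> b i) (all b (iota 0 N)).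
Proof.
by apply: (iffP allP) => H i; have := H i; rewrite ?mem_iota add0n.
Qed.

Lemma walk_ext (e e' : rel nat) k u v : e =2 e' -> walk e k u v -> walk e' k u v.
Proof. by move=> ee [p [ep lp sp]]; exists p; rewrite -(eq_path ee). Qed.

Section Bridge.
Variables (N : nat) (inp : seq nat) (par dep : nat -> nat).
Local Notation n := (order_G inp).
Local Notation m := (order_F inp).
Local Notation eG := (edge_G N inp).
Local Notation eF := (edge_F N inp).
Local Notation dg := (digc N inp).
Hypotheses (leN : n.+2 <= N) (lemn : m <= n) (m0 : 0 < m).
Hypotheses (symG : symmetric eG) (rF : rooted m eF par dep).

Lemma edge_G_lt u v : eG u v -> u < n /\ v < n.
Proof. by move=> /and3P []. Qed.

Lemma walkGP k u v : u < N -> v < N ->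
  reflect (walk eG k u v) (walkc N inp 0 0 0 k u v).
Proof. by move=> ltu ltv; have := walkcP leN lemn 0 0 0 k ltu ltv. Qed.

Lemma conncP u v : u < N -> v < N -> reflect (connected eG u v) (connc N inp u v).
Proof.
move=> ltu ltv; apply: (iffP (walkGP N ltu ltv)) => [|[k wk]]; first by exists N.
have bnd x y : eG x y -> y < n by move=> /edge_G_lt [].
by apply: walk_leq (walk_shorten bnd wk); lia.
Qed.

Lemma walkFP k x y : x < N -> y < N ->
  reflect (walk eF k x y) (walkc N inp 1 0 0 k x y).
Proof.
(* Deleting the pair [0], [0] changes nothing because F has no loops. *)
move=> ltx lty; have ee : edgec N inp 1 0 0 =2 eF.
  move=> u v; rewrite /edgec /=; case: (boolP (eF u v)) => // /(edge_par rF) [_ _ ne _].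
  by apply/negP; rewrite orbb => /andP [/eqP eu /eqP ev]; rewrite eu ev in ne.
by apply: (iffP (walkcP leN lemn 1 0 0 k ltx lty)); apply: walk_ext => u v; rewrite ee.
Qed.

Lemma cutP y z a b : a < N -> b < N ->
  reflect (connected (delete_edge eF y z) a b) (walkc N inp 1 y z N a b).
Proof.
move=> lta ltb; apply: (iffP (walkcP leN lemn 1 y z N lta ltb)) => [|[k wk]].
  by exists N.
have bnd u v : delete_edge eF y z u v -> v < n.
  by move=> /andP [/and3P [_ ltv _] _]; lia.
by apply: walk_leq (walk_shorten bnd wk); lia.
Qed.

Definition pin_of U X u x : Prop := exists i, [/\ i < N, pinc N inp U X i,
  u = dg U i - 1 & x = dg X i - 1].

Lemma pin_of_lt U X u x : pin_of U X u x -> u < n /\ x < m.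
Proof. by move=> [i [_ /andP [/andP [? ?] /andP [? ?]] -> ->]]; split; lia. Qed.

Definition demand_of a b j x y : Prop :=
  [/\ j < N, demandc N inp a b j, x = dg a j - 1 & y = dg b j - 1].

Lemma demand_of_lt a b j x y : demand_of a b j x y -> [/\ j < N, x < m & y < m].
Proof. by move=> [? /andP [/andP [? ?] /andP [? ?]] -> ->]; split; lia. Qed.

Lemma cert_of U X a b r : [&& pin_distances N inp U X, edges_covered N inp U X a b,
    isolated_covered N inp U X & demands_long N inp a b r] <->
  cert n m eG eF (pin_of U X) N (demand_of a b) (dg r).
Proof.
split=> [/and4P [h1 h2 h3 h4]|c].
  split.
  - exact: pin_of_lt.
  - move=> u x u' x' k pu pu'; have [ltu ltx] := pin_of_lt pu.
    have [ltu' ltx'] := pin_of_lt pu'.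
    move: pu pu' => [i [lti pi ui xi]] [i' [lti' pi' ui' xi']].
    have /all_ltP := h1 => /(_ i lti) /all_ltP /(_ i' lti'); rewrite pi pi' /= => h.
    have small l : l < N -> walk eG l u u' -> walk eF l x x'.
      move=> ltl wl; have /all_ltP := h => /(_ l ltl) /implyP; rewrite -ui -ui' -xi -xi'.
      by move=> H; apply/walkFP; [lia | lia | apply: H; apply/walkGP => //; lia].
    (* Only lengths below [N] are tested; longer walks shorten to at most [n] steps. *)
    move=> wk; case: (ltnP k N) => ltk; first exact: small.
    have bnd v w : eG v w -> w < n by move=> /edge_G_lt [].
    apply: walk_leq (small n _ (walk_shorten bnd wk)); lia.
  - move=> y z eyz; have /and3P [lty ltz _] := eyz.
    have /all_ltP := h2 => /(_ y ltac:(lia)) /all_ltP /(_ z ltac:(lia)).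
    rewrite eyz /= => /orP [/has_ltP [i lti /has_ltP [i' lti' /and4P [pi pi' ci nw]]]|].
      left; exists (dg U i - 1), (dg X i - 1), (dg U i' - 1), (dg X i' - 1).
      have pu : pin_of U X (dg U i - 1) (dg X i - 1) by exists i.
      have pu' : pin_of U X (dg U i' - 1) (dg X i' - 1) by exists i'.
      have [? ?] := pin_of_lt pu; have [? ?] := pin_of_lt pu'.
      split=> //; first by apply/conncP => //; lia.
      by move/cutP => H; move/negP: nw; apply; apply: H; lia.
    move=> /has_ltP [j ltj /andP [dj nw]]; right.
    have dd : demand_of a b j (dg a j - 1) (dg b j - 1) by [].
    have [_ ? ?] := demand_of_lt dd; exists j, (dg a j - 1), (dg b j - 1); split=> //.
    by move/cutP => H; move/negP: nw; apply; apply: H; lia.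
  - move=> x ltx; have /all_ltP := h3 => /(_ x ltac:(lia)); rewrite ltx /=.
    move=> /orP [/has_ltP [y _ exy]|/has_ltP [i lti /andP [pi /eqP xi]]].
      by left; exists y.
    by right; exists (dg U i - 1), i.
  - exact: demand_of_lt.
  - by move=> j x y x' y' [_ _ -> ->] [_ _ -> ->].
  - move=> j x y dd; have [_ ? ?] := demand_of_lt dd; move: dd => [ltj dj ex ey].
    have /all_ltP := h4 => /(_ j ltj); rewrite dj /= -ex -ey => /walkFP; apply; lia.
apply/and4P; split.
- apply/all_ltP => i lti; apply/all_ltP => i' lti'; apply/implyP => /andP [pi pi'].
  apply/all_ltP => k ltk.
  have pu : pin_of U X (dg U i - 1) (dg X i - 1) by exists i.
  have pu' : pin_of U X (dg U i' - 1) (dg X i' - 1) by exists i'.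
  have [? ?] := pin_of_lt pu; have [? ?] := pin_of_lt pu'.
  apply/implyP => /walkGP wk; apply/walkFP; [lia | lia |].
  by apply: (pin_dist c pu pu'); apply: wk; lia.
- apply/all_ltP => y lty; apply/all_ltP => z ltz; apply/implyP => eyz.
  case: (edge_cover c eyz) => [[u [x [u' [x' [pu pu' cu nc]]]]]|[j [x [y' [dd nc]]]]].
    have [? ?] := pin_of_lt pu; have [? ?] := pin_of_lt pu'.
    move: pu pu' => [i [lti pi ui xi]] [i' [lti' pi' ui' xi']].
    apply/orP; left; apply/has_ltP; exists i => //; apply/has_ltP; exists i' => //.
    rewrite -ui -ui' -xi -xi'; apply/and4P; split=> //.
      by apply/conncP => //; lia.
    by apply/negP => /cutP H; apply: nc; apply: H; lia.
  have [? ? ?] := demand_of_lt dd; move: dd => [ltj dj ex ey].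
  apply/orP; right; apply/has_ltP; exists j => //; rewrite -ex -ey; apply/andP; split=> //.
  by apply/negP => /cutP H; apply: nc; apply: H; lia.
- apply/all_ltP => x ltxN; apply/implyP => ltx.
  case: (isolated_cover c ltx) => [[y exy]|[u [i [lti pi _ xi]]]]; apply/orP.
    left; apply/has_ltP; exists y => //.
    by have /and3P [_ lty _] := exy; lia.
  by right; apply/has_ltP; exists i => //; rewrite pi -xi eqxx.
- apply/all_ltP => j ltj; apply/implyP => dj.
  have dd : demand_of a b j (dg a j - 1) (dg b j - 1) by [].
  have [_ ? ?] := demand_of_lt dd.
  by apply/walkFP; [lia | lia | apply: (dem_long c dd)].
Qed.

Lemma free_componentP U X v :
  reflect (free_comp n eG (pin_of U X) v) (free_component N inp U X v).
Proof.
apply: (iffP and3P) => [[ltv /all_ltP h1 /all_ltP h2]|[ltv h1 h2]].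
  split=> // [w ltw /conncP c|u x [i [lti pi -> _]] /conncP c].
    have := h1 w ltac:(lia); rewrite ltw /= => /negP; apply; apply: c; lia.
  have := h2 i lti; rewrite pi /= => /negP; apply; apply: c; first by lia.
  by move: pi => /andP [? _]; lia.
split=> //; apply/all_ltP.
  move=> w ltwN; apply/implyP => ltw; apply/negP => /conncP c.
  by apply: (h1 w ltw); apply: c; lia.
move=> i lti; apply/implyP => pi; apply/negP => /conncP c.
apply: (h2 (dg U i - 1) (dg X i - 1)); first by exists i.
by apply: c; [lia | move: pi => /andP [? _]; lia].
Qed.

Lemma wideP v d : v < n -> reflect (wide_comp eG v d) (wide N inp v d).
Proof.
move=> ltv; have ltc u : connected eG v u -> u < n.
  move=> [k [p [ep <- _]]]; case/lastP: p ep => [//|p z].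
  by rewrite rcons_path last_rcons => /andP [_ /edge_G_lt []].
apply: (iffP (has_ltP _ _)).
  move=> [u ltu /has_ltP [w ltw /and3P [/conncP cu /conncP cw wd]]].
  exists u, w; split; [by apply: cu; lia | by apply: cw; lia |].
  case/orP: wd => [/eqP|nw]; [by left | right].
  rewrite -subn1 => /walkGP H; move/negP: nw; apply; exact: H.
move=> [u [w [cu cw wd]]]; have ltu := ltc _ cu; have ltw := ltc _ cw.
exists u; first by lia.
apply/has_ltP; exists w; first by lia.
apply/and3P; split; [by apply/conncP => //; lia | by apply/conncP => //; lia |].
case: wd => [->//|nw]; apply/orP; right; rewrite subn1; apply/negP => /walkGP H.
by apply: nw; apply: H; lia.
Qed.

Let table U X i := iteri i (fun i V => mkseq (fun r =>
  if i == 0 then r == 0 : nat else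
  (nth 0 V r != 0) || free_component N inp U X (i - 1) &&
     has (fun r' => (nth 0 V r' != 0) && supply_step N inp (i - 1) r r') (iota 0 N) : nat)
  N) [::].

Lemma table0 U X r : r < N -> (nth 0 (table U X 1) r != 0) = (r == 0).
Proof. by move=> ltr; rewrite /table /= nth_mkseq //; case: (r == 0). Qed.

Lemma tableS U X i r : r < N -> (nth 0 (table U X i.+2) r != 0) =
  (nth 0 (table U X i.+1) r != 0) || free_component N inp U X i &&
  has (fun r' => (nth 0 (table U X i.+1) r' != 0) && supply_step N inp i r r') (iota 0 N).
Proof.
move=> ltr; have nb (c : bool) : ((c : nat) != 0) = c by case: c.
rewrite {1}/table iteriS -/(table U X i.+1) nth_mkseq //.
by rewrite [i.+1 == 0]/= nb subn1.
Qed.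

(** [supply_step] compares only digits below [N], whereas [supply] wants agreement at every other
    index. *)
Let dgN r j := if j < N then dg r j else 0.

(** The first round initializes, so after [i.+1] rounds the table accounts for the vertices below
    [i]. *)
Lemma supplied_sound U X r : r < N -> supplied N inp U X r ->
  exists i, supply n eG (pin_of U X) i (dgN r).
Proof.
move=> ltr; rewrite /supplied -/(table U X N).
suff H i s : s < N -> nth 0 (table U X i.+1) s != 0 ->
    supply n eG (pin_of U X) i (dgN s).
  have NE : N.-1.+1 = N by lia.
  by have := H N.-1 r ltr; rewrite NE => h /h; exists N.-1.
elim: i s => [|i IHi] s lts.
  rewrite table0 // => /eqP ->; apply: supply0 => j; rewrite /dgN.
  by case: ltnP => // ltj; rewrite digcE //; [rewrite /digit div0n mod0n | lia].
rewrite tableS // => /orP [/IHi h|/andP [/free_componentP fr /has_ltP [s' lts'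
    /andP [/IHi h /has_ltP [j ltj /andP [/all_ltP eqd wd]]]]]].
  by apply: supply_skip; apply: h.
have [lti _ _] := fr.
apply: (supply_use (j := j) (h lts')) => //.
  move=> j' /eqP ne; rewrite /dgN; case: ltnP => // ltj'.
  by have := eqd j' ltj'; rewrite (negPf ne) => /eqP.
by rewrite /dgN ltj; apply/wideP.
Qed.

Lemma certificate_sound U X a b r : r < N -> certificate N inp U X a b r ->
  exists f, good_map n m eG eF f.
Proof.
move=> ltr /and5P [h1 h2 h3 h4 h5].
have c := (cert_of U X a b r).1 ltac:(by apply/and4P; split).
have [i si] := supplied_sound ltr h5.
apply: (cert_sound symG edge_G_lt rF _ m0 si); split.
- exact: pin_lt c.
- exact: pin_dist c.
- exact: edge_cover c.
- exact: isolated_cover c.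
- exact: dem_lt c.
- exact: dem_fun c.
- move=> j x y dd; have [ltj _ _] := dem_lt c dd.
  by rewrite /dgN ltj; apply: dem_long c _ _ _ dd.
Qed.

(** Each of the five lists has at most [K] entries; vertices shifted by 1 and lengths up to [m] are
    digits in base [n.+2]. *)
Lemma certificate_complete K f : good_map n m eG eF f -> n.+2 ^ K <= N ->
  (leaf_number m eF).+1 * (4 * leaf_number m eF) <= K -> 2 * leaf_number m eF <= K ->
  exists U X a b r, [/\ U < N, X < N, a < N & [/\ b < N, r < N & certificate N inp U X a b r]].
Proof.
move=> gf leK leK1 leK2.
have [L [E [s [szL szE ct [s0 sb] chain]]]] :=
  small_certificate symG edge_G_lt rF m0 gf.
have ltKN : K < N by apply: leq_trans leK; apply: ltn_expl.
have code g : (forall j, g j < n.+2) -> exists2 w, w < n.+2 ^ K &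
    forall j, j < N -> dg w j = if j < K then g j else 0.
  move=> ltg; have [w ltw wE] := @digit_code n.+2 K g isT ltg.
  by exists w => // j ltj; rewrite digcE ?wE //; lia.
have ltN w : w < n.+2 ^ K -> w < N by move=> ?; lia.
have szLK : size L <= K by lia.
have szEK : size E <= K by lia.
pose p0 := (0, 0).
have memL j : j < size L -> (nth p0 L j).1 < n /\ (nth p0 L j).2 < m.
  by move=> ltj; apply: (pin_lt ct); rewrite -surjective_pairing mem_nth.
have [U ltU UE] := code (fun j => if j < size L then (nth p0 L j).1.+1 else 0)
  ltac:(by move=> j /=; case: (ltnP j (size L)) => [/memL [? ?]|_]; lia).
have [X ltX XE] := code (fun j => if j < size L then (nth p0 L j).2.+1 else 0)
  ltac:(by move=> j /=; case: (ltnP j (size L)) => [/memL [? ?]|_]; lia).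
have memE j : j < size E -> (nth p0 E j).1 < m /\ (nth p0 E j).2 < m.
  move=> ltj; have [] := @dem_lt _ _ _ _ _ _ _ _ ct j (nth p0 E j).1 (nth p0 E j).2 => //.
  by split=> //; rewrite -surjective_pairing.
have [a lta aE] := code (fun j => if j < size E then (nth p0 E j).1.+1 else 0)
  ltac:(by move=> j /=; case: (ltnP j (size E)) => [/memE [? ?]|_]; lia).
have [b ltb bE] := code (fun j => if j < size E then (nth p0 E j).2.+1 else 0)
  ltac:(by move=> j /=; case: (ltnP j (size E)) => [/memE [? ?]|_]; lia).
have pinE u x : pin_of U X u x <-> (u, x) \in L.
  split=> [[i [lti pi -> ->]]|uxL].
    move: pi; rewrite /pinc UE // XE //; case: (ltnP i K) => //= ltiK.
    case: (ltnP i (size L)) => //= ltiL _.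
    by rewrite !subn1 /= -surjective_pairing mem_nth.
  have ltj : index (u, x) L < size L by rewrite index_mem.
  have [ltu ltx] := pin_lt ct uxL.
  exists (index (u, x) L); rewrite /pinc UE ?XE; try lia.
  have ltjK : index (u, x) L < K by lia.
  by rewrite ltj ltjK nth_index //= !subn1 /=; split=> //; lia.
have demE j x y : demand_of a b j x y <-> j < size E /\ nth (0, 0) E j = (x, y).
  split=> [[ltj dj -> ->]|[ltj e]].
    move: dj; rewrite /demandc aE // bE //; case: (ltnP j K) => //= ltjK.
    case: (ltnP j (size E)) => //= ltjE _; split=> //.
    by rewrite !subn1 /= -/p0 -surjective_pairing.
  have [ltx lty] := memE j ltj; rewrite /p0 e /= in ltx lty.
  have ltjK : j < K by lia.
  have ltjN : j < N by lia.
  split=> //; first by rewrite /demandc aE // bE // ltj ltjK /p0 e /=; lia.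
    by rewrite aE // ltj ltjK /p0 e subn1.
  by rewrite bE // ltj ltjK /p0 e subn1.
have digs i w : (forall j, j < N -> dg w j = if j < K then s i j else 0) ->
    forall j, j < N -> dg w j = s i j.
  move=> H j ltj; rewrite H //; case: ltnP => // leKj.
  by have [_ ->] := sb i j => //; lia.
(* The table is indexed by codes, so each intermediate vector of the chain needs one too. *)
have run i : i <= n -> exists w, [/\ w < N, forall j, j < N -> dg w j = s i j
    & nth 0 (table U X i.+1) w != 0].
  elim: i => [|i IHi] lei.
    exists 0; split; [by lia | | by rewrite table0 //; lia].
    by move=> j ltj; rewrite s0 digcE //; [rewrite /digit div0n mod0n | lia].
  have [w [ltw wE nw]] := IHi (ltnW lei).
  case: (chain i lei) => [same|[j [ltj fr eqd wd]]].
    by exists w; split=> // [j ltj|]; [rewrite same wE | rewrite tableS // nw].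
  have [|w' ltw' w'E] := code (s i.+1).
    by move=> l; have [le _] := sb i.+1 l; lia.
  have {}w'E := digs _ _ w'E.
  exists w'; split=> //; first exact: ltN.
  rewrite tableS ?ltN //; apply/orP; right; apply/andP; split.
    apply/free_componentP; have [f1 f2 f3] := fr; split=> // u x /pinE; exact: f3.
  apply/has_ltP; exists w => //; rewrite nw /=.
  have ltjN : j < N by lia.
  apply/has_ltP; exists j => //; apply/andP; split.
    apply/all_ltP => j' ltj'; rewrite wE // w'E //; case: eqP => //= ne.
    by rewrite eqd.
  by rewrite wE // w'E //; apply/wideP.
have [r [ltr rE nr]] := run n (leqnn n).
exists U, X, a, b, r; split; try exact: ltN; split=> //; first exact: ltN.
have supp : supplied N inp U X r.
  rewrite /supplied -/(table U X N).
  have NE : (n + (N - n.+1)).+1 = N by lia.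
  suff h k : nth 0 (table U X (n + k).+1) r != 0 by have := h (N - n.+1); rewrite NE.
  by elim: k => [|k IHk]; rewrite ?addn0 // addnS tableS // IHk.
have /cert_of /and4P [h1 h2 h3 h4] : cert n m eG eF (pin_of U X) N (demand_of a b) (dg r).
  split.
  - by move=> u x /pinE; apply: (pin_lt ct).
  - by move=> u x u' x' k /pinE pu /pinE pu'; apply: (pin_dist ct pu pu').
  - move=> y z /(edge_cover ct) [[u [x [u' [x' [/pinE pu /pinE pu' cu nc]]]]]|].
      by left; exists u, x, u', x'.
    by move=> [j [x [y' [/demE dd nc]]]]; right; exists j, x, y'.
  - move=> x /(isolated_cover ct) [|[u /pinE pu]]; [by left | by right; exists u].
  - by move=> j x y /demand_of_lt.
  - by move=> j x y x' y' /demE d1 /demE d2; apply: (dem_fun ct d1 d2).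
  - move=> j x y dd; have [ltj _ _] := demand_of_lt dd; rewrite rE //.
    by move/demE: dd; apply: (dem_long ct).
by apply/and5P.
Qed.

End Bridge.

(** * Running time *)

Lemma iota_rank (T : finType) : iota 0 #|T| = [seq nat_of_ord (enum_rank x) | x <- enum T].
Proof.
apply: (@eq_from_nth _ 0) => [|i]; rewrite size_iota; first by rewrite size_map -cardE.
move=> lti; pose x := enum_val (Ordinal lti).
rewrite nth_iota // (nth_map x) -?cardE //.
have -> : nth x (enum T) i = x by rewrite /x -(enum_val_nth x (Ordinal lti)).
by rewrite enum_valK.
Qed.

Lemma count_rank (T : finType) (p : pred nat) (A : {pred T}) :
  (forall x, p (enum_rank x) = (x \in A)) -> count p (iota 0 #|T|) = #|A|.
Proof.
move=> pA; rewrite iota_rank count_map -sum1_count big_enum_cond /= -[RHS]sum1_card.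
by apply: eq_bigl => x; rewrite /= pA.
Qed.

Lemma sum_count N (p : pred nat) : \sum_(0 <= i < N) (p i : nat) = count p (iota 0 N).
Proof.
rewrite /index_iota subn0 -sum1_count [RHS]big_mkcond.
by apply: eq_bigr => i _; case: (p i).
Qed.

Lemma count_iota_trunc m N (p : pred nat) : m <= N -> (forall x, p x -> x < m) ->
  count p (iota 0 N) = count p (iota 0 m).
Proof.
move=> leN bnd; rewrite -(subnKC leN) iotaD count_cat -[RHS]addn0; congr (_ + _).
apply/eqP; rewrite -leqn0 leqNgt -has_count; apply/hasPn => x.
by rewrite mem_iota => /andP [lex _]; apply/negP => /bnd; lia.
Qed.

Section Leaves.
Variables (N : nat) (G F : sgraph).
Hypotheses (leN : #|G| <= N) (lemn : #|F| <= #|G|).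
Local Notation inp := (encode G F).

Lemma leaf_number_encode : leaf_number #|F| (edge_F N inp) = #|leaves F|.
Proof.
apply: count_rank => x; rewrite inE /degree; congr (_ <= 1).
by apply: count_rank => y; rewrite inE edge_FE.
Qed.

Lemma leaf_count_encode : leaf_count N inp = #|leaves F|.
Proof.
rewrite -leaf_number_encode /leaf_count sum_count (@count_iota_trunc #|F|).
- apply: eq_in_count => x; rewrite mem_iota add0n /order_F /= => -> /=.
  rewrite sum_count (@count_iota_trunc #|F|) //; first exact: leq_trans leN.
  by move=> y /and3P [].
- exact: leq_trans leN.
- by move=> x /andP [].
Qed.

Lemma edge_G_sym : symmetric (edge_G N inp).
Proof.
have H u v : edge_G N inp u v -> edge_G N inp v u.
  by move=> /(edge_G_rank leN) [a [b [<- <- ab]]]; rewrite edge_GE // adj_sym.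
by move=> u v; apply/idP/idP; apply: H.
Qed.

End Leaves.

Lemma identification_card (G F : sgraph) : Identification G F -> #|F| <= #|G|.
Proof.
move=> /identification_good [f gf]; have [g gK] := fin_all_exists (good_onto gf).
by apply: (leq_card g) => x y e; rewrite -(gK x) e gK.
Qed.

Lemma forest_leaves_gt0 (F : sgraph) : is_forest F -> 0 < #|F| -> 0 < #|leaves F|.
Proof.
move=> forestF /card_gt0P [x0 _].
have [x _ le1] := forest_leaf forestF (in_setT x0).
apply/card_gt0P; exists x; rewrite inE (leq_trans _ le1) // subset_leq_card //.
by apply/subsetP => y; rewrite !inE.
Qed.

Lemma answer_correct (G F : sgraph) N : is_forest F -> 0 < #|F| <= #|G| ->
  #|G|.+2 ^ (8 * #|leaves F| ^ 2) <= N ->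
  answer N (encode G F) <-> Identification G F.
Proof.
move=> forestF /andP [F0 lemn] leK; have l0 := forest_leaves_gt0 forestF F0.
have leN : #|G|.+2 <= N.
  apply: leq_trans leK; rewrite -{1}[#|G|.+2]expn1 leq_exp2l // muln_gt0 expn_gt0.
  by rewrite l0.
have leGN : #|G| <= N by lia.
have [par [dep rF]] := forest_encoding_rooted leGN lemn forestF.
have symG := edge_G_sym F leGN.
rewrite (identification_map leGN lemn) /answer.
rewrite ifF; last by apply/negbTE; rewrite -lt0n.
rewrite /order_F /order_G /= lemn /=; split.
  move=> /has_ltP [U _ /has_ltP [X _ /has_ltP [a _ /has_ltP [b _ /has_ltP [r ltr ct]]]]].
  exact: (@certificate_sound N (encode G F) par dep leN lemn F0 symG rF _ _ _ _ _ ltr ct).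
move=> [f gf].
have lE := leaf_number_encode leGN lemn.
have [||U [X [a [b [r [ltU ltX lta [ltb ltr ct]]]]]]] :=
    @certificate_complete N (encode G F) par dep leN lemn F0 symG rF _ f gf leK.
(* The constant 8 arises here, from [(l + 1) * 4l <= 8l^2] for [l >= 1]. *)
- by rewrite /order_F /= lE; move: l0; set l := #|_|; nia.
- by rewrite /order_F /= lE; move: l0; set l := #|_|; nia.
apply/has_ltP; exists U => //; apply/has_ltP; exists X => //.
apply/has_ltP; exists a => //; apply/has_ltP; exists b => //.
by apply/has_ltP; exists r.
Qed.

(** [mulc] truncates only its second factor, which here equals the loop bound, so the product may
    grow beyond that bound. *)
Lemma bound2_correct (G F : sgraph) : 0 < #|F| <= #|G| ->
  bound2 #|G|.+2 (encode G F) = #|G|.+2 ^ (8 * #|leaves F| ^ 2).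
Proof.
move=> /andP [F0 lemn]; set b := #|G|.+2; have leb : #|G| <= b by rewrite /b; lia.
rewrite /bound2 /trivial_instance ifF; last first.
  by apply/negbTE; rewrite negb_or -lt0n -leqNgt F0.
rewrite leaf_count_encode //; set l := #|leaves F|.
have lel : l <= b by apply: leq_trans (max_card _) _; lia.
have mulE x : mulc b x (order_G (encode G F)).+2 = x * b.
  by rewrite mulcE (minn_idPl _).
have foldE k c acc : iteri k (fun j x => if j < l then x * c else x) acc
    = acc * c ^ minn k l.
  elim: k => [|k /= ->]; first by rewrite min0n muln1.
  case: (ltnP k l) => ltk; last by rewrite (minn_idPr (leqW ltk)).
  by rewrite (minn_idPl ltk) expnSr mulnA.
have eq_iteri k (g h : nat -> nat -> nat) x : (forall i y, g i y = h i y) ->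
    iteri k g x = iteri k h x by move=> gh; elim: k => //= k ->.
rewrite (eq_iteri _ _ (fun i x => if i < l then x * (b ^ 8) ^ l else x)); last first.
  move=> i x; rewrite (eq_iteri _ _ (fun j x => if j < l then x * b ^ 8 else x)).
    by rewrite foldE (minn_idPr lel).
  by move=> j y; rewrite !mulE !expnSr expn0 mul1n !mulnA.
rewrite foldE (minn_idPr lel) mul1n -!expnM; congr (b ^ _); lia.
Qed.

(** For [n >= 2], [n + 4 <= n^3] and [n + 2 <= n^2], so the loop bound is at most [n^(16 l^2)], and
    adding 2 costs one more factor [n]: hence 17. For [n = 1] the powers of [n] are useless, and the
    terms [5 ^ c0] and [(3 ^ 8).+2 ^ c0] are the values at [n = l = 1]. *)
Lemma time_bound c0 n l t : 0 < l -> 0 < n -> (n = 1 -> l = 1) ->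
  t <= c0 + n.+2.+2 ^ c0 + (n.+2 ^ (8 * l ^ 2)).+2 ^ c0 ->
  t <= (2 + 17 * c0 + c0 + 5 ^ c0 + (3 ^ 8).+2 ^ c0)
       * n ^ ((2 + 17 * c0 + c0 + 5 ^ c0 + (3 ^ 8).+2 ^ c0) * l ^ 2)
       + (2 + 17 * c0 + c0 + 5 ^ c0 + (3 ^ 8).+2 ^ c0).
Proof.
move=> l0 n0 n1; set c := 2 + _ + _ + _ + _ => let_.
have l2 : 0 < l ^ 2 by rewrite expn_gt0 l0.
case: (eqVneq n 1) => [en|ne].
  move: let_; rewrite (n1 en) en !exp1n !muln1 => let_; apply: leq_trans let_ _.
  rewrite /c; move: (5 ^ c0) ((3 ^ 8).+2 ^ c0) => x y; lia.
have n2 : 1 < n by lia.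
have A : n.+2.+2 ^ c0 <= n ^ (17 * c0 * l ^ 2).
  apply: (@leq_trans ((n ^ 3) ^ c0)); last by rewrite -expnM leq_exp2l //; nia.
  have : n.+2.+2 <= n ^ 3 by rewrite !expnS expn0; nia.
  by move=> le; case: (c0) => // k; rewrite leq_exp2r.
have B : (n.+2 ^ (8 * l ^ 2)).+2 ^ c0 <= n ^ (17 * c0 * l ^ 2).
  have -> : 17 * c0 * l ^ 2 = (17 * l ^ 2) * c0 by lia.
  rewrite [n ^ _]expnM; case: (c0) => // k; rewrite leq_exp2r //.
  have le1 : n.+2 ^ (8 * l ^ 2) <= n ^ (16 * l ^ 2).
    have -> : 16 * l ^ 2 = 2 * (8 * l ^ 2) by lia.
    rewrite [n ^ _]expnM; have le : n.+2 <= n ^ 2 by rewrite !expnS expn0; nia.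
    by rewrite leq_exp2r //; lia.
  have le2 : n * n ^ (16 * l ^ 2) <= n ^ (17 * l ^ 2).
    by rewrite -expnS leq_exp2l //; lia.
  have le3 : 2 <= n ^ (16 * l ^ 2).
    by rewrite (leq_trans n2) // -{1}[n]expn1 leq_exp2l //; lia.
  by nia.
have C : n ^ (17 * c0 * l ^ 2) <= n ^ (c * l ^ 2).
  by rewrite leq_exp2l // leq_mul2r /c; apply/orP; right; lia.
have c2 : 2 <= c by rewrite /c; lia.
have c3 : c0 <= c by rewrite /c; lia.
move: (n ^ (c * l ^ 2)) C let_ A B => x C; move: (n ^ (17 * _ * _)) C => y C.
by nia.
Qed.

Theorem theorem3p13 :
  exists (P : program) (c : nat),
    forall G F : sgraph, is_forest F ->
      answers_within P (encode G F) (Identification G F)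
        (c * #|G| ^ (c * #|leaves F| ^ 2) + c).
Proof.
have [e0 E0] := def_bound1; have [e1 E1] := def_bound2; have [e2 E2] := def_answer.
have [P [c0 HP]] := staged_program e0 e1 e2.
pose d := 2 + 17 * c0 + c0 + 5 ^ c0 + (3 ^ 8).+2 ^ c0.
(* The second summand pays for trivial instances, where both loop bounds are 2. *)
exists P, (d + (c0 + 4 ^ c0 + 4 ^ c0)) => G F forestF; set c := d + _.
have [t [let_ halt val]] := HP (encode G F) _ _ erefl erefl.
move: let_ val.
rewrite (E0 (2, encode G F)) (E1 (_, encode G F)) (E2 (_, encode G F)) /= => let_ val.
exists t; rewrite val /bound1 in let_ *.
have eqb (b : bool) : ((b : nat) != 0) = b by case: b.
case: (boolP (trivial_instance (encode G F))) let_ => [triv|ntriv].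
  rewrite /bound2 triv => let_; split=> //; first by rewrite /c; lia.
  rewrite eqb /answer; move: triv; rewrite /trivial_instance /order_F /order_G /=.
  case: eqP => [F0 _|_ /= ltm]; last first.
    by rewrite leqNgt ltm /=; split=> // /identification_card; rewrite leqNgt ltm.
  have lemn : #|F| <= #|G| by rewrite F0.
  rewrite (identification_map (leqnn _) lemn) F0; split=> [/eqP G0|[f [lt _ _ _]]].
    exists id; rewrite G0; split=> // [u v /and3P []|x y /and3P []].
      by rewrite /order_G /= G0.
    by rewrite /order_F /= F0.
  by rewrite -leqn0 leqNgt; apply/negP => /lt.
move: ntriv; rewrite /trivial_instance negb_or -lt0n -leqNgt /order_F /order_G /=.
move=> nt; rewrite bound2_correct // => let_.
have /andP [F0 lemn] := nt; have l0 := forest_leaves_gt0 forestF F0.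
split=> //; last by rewrite eqb; apply: answer_correct.
have n0 : 0 < #|G| := leq_trans F0 lemn.
have n1 : #|G| = 1 -> #|leaves F| = 1.
  move=> G1; apply/eqP; rewrite eqn_leq l0 andbT -G1.
  exact: leq_trans (max_card _) lemn.
have dc : d <= c by rewrite /c; lia.
apply: leq_trans (time_bound l0 n0 n1 let_) _; rewrite -/d.
apply: leq_add => //; apply: leq_mul => //; rewrite leq_pexp2l //.
by rewrite leq_mul2r dc orbT.
Qed.
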